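(* Let $N\ge 2$ and let $V\subset\mathbb{R}^{N-1}$ be the Sierpiński gasket with intrinsic boundary $V_0$ and measure $\mu$. Let $\alpha\in L^1(V)=L^1(V,\mu)$ satisfy either (A1) $\alpha(x)\le 0$ for a.e. $x\in V$, or (A2) $\displaystyle\int_V|\alpha(x)|\,d\mu<\frac{1}{(2N+3)^2}$. Let $f:V\times\mathbb{R}\to\mathbb{R}$ be a continuous function such that $f(x,0)\ne 0$ for any $x\in V$ and such that there are $\nu>2$ and $r_0>0$ with $$t f(x,t)\le \nu F(x,t)<0\quad\text{for any } |t|\ge r_0,\ x\in V,$$ where $F(x,t):=\int_0^t f(x,s)\,ds$ for any $(x,t)\in V\times\mathbb{R}$. Put $$\kappa:=\begin{cases}2N+3 & \text{if (A1) holds},\\[2mm] \dfrac{2N+3}{\sqrt{1-(2N+3)^2\int_V|\alpha(x)|\,d\mu}} & \text{if (A2) holds}.\end{cases}$$ Then for any $\varrho>0$ and any $\lambda$ with $$0<\lambda<\frac{\varrho}{2\displaystyle\max_{x\in V,\ |s|\le \kappa\sqrt{\varrho}}\left|\int_0^s f(x,t)\,dt\right|},$$ the problem $$\Delta u(x)+\alpha(x)u(x)=\lambda f(x,u(x))\quad (x\in V\setminus V_0),\qquad u|_{V_0}=0,$$ admits at least two non-trivial weak solutions, one of which lies in $$\mathbb{B}_\varrho:=\{u\in H_0^1(V):\ \|u\|_\alpha<\sqrt{\varrho}\}.$$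
   Context: **Sierpiński gasket.** Let $N\ge2$ be a natural number and let $p_1,\dots,p_N\in\mathbb{R}^{N-1}$ satisfy $|p_i-p_j|=1$ for $i\ne j$. Let $S_i(x)=\frac12x+\frac12p_i$ for $i=1,\dots,N$, and for $A\subset\mathbb{R}^{N-1}$ let $L(A)=\bigcup_{i=1}^N S_i(A)$. The Sierpiński gasket $V$ is the unique non-empty compact set with $L(V)=V$; its intrinsic boundary is $V_0=\{p_1,\dots,p_N\}$. The measure $\mu$ is the restriction to $V$ of the $d$-dimensional Hausdorff measure, $d=\log N/\log 2$, normalized so that $\mu(V)=1$. **Energy and function space.** Let $V_m:=L(V_{m-1})$ for $m\ge1$ and $V_*:=\bigcup_{m\ge0}V_m$. Distinct points $x,y\in V_m$ are called $m$-neighbours, written $x\sim_m y$, if both belong to the same set $S_{i_1}\circ\dots\circ S_{i_m}(V_0)$ for some $i_1,\dots,i_m\in\{1,\dots,N\}$ (then $|x-y|=2^{-m}$). For $u:V_*\to\mathbb{R}$ let $$W_m(u):=\left(\frac{N+2}{N}\right)^m\sum_{x,y\in V_m,\ x\sim_m y}(u(x)-u(y))^2 ,$$ the sum being over ordered pairs $(x,y)$. The sequence $W_m(u)$ is nondecreasing in $m$; let $W(u):=\lim_{m\to\infty}W_m(u)\in[0,\infty]$. A function on $V$ is restricted to $V_*$ when these are applied. Let $C_0(V)=\{u\in C(V):u|_{V_0}=0\}$ and $$H_0^1(V):=\{u\in C_0(V):W(u)<\infty\},\qquad \|u\|:=\sqrt{W(u)},$$ a Hilbert space with inner product $$\mathcal{W}(u,v):=\lim_{m\to\infty}\left(\frac{N+2}{N}\right)^m\sum_{x,y\in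 V_m,\ x\sim_m y}(u(x)-u(y))(v(x)-v(y)).$$ For $\alpha\in L^1(V)$ satisfying the hypotheses of the claim, a norm on $H_0^1(V)$ equivalent to $\|\cdot\|$ is $$\|u\|_\alpha:=\sqrt{W(u)-\int_V\alpha(x)|u(x)|^2\,d\mu}.$$ **Weak Laplacian and weak solutions.** The weak Laplacian $\Delta u$ of $u\in H_0^1(V)$ is defined by $\langle\Delta u,v\rangle=-\mathcal{W}(u,v)$ for all $v\in H_0^1(V)$. A function $u\in H_0^1(V)$ is a weak solution of the problem in the claim if $$\mathcal{W}(u,v)-\int_V\alpha(x)u(x)v(x)\,d\mu+\lambda\int_V f(x,u(x))v(x)\,d\mu=0\quad\text{for all }v\in H_0^1(V).$$ Non-trivial means not identically zero. *)

(* Defs.v *)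
From HB Require Import structures.
From mathcomp Require Import all_boot all_order all_algebra.
From mathcomp Require Import all_classical all_reals all_analysis.

Set Implicit Arguments.
Unset Strict Implicit.
Unset Printing Implicit Defensive.

Import Order.TTheory GRing.Theory Num.Theory.
Import numFieldNormedType.Exports.

Local Open Scope classical_set_scope.
Local Open Scope ring_scope.

(* R^n with its Borel sigma-algebra.  The topology of 'rV[R]_n is the product
   topology, i.e. the Euclidean one; the library's norm on 'rV[R]_n, however,
   is the sup norm, hence [enorm] below. *)
Notation borelRn R n := (g_sigma_algebraType (@open 'rV[R]_n)).

Section HausdorffMeasure.
Context {R : realType} {n : nat}.
Implicit Types A : set 'rV[R]_n.

Definition enorm (x : 'rV[R]_n) : R := Num.sqrt (\sum_j x ord0 j ^+ 2).

(* The diameter of the empty set is 0. *)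
Definition ediam A : \bar R :=
  maxe 0%E (ereal_sup [set (enorm (x - y))%:E | x in A & y in A]).

Definition hausdorff_premeasure (d delta : R) A : \bar R :=
  ereal_inf [set (\sum_(0 <= i <oo) (ediam (U i) `^ d))%E | U in
    [set U : nat -> set 'rV[R]_n |
      (forall i, (ediam (U i) <= delta%:E)%E) /\ A `<=` \bigcup_i U i]].

(* Supremum over delta > 0, i.e. the limit as delta decreases to 0.  No
   dimensional constant is included. *)
Definition hausdorff (d : R) A : \bar R :=
  ereal_sup [set hausdorff_premeasure d delta A | delta in [set e : R | 0 < e]].

End HausdorffMeasure.

Section Gasket.
Context {R : realType} {N : nat}.
Local Notation E := 'rV[R]_N.-1.
Variable p : 'I_N -> E.

Definition unit_simplex : Prop :=
  forall i j : 'I_N, i != j -> enorm (p i - p j) = 1.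

Definition simil (i : 'I_N) (x : E) : E := 2^-1 *: x + 2^-1 *: p i.

Definition hutchinson (A : set E) : set E :=
  \bigcup_(i : 'I_N) (simil i @` A).

Definition gasket (V : set E) : Prop :=
  [/\ V !=set0, compact V & hutchinson V = V].

Definition boundary0 : set E := range p.

(* For [mu V = 1] to hold, the Hausdorff measure of V is necessarily finite and
   positive, with inverse c. *)
Definition gasket_measure (V : set E)
    (mu : {measure set (borelRn R N.-1) -> \bar R}) : Prop :=
  (exists2 c : R, 0 < c &
    forall A : set (borelRn R N.-1), measurable A ->
      mu A = (c%:E * hausdorff (ln N%:R / ln 2) (A `&` V))%E) /\
  mu V = 1%E.

Definition level (m : nat) : set E := iter m hutchinson boundary0.

(* S_{i_1} o ... o S_{i_m} (V_0) for w = (i_1, ..., i_m). *)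
Definition cell (w : seq 'I_N) : set E :=
  [set foldr simil x w | x in boundary0].

Definition neighbours (m : nat) (x y : E) : Prop :=
  [/\ x <> y, level m x, level m y &
      exists w : m.-tuple 'I_N, cell w x /\ cell w y].

Definition energy_form (m : nat) (u v : E -> R) : R :=
  ((N + 2)%:R / N%:R) ^+ m *
  \sum_(z \in [set z : E * E | neighbours m z.1 z.2])
     (u z.1 - u z.2) * (v z.1 - v z.2).

Definition energy (u : E -> R) : \bar R :=
  limn (fun m => (energy_form m u u)%:E).

Definition energy_inner (u v : E -> R) : R :=
  limn (fun m => energy_form m u v).

(* Functions on V are represented by functions on the whole space, of which
   only the values on V matter. *)
Definition H01 (V : set E) (u : E -> R) : Prop :=
  [/\ {within V, continuous u},
      (forall i, u (p i) = 0) & (energy u < +oo)%E].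

Definition alpha_norm (V : set E)
    (mu : {measure set (borelRn R N.-1) -> \bar R})
    (alpha u : E -> R) : R :=
  Num.sqrt (fine (energy u) - \int[mu]_(x in V) (alpha x * `|u x| ^+ 2)).

Definition weak_solution (V : set E)
    (mu : {measure set (borelRn R N.-1) -> \bar R})
    (alpha : E -> R) (f : E -> R -> R) (lambda : R) (u : E -> R) : Prop :=
  H01 V u /\
  forall v, H01 V v ->
    energy_inner u v - \int[mu]_(x in V) (alpha x * u x * v x)
      + lambda * \int[mu]_(x in V) (f x (u x) * v x) = 0.

End Gasket.

(* The oriented integral of g from 0 to t, for t of either sign. *)
Definition primitive0 {R : realType} (g : R -> R) (t : R) : R :=
  if 0 <= t then \int[lebesgue_measure]_(s in `[0, t]) g s
  else - \int[lebesgue_measure]_(s in `[t, 0]) g s.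

(* Main.v *)
Require Import Defs.
From HB Require Import structures.
From mathcomp Require Import all_boot all_order all_algebra.
From mathcomp Require Import all_classical all_reals all_analysis.
From mathcomp Require Import ring lra.

Set Implicit Arguments.
Unset Strict Implicit.
Unset Printing Implicit Defensive.

Import Order.TTheory GRing.Theory Num.Theory.
Import numFieldNormedType.Exports.

Local Open Scope classical_set_scope.
Local Open Scope ring_scope.

(** The weak solutions are the critical points, on the space [H01] of functions of
    finite energy vanishing at the vertices, of
      [action u = (nrm u) ^ 2 / 2 + lambda * (integral of F(x, u(x)) over V)],
    where nrm is the norm of the form [alpha_form] and F, called [primitive0] of
    f(x, .), is the primitive in the second variable.  One is found at a level <= 0 and
    another at a positive level.

    The energy space.  By self-similarity the graph energy of level m + 1 is
    (N + 2) / N times the sum of the energies of level m of the restrictions to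
    the N cells ([cell_energy]).  Harmonic extension from the vertices of a cell to
    those of its subcells preserves this energy, and every other extension has a
    larger one ([harm_min]), so the energies increase.  Energy at most W bounds the
    oscillation on a cell of level m by a constant times the square root of W times
    the m-th power of a ratio q < 1 ([cell_osc]).  This gives the supremum bound
    [H01_sup], and turns pointwise into uniform convergence for sequences of bounded
    energy ([limit_uniform]); completeness of the space and compactness of its balls
    in the supremum norm both follow.  With either hypothesis on alpha the form is
    equivalent to the energy ([alpha_coercive]), and functions of norm at most r
    take values of modulus at most kappa r ([alpha_nrm_sup]).

    The gradient of the action is u + G u, with G u the Riesz representative of
    v |-> lambda * (integral of f(x, u(x)) v(x)).  As G u depends continuously on u in
    the supremum norm, bounded Palais-Smale sequences converge ([action_ps]).

    The solutions.  On the ball of radius sqrt rho the integral of F is at most the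
    maximum S in the bound on lambda, so the action is positive near the sphere,
    whereas it vanishes at 0: it has a critical point inside the ball, at a level
    <= 0 ([critical_in_ball]).  The superquadratic inequality for f makes F go to
    minus infinity faster than any multiple of t ^ 2 ([primitive0_superquadratic]),
    so along a ray through a positive function ([test_function]) the action stays
    bounded above by some C; it also makes the action decrease in the radial direction
    at points of level <= C + 1 far from 0.  Hence 0 can be joined to infinity below
    a finite level, but not below the positive level imposed by the sphere, and the
    mountain pass argument [mountain_pass] yields a critical point at a positive
    level.  Both arguments use a single explicit gradient step ([gradient_step]),
    with chains of small mesh in place of paths, because the gradient is uniformly
    continuous on bounded sets.

    Neither solution is zero: 0 being a solution would make f(x, 0), which has a
    constant sign on the connected set V, orthogonal to the positive test function
    ([weak_solution_neq0]), whose zeros, the vertices, are a null set for the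
    Hausdorff measure ([hausdorff_corners]). *)


(** * Positive semidefinite forms *)

Section PsdForm.
Context {R : realType} {L : lmodType R}.

(** The form is only constrained on a subspace D of L: the energy form is a
    limit, which means nothing outside the functions of finite energy. *)
Record psd_form (D : set L) (B : L -> L -> R) : Prop := PsdForm {
  psd_0 : D 0;
  psd_D : forall u v, D u -> D v -> D (u + v);
  psd_Z : forall a u, D u -> D (a *: u);
  psd_sym : forall u v, D u -> D v -> B u v = B v u;
  psd_addl : forall u v w, D u -> D v -> D w -> B (u + v) w = B u w + B v w;
  psd_scalel : forall a u w, D u -> D w -> B (a *: u) w = a * B u w;
  psd_ge0 : forall u, D u -> 0 <= B u u }.

Definition nrm (B : L -> L -> R) (u : L) : R := Num.sqrt (B u u).

Context {D : set L} {B : L -> L -> R} (hB : psd_form D B).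

Let D0 : D 0 := psd_0 hB.
Let DD := psd_D hB.
Let DZ := psd_Z hB.

Lemma psd_N u : D u -> D (- u).
Proof. by move=> Du; rewrite -scaleN1r; exact: DZ. Qed.

Lemma psd_B u v : D u -> D v -> D (u - v).
Proof. by move=> Du Dv; apply: DD => //; exact: psd_N. Qed.

Lemma psd_addr u v w : D u -> D v -> D w -> B w (u + v) = B w u + B w v.
Proof.
move=> Du Dv Dw.
by rewrite !(psd_sym hB Dw) ?(psd_addl hB) //; exact: DD.
Qed.

Lemma psd_scaler a u w : D u -> D w -> B w (a *: u) = a * B w u.
Proof.
move=> Du Dw.
by rewrite !(psd_sym hB Dw) ?(psd_scalel hB) //; exact: DZ.
Qed.

Lemma psd_oppl u w : D u -> D w -> B (- u) w = - B u w.
Proof. by move=> Du Dw; rewrite -scaleN1r (psd_scalel hB) // mulN1r. Qed.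

Lemma psd_oppr u w : D u -> D w -> B w (- u) = - B w u.
Proof. by move=> Du Dw; rewrite -scaleN1r psd_scaler // mulN1r. Qed.

Lemma psd_subl u v w : D u -> D v -> D w -> B (u - v) w = B u w - B v w.
Proof.
move=> Du Dv Dw.
by rewrite (psd_addl hB) ?psd_oppl //; exact: psd_N.
Qed.

Lemma psd_sqrD u v : D u -> D v ->
  B (u + v) (u + v) = B u u + 2 * B u v + B v v.
Proof.
move=> Du Dv; have Duv := DD Du Dv.
rewrite (psd_addl hB) // !psd_addr // (psd_sym hB Dv Du); ring.
Qed.

Lemma psd_sqrZ a u : D u -> B (a *: u) (a *: u) = a ^+ 2 * B u u.
Proof.
move=> Du; rewrite (psd_scalel hB) ?psd_scaler //; last exact: DZ.
by rewrite mulrA expr2.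
Qed.

Lemma nrm_ge0 u : 0 <= nrm B u. Proof. exact: sqrtr_ge0. Qed.

Lemma nrm_sqr u : D u -> nrm B u ^+ 2 = B u u.
Proof. by move=> Du; rewrite sqr_sqrtr // (psd_ge0 hB). Qed.

Lemma nrmZ a u : D u -> nrm B (a *: u) = `|a| * nrm B u.
Proof.
by move=> Du; rewrite /nrm psd_sqrZ // sqrtrM ?sqr_ge0 // sqrtr_sqr.
Qed.

Lemma nrmN u : D u -> nrm B (- u) = nrm B u.
Proof. by move=> Du; rewrite -scaleN1r nrmZ // normrN1 mul1r. Qed.

Lemma nrm0 : nrm B 0 = 0.
Proof. by rewrite -(scale0r (0 : L)) nrmZ // normr0 mul0r. Qed.

Lemma nrm_le u c : D u -> 0 <= c -> (nrm B u <= c) = (B u u <= c ^+ 2).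
Proof.
move=> Du c0; rewrite -nrm_sqr // ler_sqr ?nnegrE //; exact: nrm_ge0.
Qed.

(** Expanding the square of [B v v *: u - B u v *: v] settles the case
    [0 < B v v]; both squares can vanish, as the form is only semidefinite, and
    then the squares of u + v and u - v bound [B u v] from both sides. *)
Lemma cauchy_schwarz u v : D u -> D v -> `|B u v| <= nrm B u * nrm B v.
Proof.
move=> Du Dv.
have key x y : D x -> D y -> 0 < B y y -> B x y ^+ 2 <= B x x * B y y.
  move=> Dx Dy y0.
  have Dc := DD (DZ (B y y) Dx) (DZ (- B x y) Dy).
  have := psd_ge0 hB Dc.
  rewrite psd_sqrD; [|exact: DZ..].
  rewrite !psd_sqrZ // (psd_scalel hB) ?psd_scaler //; last exact: DZ.
  rewrite (_ : _ + _ + _ = B y y * (B x x * B y y - B x y ^+ 2)); last by ring.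
  by rewrite pmulr_rge0 // subr_ge0.
have sq : B u v ^+ 2 <= B u u * B v v.
  have [v0|v0] := ltP 0 (B v v); first exact: key.
  have [u0|u0] := ltP 0 (B u u).
    by rewrite (psd_sym hB Du Dv) mulrC; exact: key.
  have vz : B v v = 0 by apply/eqP; rewrite eq_le v0 (psd_ge0 hB).
  have uz : B u u = 0 by apply/eqP; rewrite eq_le u0 (psd_ge0 hB).
  have := psd_ge0 hB (DD Du Dv); rewrite psd_sqrD // uz vz => p1.
  have := psd_ge0 hB (DD Du (psd_N Dv)).
  rewrite psd_sqrD ?psd_oppr ?psd_oppl ?uz ?vz //; try exact: psd_N.
  move=> p2; have -> : B u v = 0 by lra.
  by rewrite expr0n mulr0.
rewrite -ler_sqr ?nnegrE ?mulr_ge0 ?nrm_ge0 //.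
by rewrite exprMn !nrm_sqr // real_normK // num_real.
Qed.

Lemma nrmD u v : D u -> D v -> nrm B (u + v) <= nrm B u + nrm B v.
Proof.
move=> Du Dv.
rewrite nrm_le ?addr_ge0 ?nrm_ge0 //; last exact: DD.
rewrite psd_sqrD // sqrrD !nrm_sqr //.
have := le_trans (ler_norm _) (cauchy_schwarz Du Dv); lra.
Qed.

Lemma nrmB u v : D u -> D v -> nrm B (u - v) <= nrm B u + nrm B v.
Proof.
by move=> Du Dv; rewrite -(nrmN Dv); apply: nrmD => //; exact: psd_N.
Qed.

Lemma nrm_dist u v : D u -> D v -> nrm B u <= nrm B v + nrm B (u - v).
Proof.
move=> Du Dv.
by have := nrmD Dv (psd_B Du Dv); rewrite addrC subrK.
Qed.

Lemma nrm_distC u v : D u -> D v -> nrm B (u - v) = nrm B (v - u).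
Proof. by move=> Du Dv; rewrite -(nrmN (psd_B Dv Du)) opprB. Qed.

Definition psd_complete := forall s : nat -> L, (forall n, D (s n)) ->
  (forall e, 0 < e -> exists n0, forall m n, (n0 <= m)%N -> (n0 <= n)%N ->
     nrm B (s m - s n) <= e) ->
  exists2 u, D u & forall e, 0 < e ->
    exists n0, forall n, (n0 <= n)%N -> nrm B (s n - u) <= e.

(** Riesz representation by the direct method: the parallelogram identity makes
    every minimizing sequence of [B w w / 2 - ell w] a Cauchy sequence, and its
    limit represents ell. *)
Lemma riesz (ell : L -> R) (c : R) : psd_complete ->
  (forall u v, D u -> D v -> ell (u + v) = ell u + ell v) ->
  (forall a u, D u -> ell (a *: u) = a * ell u) ->
  (forall v, D v -> `|ell v| <= c * nrm B v) ->
  exists2 g, D g & forall v, D v -> B g v = ell v.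
Proof.
move=> cpl ellD ellZ ellb.
pose q w := B w w / 2 - ell w.
pose Q := [set q w | w in D].
have Qlb : lbound Q (- (c ^+ 2 / 2)).
  move=> _ [w Dw <-]; rewrite /q -nrm_sqr //.
  have h1 := le_trans (ler_norm _) (ellb _ Dw).
  have := sqr_ge0 (nrm B w - c); rewrite sqrrB; lra.
have hQ : has_inf Q.
  by split; [exists (q 0); exists 0|exists (- (c ^+ 2 / 2))].
have Qinf w : D w -> inf Q <= q w.
  by move=> Dw; apply: ge_inf; [case: hQ|exists w].
have /choice[s hs] : forall n : nat, exists w, D w /\ q w < inf Q + n.+1%:R^-1.
  move=> n.
  have [|_ [w Dw <-] qw] := @inf_adherent _ Q (n.+1%:R^-1) _ hQ.
    by rewrite invr_gt0 ltr0n.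
  by exists w.
have Ds n : D (s n) by case: (hs n).
have qs n : q (s n) < inf Q + n.+1%:R^-1 by case: (hs n).
have sC m n : B (s m - s n) (s m - s n) <= 4 * (m.+1%:R^-1 + n.+1%:R^-1).
  have Dmn := DZ 2^-1 (DD (Ds m) (Ds n)).
  have := Qinf _ Dmn; have := qs m; have := qs n; rewrite /q.
  rewrite psd_sqrZ ?ellZ ?ellD ?psd_sqrD ?psd_oppr ?psd_oppl //; try exact: DD;
    try exact: psd_N.
  have -> : (2^-1 : R) ^+ 2 = 4^-1 by field.
  move: (m.+1%:R^-1) (n.+1%:R^-1) => em en; lra.
have invn e : 0 < e -> exists n0 : nat, forall n, (n0 <= n)%N ->
    (n.+1%:R^-1 : R) <= e.
  move=> e0; exists (Num.truncn e^-1) => n hn.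
  rewrite -[e]invrK lef_pV2 ?posrE ?invr_gt0 // ?ltr0n //.
  apply: le_trans (ltW (truncnS_gt _)) _.
  by rewrite ler_nat ltnS.
have [e e0|u Du su] := cpl s Ds.
  have [|n0 hn0] := invn (e ^+ 2 / 8); first by rewrite divr_gt0 ?exprn_gt0.
  exists n0 => m n hm hn; rewrite nrm_le ?(ltW e0) //; last exact: psd_B.
  have := sC m n; have := hn0 _ hm; have := hn0 _ hn.
  move: (m.+1%:R^-1) (n.+1%:R^-1) => em en; lra.
exists u => // v Dv.
(* [q (u + t *: v) >= q u], in the limit from the near-minimality of s n. *)
have lim_ineq t : 0 <= t * (B u v - ell v) + t ^+ 2 * B v v / 2.
  apply/ler_addgt0Pr => e e0.
  pose k := `|t| * nrm B v + 1.
  have k0 : 0 < k.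
    by rewrite ltr_wpDl // mulr_ge0 ?normr_ge0 ?nrm_ge0.
  have [|n0 hn0] := invn (e / 2); first by rewrite divr_gt0.
  have [|n1 hn1] := su (e / (2 * k)); first by rewrite divr_gt0 ?mulr_gt0.
  pose n := maxn n0 n1.
  have h0 := hn0 n (leq_maxl _ _); have h1 := hn1 n (leq_maxr _ _).
  have DW : D (s n + t *: v) by apply: DD => //; exact: DZ.
  have := Qinf _ DW; have := qs n; rewrite /q.
  rewrite ellD ?ellZ ?psd_sqrD ?psd_sqrZ ?psd_scaler //; try exact: DZ.
  have : t * (B (s n) v - B u v) <= e / 2.
    apply: le_trans (ler_norm _) _.
    rewrite -psd_subl // normrM.
    have := cauchy_schwarz (psd_B (Ds n) Du) Dv => cs.
    have : `|t| * `|B (s n - u) v| <= (e / (2 * k)) * (`|t| * nrm B v).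
      rewrite mulrCA; apply: ler_wpM2l => //.
      apply: le_trans cs _; apply: ler_wpM2r h1; exact: nrm_ge0.
    move=> /le_trans; apply.
    have : (e / (2 * k)) * (`|t| * nrm B v) <= (e / (2 * k)) * k.
      apply: ler_wpM2l; first by rewrite divr_ge0 ?mulr_ge0 ?ltW.
      by rewrite /k lerDl.
    move=> /le_trans; apply.
    by rewrite le_eqVlt; apply/orP; left; apply/eqP; field; rewrite lt0r_neq0.
  move: h0; move: (n.+1%:R^-1) => en; lra.
have hb : 0 <= B v v by apply: (psd_ge0 hB).
set X := B u v - ell v in lim_ineq.
suff : X = 0 by move/eqP; rewrite subr_eq0 => /eqP.
(* The step nearly minimizes the quadratic; the + 1 covers B v v = 0. *)
have := lim_ineq (- X / (B v v + 1)).
have b1 : 0 < B v v + 1 by rewrite ltr_wpDl.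
rewrite (_ : _ + _ = - X ^+ 2 * (B v v + 2) / (2 * (B v v + 1) ^+ 2)); last first.
  by field; rewrite lt0r_neq0.
rewrite mulNr mulNr oppr_ge0 => h.
apply/eqP; rewrite -sqrf_eq0 eq_le sqr_ge0 andbT.
rewrite -(pmulr_lle0 _ (_ : 0 < (B v v + 2) / (2 * (B v v + 1) ^+ 2))).
  by rewrite mulrA.
by rewrite divr_gt0 ?mulr_gt0 ?exprn_gt0 // ltr_wpDl.
Qed.

End PsdForm.

(** * Two critical points from one descent step *)

Section CriticalPoints.
Context {R : realType} {L : lmodType R} {D : set L} {B : L -> L -> R}.
Context (hB : psd_form D B).
Context {I : L -> R} {g : L -> L}.

Definition critical (u : L) : Prop := D u /\ forall v, D v -> B (g u) v = 0.

(** What is used of a functional I of class C^1 with gradient g: uniformity on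
    balls, and compactness of bounded Palais-Smale sequences. *)
Record smooth_ps : Prop := SmoothPS {
  grad_in : forall u, D u -> D (g u);
  grad_ucont : forall M e, 0 < e -> exists2 d, 0 < d &
    forall u w, D u -> D w -> nrm B u <= M -> nrm B w <= M ->
      nrm B (u - w) <= d -> nrm B (g u - g w) <= e;
  grad_bound : forall M, exists K, forall u, D u -> nrm B u <= M ->
    nrm B (g u) <= K;
  grad_diff : forall M e, 0 < e -> exists2 d, 0 < d &
    forall u h, D u -> D h -> nrm B u <= M -> nrm B h <= d ->
      `|I (u + h) - I u - B (g u) h| <= e * nrm B h;
  palais_smale : forall M a b,
    (forall d, 0 < d -> exists u,
       [/\ D u, nrm B u <= M, a <= I u <= b & nrm B (g u) <= d]) ->
    exists u, [/\ critical u, nrm B u <= M & a <= I u <= b] }.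

Context (hI : smooth_ps).

Let D0 : D 0 := psd_0 hB.
Let DZ := psd_Z hB.
Let Dg := grad_in hI.

Lemma grad_bound_pos M : exists2 K, 0 < K &
  forall u, D u -> nrm B u <= M -> nrm B (g u) <= K.
Proof.
have [K hK] := grad_bound hI M; exists (Num.max K 1).
  by rewrite lt_max ltr01 orbT.
by move=> u Du uM; rewrite le_max hK.
Qed.

(** Bounded gradients make the functional Lipschitz at small distances. *)
Lemma functional_ucont M e : 0 < e -> exists2 d, 0 < d &
  forall u w, D u -> D w -> nrm B u <= M -> nrm B w <= M ->
    nrm B (u - w) <= d -> `|I u - I w| <= e.
Proof.
move=> e0; have [K K0 hK] := grad_bound_pos M.
have [d d0 hd] := grad_diff hI M ltr01.
exists (Num.min d (e / (K + 1))).
  by rewrite lt_min d0 divr_gt0 // addr_gt0.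
move=> u w Du Dw uM wM; rewrite le_min => /andP[uw1 uw2].
have Duw := psd_B hB Du Dw.
have := hd w (u - w) Dw Duw wM uw1.
rewrite subrKC mul1r => h1.
have h2 : `|B (g w) (u - w)| <= K * nrm B (u - w).
  apply: le_trans (cauchy_schwarz hB (Dg Dw) Duw) _.
  by apply: ler_wpM2r; [exact: nrm_ge0|exact: hK].
have h3 : (K + 1) * nrm B (u - w) <= e.
  by rewrite mulrC -ler_pdivlMr // addr_gt0.
rewrite (_ : I u - I w = (I u - I w - B (g w) (u - w)) + B (g w) (u - w)).
  by apply: le_trans (ler_normD _ _) _; lra.
by ring.
Qed.

(** Contrapositive of compactness: without critical points the gradient stays
    away from zero. *)
Lemma grad_gap M a b :
  (forall u, critical u -> nrm B u <= M -> a <= I u <= b -> False) ->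
  exists2 d, 0 < d & forall u, D u -> nrm B u <= M -> a <= I u <= b ->
    d <= nrm B (g u).
Proof.
move=> nocrit; apply: contrapT => nogap.
have [d d0|u [cu uM uI]] := palais_smale hI (M := M) (a := a) (b := b).
  apply: contrapT => nou; apply: nogap; exists d => // u Du uM uI.
  rewrite leNgt; apply/negP => /ltW ud; apply: nou.
  by exists u; split.
exact: (nocrit u).
Qed.

(** The gradient hardly varies along a short step, so that a step of fixed size
    gains a fixed amount at every point with large gradient.  This replaces the
    gradient flow. *)
Lemma gradient_step M d e : 0 < d -> 0 < e ->
  exists2 t, 0 < t & forall u s, D u -> nrm B u <= M -> 0 <= s <= t ->
    s * nrm B (g u) <= e /\
    (d <= nrm B (g u) -> I (u - s *: g u) <= I u - s * (d ^+ 2 / 2)).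
Proof.
move=> d0 e0; have [K K0 hK] := grad_bound_pos M.
have [|del del0 hdel] := grad_diff hI M (_ : 0 < d / 2).
  by rewrite divr_gt0.
exists (Num.min (del / K) (e / K)).
  by rewrite lt_min !divr_gt0.
move=> u s Du uM /andP[s0]; rewrite le_min => /andP[s1 s2].
have gK := hK u Du uM.
have len c : s <= c / K -> s * nrm B (g u) <= c.
  rewrite ler_pdivlMr // => /(le_trans _); apply.
  exact: ler_wpM2l.
split; first exact: len.
move=> dg.
have Dsg : D (- (s *: g u)) by apply: (psd_N hB); apply: DZ; apply: Dg.
have nsg : nrm B (- (s *: g u)) = s * nrm B (g u).
  by rewrite (nrmN hB) ?(nrmZ hB) ?ger0_norm //; [exact: Dg|apply: DZ; exact: Dg].
have := hdel u (- (s *: g u)) Du Dsg uM.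
rewrite nsg => /(_ (len _ s1)).
have Dgu := Dg Du.
rewrite (psd_oppr hB) ?(psd_scaler hB) -?(nrm_sqr hB) //; last exact: DZ.
set G := nrm B (g u) in dg *; set J := I (u - _).
move=> /ler_normlP[_ h].
have : 0 <= s * ((G - d) * (G + d / 2)).
  by rewrite !mulr_ge0 ?subr_ge0 //; lra.
rewrite (_ : s * _ = s * G ^+ 2 - d / 2 * (s * G) - s * (d ^+ 2 / 2)); last by field.
move: h; lra.
Qed.

(** A near-minimizer in the ball stays away from the rim, where I is positive; if its
    gradient were large it could step below the infimum without leaving the ball. *)
Lemma critical_in_ball s e0 m0 K : 0 <= s -> 0 < e0 -> 0 < m0 -> I 0 = 0 ->
  (forall u, D u -> nrm B u <= s -> K <= I u) ->
  (forall u, D u -> s - e0 <= nrm B u <= s -> m0 <= I u) ->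
  exists u, [/\ critical u, nrm B u < s & I u <= 0].
Proof.
move=> s0 e00 m00 I0 Ilb Irim.
have inner u : D u -> nrm B u <= s -> I u <= 0 -> nrm B u < s - e0.
  move=> Du us Iu; rewrite ltNge; apply/negP => h.
  by have := Irim u Du; rewrite h us => /(_ isT); lra.
apply: contrapT => nocrit.
have [u cu us /andP[_ uI]|d d0 hd] := @grad_gap s K 0.
  apply: nocrit; exists u; split => //.
  by have := inner u cu.1 us uI; lra.
have [t t0 ht] := gradient_step s d0 e00.
pose Q := [set I u | u in [set u | D u /\ nrm B u <= s]].
have hQ : has_inf Q.
  split; first by exists (I 0); exists 0 => //; rewrite /= (nrm0 hB).
  by exists K => _ [u [Du us] <-]; exact: Ilb.
have Qinf u : D u -> nrm B u <= s -> inf Q <= I u.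
  by move=> Du us; apply: ge_inf; [case: hQ|exists u].
pose gam := t * (d ^+ 2 / 2).
have gam0 : 0 < gam by rewrite mulr_gt0 // divr_gt0 // exprn_gt0.
have [u [Du us Iu0 Iu]] : exists u,
    [/\ D u, nrm B u <= s, I u <= 0 & I u < inf Q + gam].
  have [_ [u [Du us] <-] Iu] := inf_adherent gam0 hQ.
  have [Iu0|Iu0] := leP (I u) 0; first by exists u.
  exists 0; split; rewrite ?I0 ?(nrm0 hB) //; lra.
have tt : 0 <= t <= t by rewrite lexx (ltW t0).
have [len step] := ht u t Du us tt.
have Iub : K <= I u <= 0 by rewrite Ilb.
have {}step := step (hd u Du us Iub).
have Dn := psd_B hB Du (DZ t (Dg Du)).
have : nrm B (u - t *: g u) <= s.
  apply: le_trans (nrmB hB Du (DZ t (Dg Du))) _.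
  rewrite (nrmZ hB) ?(ger0_norm (ltW t0)) //; last exact: Dg.
  have := inner u Du us Iu0; lra.
move=> /(Qinf _ Dn); move: step Iu; rewrite /gam; lra.
Qed.

(** Chains with small mesh stand in for continuous paths from 0 out of a ball;
    only their last point may lie outside the ball. *)
Inductive chain (r a eta : R) : L -> Prop :=
| chain_nil : chain r a eta 0
| chain_cons u w : chain r a eta u -> nrm B u < r -> D w -> I w <= a ->
    nrm B (w - u) <= eta -> chain r a eta w.

(** All small meshes at once play the role of continuity, and a uniformly
    continuous map preserves this property. *)
Definition escapes r a := forall eta, 0 < eta ->
  exists2 u, chain r a eta u & r <= nrm B u.

Lemma chain_in r a eta u : chain r a eta u -> D u.
Proof. by case. Qed.

Lemma chain_level r a eta u : I 0 <= a -> chain r a eta u -> I u <= a.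
Proof. by move=> Ia; case. Qed.

Lemma chain_nrm r a eta u : 0 <= r -> 0 <= eta -> chain r a eta u ->
  nrm B u <= r + eta.
Proof.
move=> r0 eta0; case=> [|v w cv vr Dw _ vw].
  by rewrite (nrm0 hB) addr_ge0.
apply: le_trans (nrm_dist hB Dw (chain_in cv)) _.
by rewrite lerD // ltW.
Qed.

(** Switches the gradient step off below the level c/2, which keeps the starting
    point 0 of the chains fixed, and fully on above 3c/4. *)
Definition cutoff (c t : R) : R := Num.min 1 (Num.max 0 ((t - c / 2) / (c / 4))).

Lemma cutoff_lip c x y : 0 < c ->
  `|cutoff c x - cutoff c y| <= `|x - y| / (c / 4).
Proof.
move=> c0; have c4 : 0 < c / 4 by lra.
rewrite -[X in _ <= _ / X](gtr0_norm c4) -normf_div.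
rewrite (_ : (x - y) / _ = (x - c / 2) / (c / 4) - (y - c / 2) / (c / 4)); last first.
  by rewrite -mulrBl; congr (_ * _); ring.
rewrite /cutoff; move: ((x - _) / _) ((y - _) / _) => X Y.
have := ler_norm (X - Y); have := ler_norm (Y - X); rewrite (distrC Y).
rewrite ler_norml.
by case: (ltP 0 X) => ?; case: (ltP 0 Y) => ?;
  case: (ltP 1 X) => ?; case: (ltP 1 Y) => ?; case: (ltP (1 : R) 0) => ?; lra.
Qed.

Lemma cutoff_itv c x : 0 <= cutoff c x <= 1.
Proof.
rewrite /cutoff le_min ler01 le_max lexx /= ge_min lexx //.
Qed.

Lemma cutoff0 c x : 0 < c -> x <= c / 2 -> cutoff c x = 0.
Proof.
move=> c0 xc; rewrite /cutoff (max_idPl _).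
  by rewrite min_r.
by rewrite ler_pdivrMr; lra.
Qed.

Lemma cutoff1 c x : 0 < c -> 3 * c / 4 <= x -> cutoff c x = 1.
Proof.
move=> c0 xc; rewrite /cutoff (min_idPl _) // le_max.
by apply/orP; right; rewrite ler_pdivlMr; lra.
Qed.

(** Mountain pass.  The infimum c of the levels at which 0 escapes is positive.
    Were there no critical point at a positive level, a gradient step, switched
    off below c/2, would carry chains of level slightly above c to chains below
    c.  The step fixes 0, and it leaves points of norm >= r outside the ball
    because the functional decreases radially there. *)
Lemma mountain_pass s e0 m0 (e : L) C : 0 <= s -> 0 < e0 -> 0 < m0 -> I 0 = 0 ->
  (forall u, D u -> s - e0 <= nrm B u <= s -> m0 <= I u) ->
  D e -> 0 < nrm B e -> (forall t, 0 <= t -> I (t *: e) <= C) ->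
  (exists r, forall u, D u -> r <= nrm B u -> I u <= C + 1 ->
     B (g u) u <= 0) ->
  exists u, critical u /\ 0 < I u.
Proof.
move=> s0 e00 m00 I0 Irim De ne IC [r0 radial0].
(* Shrinking e0 makes 0 lie inside the rim. *)
wlog e0s : e0 e00 Irim / e0 <= s.
  move=> /(_ (Num.min e0 s)); apply.
  - rewrite lt_min e00 /= lt_neqAle s0 andbT; apply/eqP => s00.
    have := Irim 0 D0; rewrite (nrm0 hB) I0 -s00 lexx andbT sub0r.
    by rewrite oppr_le0 (ltW e00) => /(_ isT); lra.
  - move=> u Du /andP[h1 h2]; apply: Irim => //; rewrite h2 andbT.
    apply: le_trans h1; rewrite lerB //; by rewrite ge_min lexx.
  - by rewrite ge_min lexx orbT.
apply: contrapT => nocrit.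
pose r := Num.max (Num.max r0 s) 1.
have r1 : 1 <= r by rewrite le_max lexx orbT.
have rs : s <= r by rewrite !le_max lexx orbT.
have radial u : D u -> r <= nrm B u -> I u <= C + 1 -> B (g u) u <= 0.
  by move=> Du ur; apply: radial0 => //; apply: le_trans ur; rewrite !le_max lexx.
have C0 : 0 <= C by have := IC 0 (lexx 0); rewrite scale0r I0.
(* The ray through e, in steps of length eta. *)
have escC : escapes r C.
  move=> eta eta0.
  pose k := eta / nrm B e.
  have k0 : 0 < k by rewrite divr_gt0.
  have Ie n : I ((n%:R * k) *: e) <= C.
    by apply: IC; rewrite mulr_ge0 ?ler0n // ltW.
  have ch n : (exists2 u, chain r C eta u & r <= nrm B u) \/
      chain r C eta ((n%:R * k) *: e).
    elim: n => [|n [|IH]]; [|by left|].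
      by right; rewrite mul0r scale0r; exact: chain_nil.
    have [ur|ur] := leP r (nrm B ((n%:R * k) *: e)).
      by left; exists ((n%:R * k) *: e).
    right; apply: (chain_cons IH ur) => //; first exact: DZ.
    rewrite -scalerBl -mulrBl -natrB // subSnn mul1r (nrmZ hB) //.
    by rewrite gtr0_norm // /k divfK // lt0r_neq0.
  pose n := (Num.truncn (r / eta)).+1.
  case: (ch n) => [//|cn]; exists ((n%:R * k) *: e) => //.
  have nk : 0 <= n%:R * k by rewrite mulr_ge0 // ltW.
  rewrite (nrmZ hB) // ger0_norm //.
  rewrite -mulrA /k divfK ?lt0r_neq0 // -ler_pdivrMr //.
  by rewrite ltW // truncnS_gt.
pose Q := [set a | escapes r a].
(* A chain below m0 cannot cross the rim. *)
have Qlb a : escapes r a -> m0 <= a.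
  move=> /(_ e0 e00)[u cu ur]; rewrite leNgt; apply/negP => am.
  have : nrm B u < s - e0 \/ u = 0.
    elim: cu {ur} => [|v w cv IH vr Dw Iw vw]; first by right.
    left; rewrite ltNge; apply/negP => h.
    have vb : nrm B v <= s - e0.
      by case: IH => [/ltW//|->]; rewrite (nrm0 hB) subr_ge0.
    have := nrm_dist hB Dw (chain_in cv) => h3.
    have := Irim w Dw; rewrite h /= => /(_ _); move: Iw am h3 vb vw => *.
    have : m0 <= I w by apply: Irim => //; apply/andP; split; lra.
    by lra.
  by case=> [h|u0]; [move: ur h e00; lra|move: ur; rewrite u0 (nrm0 hB); move: r1; lra].
have hQ : has_inf Q.
  by split; [exists C; exact: escC|exists m0 => a; exact: Qlb].
set c := inf Q.
have c0 : 0 < c.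
  apply: lt_le_trans m00 _; apply: lb_le_inf; first by case: hQ.
  by move=> a; exact: Qlb.
have cC : c <= C by apply: ge_inf => //; case: hQ.
have [u cu _ /andP[uI _]|d d0 hd] := @grad_gap (r + 1) (c / 2) (C + 1).
  by apply: nocrit; exists u; split => //; lra.
have [t t0 ht] := gradient_step (r + 1) d0 ltr01.
pose gam := t * (d ^+ 2 / 2).
have gam0 : 0 < gam by rewrite mulr_gt0 // divr_gt0 // exprn_gt0.
pose step u := u - (t * cutoff c (I u)) *: g u.
have scale_itv u : 0 <= t * cutoff c (I u) <= t.
  have /andP[h1 h2] := cutoff_itv c (I u).
  by rewrite mulr_ge0 ?(ltW t0) //= ler_piMr // ltW.
have Dstep u : D u -> D (step u).
  by move=> Du; apply: (psd_B hB) => //; apply: DZ; exact: Dg.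
have step0 : step 0 = 0.
  rewrite /step I0 cutoff0 ?mulr0 ?scale0r ?subr0 //.
  by rewrite divr_ge0 // ltW.
have step_level u a : D u -> nrm B u <= r + 1 -> I u <= a -> a <= C + 1 ->
    I (step u) <= Num.max (3 * c / 4) (a - gam).
  move=> Du ur Iu aC.
  have [_ hs] := ht u _ Du ur (scale_itv u).
  have [Ic|Ic] := leP (I u) (c / 2).
    rewrite /step cutoff0 // mulr0 scale0r subr0 le_max.
    by apply/orP; left; lra.
  have Iub : c / 2 <= I u <= C + 1 by apply/andP; split; lra.
  have {}hs := hs (hd u Du ur Iub).
  have [Ic2|Ic2] := leP (3 * c / 4) (I u).
    rewrite /step; move: hs; rewrite cutoff1 // mulr1 => hs.
    by rewrite le_max; apply/orP; right; move: hs; rewrite /gam; lra.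
  rewrite le_max; apply/orP; left; apply: le_trans hs _.
  rewrite lerBlDr; apply: ler_wpDr; last exact: ltW.
  by rewrite mulr_ge0 ?divr_ge0 ?sqr_ge0 //; case/andP: (scale_itv u).
have step_out u : D u -> r <= nrm B u -> I u <= C + 1 -> r <= nrm B (step u).
  move=> Du ur Iu; have rad := radial u Du ur Iu.
  apply: le_trans ur _; rewrite (nrm_le hB) ?nrm_ge0 // (nrm_sqr hB); last exact: Dstep.
  rewrite /step (psd_sqrD hB) //; last first.
    by apply: (psd_N hB); apply: DZ; exact: Dg.
  have Dgu := Dg Du.
  rewrite (psd_oppr hB) ?(psd_scaler hB) //; last exact: DZ.
  rewrite (psd_sym hB Du Dgu).
  have : 0 <= B (- ((t * cutoff c (I u)) *: g u)) (- ((t * cutoff c (I u)) *: g u)).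
    by apply: (psd_ge0 hB); apply: (psd_N hB); exact: DZ.
  have : t * cutoff c (I u) * B (g u) u <= 0.
    by rewrite mulr_ge0_le0 //; case/andP: (scale_itv u).
  lra.
have step_ucont eta : 0 < eta -> exists2 del, 0 < del & forall u w, D u -> D w ->
    nrm B u <= r + 1 -> nrm B w <= r + 1 -> nrm B (u - w) <= del ->
    nrm B (step u - step w) <= eta.
  move=> eta0; have [K K0 hK] := grad_bound_pos (r + 1).
  have e3 : 0 < eta / 3 by rewrite divr_gt0.
  have [|d1 d10 hd1] := grad_ucont hI (r + 1) (_ : 0 < eta / 3 / t).
    by rewrite divr_gt0.
  have [|d2 d20 hd2] := functional_ucont (r + 1) (_ : 0 < eta / 3 / (t * K) * (c / 4)).
    by rewrite mulr_gt0 ?divr_gt0 // mulr_gt0.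
  exists (Num.min (eta / 3) (Num.min d1 d2)); first by rewrite !lt_min e3 d10.
  move=> u w Du Dw ur wr; rewrite !le_min => /and3P[uw uw1 uw2].
  set x := cutoff c (I u); set y := cutoff c (I w).
  have Dgu := Dg Du; have Dgw := Dg Dw.
  rewrite /step (_ : _ - _ = (u - w) - (((t * (x - y)) *: g u) +
      ((t * y) *: (g u - g w)))); last first.
    rewrite scalerBr addrA -scalerDl (_ : t * (x - y) + t * y = t * x); last by ring.
    by rewrite !opprD !opprK addrACA.
  have Duw := psd_B hB Du Dw; have Dguw := psd_B hB Dgu Dgw.
  apply: le_trans (nrmB hB Duw (psd_D hB (DZ _ Dgu) (DZ _ Dguw))) _.
  have := nrmD hB (DZ (t * (x - y)) Dgu) (DZ (t * y) Dguw).
  rewrite !(nrmZ hB) // !normrM (gtr0_norm t0).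
  have : t * `|y| * nrm B (g u - g w) <= eta / 3.
    have : t * `|y| <= t.
      by have /andP[y0 y1] := cutoff_itv c (I w); rewrite ler_piMr ?(ltW t0) ?ger0_norm.
    have := hd1 u w Du Dw ur wr uw1; rewrite ler_pdivlMr // mulrC => h1 h2.
    by apply: le_trans h1; apply: ler_wpM2r h2; exact: nrm_ge0.
  have : t * `|x - y| * nrm B (g u) <= eta / 3.
    have h1 : `|x - y| <= eta / 3 / (t * K).
      apply: le_trans (cutoff_lip _ _ c0) _.
      rewrite ler_pdivrMr; last by rewrite divr_gt0.
      exact: hd2.
    have h2 : `|x - y| * (t * K) <= eta / 3.
      by rewrite -ler_pdivlMr // mulr_gt0.
    apply: le_trans h2; rewrite (mulrC t) -mulrA; apply: ler_wpM2l => //.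
    by apply: ler_wpM2l; [exact: ltW|exact: hK].
  move: uw; lra.
pose del := Num.min gam 1.
have del0 : 0 < del by rewrite lt_min gam0 ltr01.
have [a ea ac] := inf_adherent del0 hQ.
have aC : a <= C + 1.
  have : del <= 1 by rewrite ge_min lexx orbT.
  by move: ac; rewrite -/c; lra.
have a0 : 0 <= a by have := Qlb a ea; lra.
suff : Q (Num.max (3 * c / 4) (a - gam)).
  move=> /(ge_inf hQ.2); rewrite -/c le_max.
  have : del <= gam by rewrite ge_min lexx.
  by move: ac; rewrite -/c => ? ? /orP[]; lra.
set a' := Num.max _ _.
move=> eta eta0; have [xi xi0 hxi] := step_ucont eta eta0.
have [|u cu ur] := ea (Num.min xi 1); first by rewrite lt_min xi0 ltr01.
have chain_r v : chain r a (Num.min xi 1) v -> nrm B v <= r + 1.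
  move=> cv; apply: le_trans (chain_nrm _ _ cv) _; first by lra.
    by rewrite le_min ler01 (ltW xi0).
  by rewrite lerD2l ge_min lexx orbT.
have lev v : chain r a (Num.min xi 1) v -> I v <= a.
  by apply: chain_level; rewrite I0.
have : (exists2 v, chain r a' eta v & r <= nrm B v) \/ chain r a' eta (step u).
  elim: cu {ur} => [|v w cv IH vr Dw Iw vw].
    by right; rewrite step0; exact: chain_nil.
  case: IH => [|IH]; first by left.
  have [sr|sr] := leP r (nrm B (step v)); first by left; exists (step v).
  have cw := chain_cons cv vr Dw Iw vw.
  right; apply: (chain_cons IH sr); first exact: Dstep.
    by apply: step_level => //; exact: chain_r.
  have Dv := chain_in cv.
  apply: hxi => //; try exact: chain_r.
  by apply: le_trans vw _; rewrite ge_min lexx.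
case=> // cs; exists (step u) => //; apply: step_out => //; first exact: chain_in cu.
exact: le_trans (lev _ cu) aC.
Qed.

End CriticalPoints.
Arguments critical {R L} D B g u.
Arguments smooth_ps {R L} D B I g.

(** * Geometry of the gasket *)

Lemma geo_small {R : realType} (q K e : R) : 0 <= q < 1 -> 0 < e ->
  exists n, K * q ^+ n <= e.
Proof.
move=> /andP[q0 q1] e0.
have : `|q| < 1 by rewrite ger0_norm.
move=> /(cvg_geometric K)/cvgrPdist_le/(_ e e0)[n _ /(_ n (leqnn n))].
rewrite /geometric /= sub0r normrN => h.
by exists n; apply: le_trans h; exact: ler_norm.
Qed.

Lemma geo_le0 {R : realType} (q K x : R) : 0 <= q < 1 ->
  (forall n, x <= K * q ^+ n) -> x <= 0.
Proof.
move=> q01 h; apply/ler_addgt0Pr => e e0; rewrite add0r.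
by have [n hn] := geo_small K q01 e0; exact: le_trans (h n) hn.
Qed.

Section Geometry.
Context {R : realType} {N : nat}.
Local Notation E := 'rV[R]_N.-1.
Context {p : 'I_N -> E} {V : set E}.
Context (N_ge2 : (2 <= N)%N) (hp : unit_simplex p) (hV : gasket p V).

Let half01 : 0 <= (2^-1 : R) < 1. Proof. by apply/andP; split; lra. Qed.
Let N0 : (N%:R : R) != 0. Proof. by rewrite pnatr_eq0; case: N N_ge2. Qed.

Lemma simil_dist i x y : `|simil p i x - simil p i y| = 2^-1 * `|x - y|.
Proof.
by rewrite /simil opprD addrACA subrr addr0 -scalerBr normrZ gtr0_norm.
Qed.

Lemma simil_fix i : simil p i (p i) = p i.
Proof. by rewrite /simil -scalerDl [_ + _](_ : _ = 1) ?scale1r //; field. Qed.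

Lemma simil_inj i : injective (simil p i).
Proof.
move=> x y xy; apply/eqP; rewrite -subr_eq0 -normr_eq0.
by have := simil_dist i x y; rewrite xy subrr normr0 => ?; apply/eqP; lra.
Qed.

Lemma gasket_compact : compact V. Proof. by case: hV. Qed.

Lemma gasket_closed : closed V.
Proof. exact: compact_closed (@norm_hausdorff _ _) gasket_compact. Qed.

Lemma gasket_simil i x : V x -> V (simil p i x).
Proof. by move=> Vx; case: hV => _ _ <-; exists i => //; exists x. Qed.

Lemma gasket_cover x : V x -> exists i y, V y /\ x = simil p i y.
Proof.
case: hV => _ _ {1}<- [i _ [y Vy <-]]; by exists i, y.
Qed.

Lemma gasket_bounded : exists2 K, 0 <= K & forall x, V x -> `|x| <= K.
Proof.
have /pinfty_ex_gt0[K K0 hK] := compact_bounded gasket_compact.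
by exists K; rewrite ?ltW.
Qed.

Lemma gasket_dist_bounded y : exists2 K, 0 <= K & forall x, V x -> `|x - y| <= K.
Proof.
have [K K0 hK] := gasket_bounded; exists (K + `|y|); first exact: addr_ge0.
by move=> x /hK xK; apply: le_trans (ler_normB _ _) _; rewrite lerD2r.
Qed.

(** Each point of Q is obtained from a point of the bounded set V by n contractions
    towards p i, for all n. *)
Lemma peel_corner (Q : set E) i : Q `<=` V ->
  (forall y, Q y -> exists2 z, Q z & y = simil p i z) -> Q `<=` [set p i].
Proof.
move=> QV Qp y Qy; have [K K0 hK] := gasket_dist_bounded (p i).
have : `|y - p i| <= 0.
  apply: (geo_le0 (q := 2^-1) (K := K)) => // n.
  elim: n y Qy => [|n IH] y Qy; first by rewrite mulr1; exact: hK (QV _ Qy).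
  have [z Qz ->] := Qp y Qy.
  rewrite -{1}(simil_fix i) simil_dist exprS mulrCA.
  by apply: ler_wpM2l; [case/andP: half01|exact: IH].
by rewrite normr_le0 subr_eq0 => /eqP.
Qed.

(** Iterating one contraction on any point of V converges to its fixed point. *)
Lemma gasket_corner i : V (p i).
Proof.
have [x Vx] : V !=set0 by case: hV.
apply: gasket_closed => B /nbhs_ballP[e /= e0 hB].
have [n hn] : exists n, `|x - p i| * 2^-1 ^+ n <= e / 2.
  by apply: geo_small; rewrite ?divr_gt0.
have it m : V (iter m (simil p i) x) /\
    `|iter m (simil p i) x - p i| = `|x - p i| * 2^-1 ^+ m.
  elim: m => [|m [IH1 IH2]]; first by rewrite mulr1.
  split; first exact: gasket_simil.
  by rewrite -{1}(simil_fix i) /= simil_dist IH2 exprS mulrCA.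
exists (iter n (simil p i) x); split; first by case: (it n).
apply: hB; rewrite -ball_normE /= distrC (it n).2.
by apply: le_lt_trans hn _; rewrite gtr_pMr // invf_lt1 // ltr1n.
Qed.

Definition sqdist (x y : E) : R := \sum_j (x ord0 j - y ord0 j) ^+ 2.

Lemma sqdist_corner i j : sqdist (p i) (p j) = (i != j)%:R.
Proof.
have [<-|ij] := eqVneq i j.
  by apply: big1 => k _; rewrite subrr expr0n.
have := hp ij; rewrite /enorm => /(congr1 (fun x => x ^+ 2)).
rewrite sqr_sqrtr; last by apply: sumr_ge0 => k _; exact: sqr_ge0.
by rewrite expr1n => <-; apply: eq_bigr => k _; rewrite !mxE.
Qed.

Lemma sqdist_simil i x z :
  sqdist (simil p i x) z = sqdist x z / 2 + sqdist (p i) z / 2 - sqdist x (p i) / 4.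
Proof.
rewrite /sqdist !mulr_suml -sumrN -!big_split /=; apply: eq_bigr => j _.
by rewrite !mxE; field.
Qed.

(** Barycentric coordinate of x at the vertex p i.  It is affine because the
    quadratic terms cancel, and has the right values at the vertices because
    these are at distance 1. *)
Definition bary (i : 'I_N) (x : E) : R :=
  (1 + \sum_j sqdist x (p j) - N%:R * sqdist x (p i)) / N%:R.

Lemma bary_corner i k : bary i (p k) = (i == k)%:R.
Proof.
rewrite /bary sqdist_corner (eq_bigr _ (fun j _ => sqdist_corner k j)).
rewrite (bigD1 k) //= eqxx add0r (eq_bigr (fun=> 1)); last by move=> j; rewrite eq_sym => ->.
rewrite sumr_const (_ : #|_| = N.-1)%N; last first.
  by rewrite cardC1 card_ord.
have -> : (N.-1%:R : R) = N%:R - 1 by rewrite -subn1 natrB //; case: N N_ge2.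
by rewrite (eq_sym k); case: eqP => _ /=; field.
Qed.

Lemma bary_simil i k x : bary i (simil p k x) = (bary i x + (i == k)%:R) / 2.
Proof.
rewrite -(bary_corner i k) /bary sqdist_simil.
rewrite (eq_bigr _ (fun j _ => sqdist_simil k x (p j))).
rewrite sumrB big_split /= -!mulr_suml sumr_const card_ord -mulr_natl.
by field.
Qed.

Lemma sum_bary x : \sum_i bary i x = 1.
Proof.
rewrite /bary -mulr_suml sumrB -mulr_sumr sumr_const card_ord.
by rewrite -[X in X - _]mulr_natl mulrDr mulr1 addrK divff.
Qed.

Lemma coord_le (x : E) j : `|x ord0 j| <= `|x|.
Proof.
rewrite [leRHS]/Num.norm /= mx_normrE; apply/bigmax_geP; right => /=.
by exists (ord0, j).
Qed.

(** A lower bound on V is halved by passing to the cells of level 1. *)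
Lemma bary_ge0 i x : V x -> 0 <= bary i x.
Proof.
have [K K0 hK] := gasket_dist_bounded (p i).
have sq y : V y -> sqdist y (p i) <= \sum_(j < N.-1) K ^+ 2.
  move=> Vy; apply: ler_sum => j _.
  rewrite -real_normK ?num_real // ler_sqr ?nnegrE //.
  by have := coord_le (y - p i) j; rewrite !mxE => /le_trans; apply; exact: hK.
set M := \sum_(j < _) _ in sq.
have lb y : V y -> - M <= bary i y.
  move=> /sq h; rewrite /bary ler_pdivlMr ?lt0r_neq0 ?ltr0n; last by case: N N_ge2.
  have := ler_wpM2l (ler0n R N) h.
  have : 0 <= \sum_j sqdist y (p j).
    by apply: sumr_ge0 => j _; apply: sumr_ge0 => k _; exact: sqr_ge0.
  lra.
move=> Vx; rewrite -oppr_le0; apply: (geo_le0 (q := 2^-1) (K := M)) => // n.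
elim: n x Vx => [|n IH] x Vx; first by have := lb x Vx; rewrite mulr1; lra.
have [k [y [Vy ->]]] := gasket_cover Vx.
rewrite bary_simil exprS mulrCA; have := IH y Vy.
have : 0 <= (i == k)%:R :> R by exact: ler0n.
lra.
Qed.

(** Only the cell at p i contains points with coordinate above 1/2, and their
    preimages have coordinate 1 again. *)
Lemma bary_eq1 i x : V x -> 1 <= bary i x -> x = p i.
Proof.
move=> Vx ix.
have ub k y : V y -> bary k y <= 1.
  move=> Vy; rewrite -(sum_bary y) (bigD1 k) //= lerDl.
  by apply: sumr_ge0 => j _; exact: bary_ge0.
apply: (@peel_corner [set y | V y /\ 1 <= bary i y]); last by split.
  by move=> y [].
move=> y [Vy iy]; have [k [z [Vz yz]]] := gasket_cover Vy.
move: iy; rewrite yz bary_simil; have := ub i z Vz.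
have [<-|_] /= := eqVneq i k => h1 h2; last by exfalso; lra.
by exists z => //; split => //; lra.
Qed.

(** At a common point both barycentric coordinates are at least 1/2, hence equal
    to 1/2, so that x has coordinate 1 at p j. *)
Lemma cell_overlap i j x y : V x -> V y -> i != j ->
  simil p i x = simil p j y -> x = p j.
Proof.
move=> Vx Vy ij xy; apply: bary_eq1 => //.
have := bary_simil j i x; rewrite xy bary_simil eqxx (eq_sym j) (negbTE ij) /=.
have := bary_ge0 j Vy; lra.
Qed.

Lemma corner_inj : injective p.
Proof.
move=> i j ij; apply/eqP/negPn/negP => nij.
have := bary_corner i i; rewrite ij bary_corner eqxx (negbTE nij) => /eqP.
by rewrite eq_sym oner_eq0.
Qed.

Lemma simil_corner_swap i j : simil p i (p j) = simil p j (p i).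
Proof. by rewrite /simil addrC. Qed.

Definition word_map (w : seq 'I_N) (x : E) : E := foldr (simil p) x w.

Lemma gasket_word w x : V x -> V (word_map w x).
Proof. by move=> Vx; elim: w => //= i w IH; exact: gasket_simil. Qed.

Lemma gasket_word_cover m x : V x ->
  exists w y, [/\ size w = m, V y & x = word_map w y].
Proof.
elim: m x => [|m IH] x Vx; first by exists [::], x.
have [i [y [Vy ->]]] := gasket_cover Vx.
have [w [z [sw Vz ->]]] := IH y Vy.
by exists (i :: w), z; split => //=; rewrite sw.
Qed.

Lemma word_map_dist w x y :
  `|word_map w x - word_map w y| = 2^-1 ^+ size w * `|x - y|.
Proof.
elim: w => [|i w IH] /=; first by rewrite mul1r.
by rewrite simil_dist IH exprS mulrA.
Qed.

(** Identifies the edges of the graph of level m with pairs of distinct vertices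
    of the cells of level m: two cells share at most one point. *)
Lemma cell_pair_inj (w w' : seq 'I_N) i i' j j' : size w = size w' -> i != j ->
  word_map w (p i) = word_map w' (p i') -> word_map w (p j) = word_map w' (p j') ->
  [/\ w = w', i = i' & j = j'].
Proof.
elim: w w' => [|a w IH] [|a' w'] //= => [_ ij /corner_inj-> /corner_inj-> //|[sw]] ij.
have VV k v : V (word_map v (p k)) by exact: gasket_word (gasket_corner k).
have [<-|aa'] := eqVneq a a'.
  by move=> /simil_inj h1 /simil_inj h2; have [->-> ->] := IH w' sw ij h1 h2.
move=> /(cell_overlap (VV _ _) (VV _ _) aa') h1.
move=> /(cell_overlap (VV _ _) (VV _ _) aa') h2.
have : `|word_map w (p i) - word_map w (p j)| = 0 by rewrite h1 h2 subrr normr0.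
rewrite word_map_dist => /eqP; rewrite mulf_eq0 expf_eq0 invr_eq0 pnatr_eq0 andbF /=.
rewrite normr_eq0 subr_eq0 => /eqP/corner_inj ij'.
by rewrite ij' eqxx in ij.
Qed.

End Geometry.
Arguments word_map {R N} p w x.

(** * The graph energies *)

Section PairSums.
Context {R : realType} {N : nat}.
Implicit Types x y a : 'I_N -> R.

(** Reduces the energy of one cell to power sums. *)
Lemma pair_sumE x y :
  \sum_i \sum_j (x i - x j) * (y i - y j) =
  2 * (N%:R * \sum_i x i * y i - (\sum_i x i) * \sum_i y i).
Proof.
transitivity (\sum_i (N%:R * (x i * y i) + \sum_j x j * y j
    - x i * \sum_j y j - y i * \sum_j x j)).
  apply: eq_bigr => i _; rewrite !mulr_sumr.
  transitivity (\sum_j (x i * y i + x j * y j - x i * y j - y i * x j)).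
    by apply: eq_bigr => j _; ring.
  by rewrite !sumrB big_split /= sumr_const card_ord -[_ *+ N]mulr_natl.
rewrite !sumrB big_split /= sumr_const card_ord -mulr_sumr -!mulr_suml.
by rewrite -[_ *+ N]mulr_natl; ring.
Qed.

Lemma sum_quadratic a (al be ga : R) :
  \sum_k (al * a k ^+ 2 + be * a k + ga) =
  al * \sum_k a k ^+ 2 + be * \sum_k a k + N%:R * ga.
Proof.
by rewrite !big_split /= -!mulr_sumr sumr_const card_ord -[ga *+ N]mulr_natl.
Qed.

Lemma sum_indicator (k : 'I_N) : \sum_i (i == k)%:R = 1 :> R.
Proof. by rewrite (bigD1 k) //= eqxx big1 ?addr0 // => i /negbTE->. Qed.

(** The value at the vertex i of cell k of the harmonic extension of the
    boundary values a, i.e. of the extension of least energy. *)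
Definition harm a (k i : 'I_N) : R :=
  if i == k then a k else (a i + a k + \sum_j a j) / (N%:R + 2).

Let D0 : (N%:R + 2 : R) != 0.
Proof. by rewrite lt0r_neq0 // ltr_wpDl. Qed.

Lemma harmE a k i : harm a k i =
  (a i + a k + \sum_j a j + (i == k)%:R * (N%:R * a k - \sum_j a j)) / (N%:R + 2).
Proof. by rewrite /harm; case: eqP => [->|_] /=; field. Qed.

Lemma sum_harm a k :
  \sum_i harm a k i = N%:R * (2 * a k + \sum_j a j) / (N%:R + 2).
Proof.
rewrite (eq_bigr _ (fun i _ => harmE a k i)) -mulr_suml; congr (_ / _).
rewrite !big_split /= !sumr_const card_ord -mulr_suml sum_indicator.
by rewrite -[a k *+ _]mulr_natl -[_ *+ N]mulr_natl; ring.
Qed.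

Lemma sum_harm_sqr a k : \sum_i harm a k i ^+ 2 =
  (\sum_i a i ^+ 2 + 2 * (a k + \sum_j a j) * \sum_j a j
   + N%:R * (a k + \sum_j a j) ^+ 2 + (N%:R + 2) ^+ 2 * a k ^+ 2
   - (2 * a k + \sum_j a j) ^+ 2) / (N%:R + 2) ^+ 2.
Proof.
set s := \sum_j a j; set D := N%:R + 2.
transitivity (\sum_i ((1 * a i ^+ 2 + 2 * (a k + s) * a i + (a k + s) ^+ 2)
    + (i == k)%:R * (D ^+ 2 * a k ^+ 2 - (2 * a k + s) ^+ 2)) / D ^+ 2).
  apply: eq_bigr => i _; rewrite harmE -/s -/D exprMn exprVn; congr (_ * _).
  by case: eqP => [->|_] /=; rewrite /D; ring.
rewrite -mulr_suml big_split /= sum_quadratic -/s -mulr_suml; congr (_ / _).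
rewrite sum_indicator.
by rewrite /D; ring.
Qed.

Context (N0 : (N%:R : R) != 0).

(** The factor (N + 2) / N is the one that makes the harmonic extension preserve
    the energy. *)
Lemma harm_energy a : \sum_i \sum_j (a i - a j) * (a i - a j) =
  (N%:R + 2) / N%:R *
  \sum_k \sum_i \sum_j (harm a k i - harm a k j) * (harm a k i - harm a k j).
Proof.
rewrite pair_sumE (eq_bigr (fun i => a i ^+ 2)) => [|i _]; last by rewrite expr2.
set s := \sum_i a i; set q := \sum_i a i ^+ 2; set D := N%:R + 2.
(* The energy of cell k as a polynomial in a k. *)
transitivity (D / N%:R * \sum_k (
     (2 * N%:R * (N%:R + D ^+ 2 - 4) - 8 * N%:R ^+ 2) / D ^+ 2 * a k ^+ 2
   + (2 * N%:R * (2 + 2 * N%:R - 4) - 8 * N%:R ^+ 2) * s / D ^+ 2 * a k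
   + (2 * N%:R * (q + (1 + N%:R) * s ^+ 2) - 2 * N%:R ^+ 2 * s ^+ 2) / D ^+ 2)).
  by rewrite sum_quadratic -/s -/q /D; field; rewrite N0 D0.
congr (_ * _); apply: eq_bigr => k _.
rewrite pair_sumE (eq_bigr (fun i => harm a k i ^+ 2)) => [|i _]; last by rewrite expr2.
by rewrite sum_harm_sqr sum_harm -/s -/q /D; field; rewrite D0.
Qed.

(** Any extension b splits as the harmonic one plus a part d orthogonal to it:
    the cross terms are antisymmetric in the two cells that share a vertex,
    while d is symmetric. *)
Lemma harm_min a (b : 'I_N -> 'I_N -> R) :
  (forall k, b k k = a k) -> (forall k i, b k i = b i k) ->
  \sum_i \sum_j (a i - a j) * (a i - a j) <=
  (N%:R + 2) / N%:R *
  \sum_k \sum_i \sum_j (b k i - b k j) * (b k i - b k j).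
Proof.
move=> ba bC; rewrite harm_energy.
have c0 : 0 <= (N%:R + 2) / N%:R :> R by rewrite divr_ge0 // addr_ge0.
apply: ler_wpM2l => //.
pose d k i := b k i - harm a k i.
have dC k i : d k i = d i k.
  rewrite /d bC !harmE eq_sym; congr (_ - _ / _).
  by case: eqP => [->//|_] /=; ring.
have dk k : d k k = 0 by rewrite /d ba /harm eqxx subrr.
pose cross k := \sum_i \sum_j (harm a k i - harm a k j) * (d k i - d k j).
have crossE k : cross k = 2 * N%:R / (N%:R + 2) * \sum_i (d k i * a i - d k i * a k).
  rewrite /cross pair_sumE sum_harm !mulr_sumr -sumrB !mulr_sumr; apply: eq_bigr => i _.
  have [->|ik] := eqVneq i k; first by rewrite dk; ring.
  by rewrite /harm (negbTE ik); field.
have cross0 : \sum_k cross k = 0.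
  rewrite (eq_bigr _ (fun k _ => crossE k)) -mulr_sumr.
  rewrite (eq_bigr _ (fun k _ => sumrB _ _ _ _)) sumrB [X in _ - X]exchange_big /=.
  rewrite [X in X - _](_ : _ = \sum_j \sum_i d i j * a i); first by rewrite subrr mulr0.
  by apply: eq_bigr => k _; apply: eq_bigr => i _; rewrite dC.
rewrite -subr_ge0.
have noop (x : R) : x - 2 * \sum_k cross k = x by rewrite cross0 mulr0 subr0.
rewrite -[leRHS]noop -sumrB mulr_sumr -sumrB.
apply: sumr_ge0 => k _.
rewrite -sumrB mulr_sumr -sumrB; apply: sumr_ge0 => i _.
rewrite -sumrB mulr_sumr -sumrB; apply: sumr_ge0 => j _.
have -> : (b k i - b k j) * (b k i - b k j)
  - (harm a k i - harm a k j) * (harm a k i - harm a k j)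
  - 2 * ((harm a k i - harm a k j) * (d k i - d k j)) = (d k i - d k j) ^+ 2.
  by rewrite /d; ring.
exact: sqr_ge0.
Qed.

End PairSums.

Section GraphEnergy.
Context {R : realType} {N : nat}.
Local Notation E := 'rV[R]_N.-1.
Context (p : 'I_N -> E).
Implicit Types u v : E -> R.

Definition graph_energy u v : R :=
  \sum_i \sum_j (u (p i) - u (p j)) * (v (p i) - v (p j)).

(** The energies of all levels by self-similarity, instead of by sums over the
    edges of the graphs. *)
Fixpoint cell_energy m u v : R :=
  if m is m'.+1 then
    (N%:R + 2) / N%:R * \sum_a cell_energy m' (u \o simil p a) (v \o simil p a)
  else graph_energy u v.

Fixpoint words m : seq (seq 'I_N) :=
  if m is m'.+1 then [seq a :: w | a <- enum 'I_N, w <- words m'] else [:: [::]].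

Lemma mem_words m w : (w \in words m) = (size w == m).
Proof.
elim: m w => [|m IH] [|a w] //=.
- by apply/allpairsP => -[[b v] /= [_ _]].
- rewrite eqSS -IH; apply/allpairsP/idP => [[[b v] /= [_ vm [_ ->]]] //|wm].
  by exists (a, w); split => //; rewrite mem_enum.
Qed.

Lemma words_uniq m : uniq (words m).
Proof.
elim: m => //= m IH; apply: allpairs_uniq => //; first exact: enum_uniq.
by move=> [a v] [b w] /= _ _ [-> ->].
Qed.

Lemma cell_energy_words m u v : cell_energy m u v =
  ((N%:R + 2) / N%:R) ^+ m *
  \sum_(w <- words m) graph_energy (u \o word_map p w) (v \o word_map p w).
Proof.
elim: m u v => [|m IH] u v; first by rewrite mul1r big_seq1.
rewrite [LHS]/= exprS -[RHS]mulrA; congr (_ * _).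
rewrite /= big_allpairs_dep big_enum /= mulr_sumr.
by apply: eq_bigr => a _; rewrite IH.
Qed.

Lemma level_words m x : level p m x <-> exists w i, size w = m /\ x = word_map p w (p i).
Proof.
rewrite /level; elim: m x => [|m IH] x /=; split.
- by move=> [i _ <-]; exists [::], i.
- by move=> [[|a w] [i [sw ->]]] //; exists i.
- move=> [a _ [y /IH[w [i [sw ->]]] <-]].
  by exists (a :: w), i; split => //=; rewrite sw.
- move=> [[|a w] [i [sw ->]]] //; case: sw => sw; exists a => //.
  by exists (word_map p w (p i)) => //; apply/IH; exists w, i.
Qed.

Context {V : set E}.
Context (N_ge2 : (2 <= N)%N) (hp : unit_simplex p) (hV : gasket p V).

(** Every edge of level m belongs to exactly one cell, so that the sum over edges
    is a sum over words and pairs of distinct vertices. *)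
Lemma energy_formE m u v : energy_form p m u v = cell_energy m u v.
Proof.
rewrite cell_energy_words /energy_form natrD; congr (_ * _).
pose ends (t : seq 'I_N * ('I_N * 'I_N)) :=
  (word_map p t.1 (p t.2.1), word_map p t.1 (p t.2.2)).
pose T := [seq (w, ij) | w <- words m,
  ij <- enum [pred ij : 'I_N * 'I_N | ij.1 != ij.2]].
have memT w i j : ((w, (i, j)) \in T) = (size w == m) && (i != j).
  apply/allpairsP/andP => [[[w' [i' j']] /= [wm ijm [-> -> ->]]]|[wm ij]].
    by move: wm ijm; rewrite mem_words mem_enum.
  by exists (w, (i, j)); split; rewrite ?mem_words ?mem_enum.
have uT : uniq [seq ends t | t <- T].
  rewrite map_inj_in_uniq.
    apply: allpairs_uniq; rewrite ?words_uniq ?enum_uniq //.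
    by move=> [? [? ?]] [? [? ?]] _ _ [-> -> ->].
  move=> [w [i j]] [w' [i' j']]; rewrite !memT => /andP[/eqP sw ij] /andP[/eqP sw' _].
  move=> [h1 h2].
  have [|-> -> ->//] := cell_pair_inj N_ge2 hp hV _ ij h1 h2; by rewrite sw.
rewrite (_ : [set z | _] = [set` [seq ends t | t <- T]]); last first.
  apply/seteqP; split => [[x y] /= [xy _ _ [w [[_ [i _ <-] ex] [_ [j _ <-] ey]]]]|].
    move: xy; rewrite -ex -ey => xy.
    apply/mapP; exists (tval w, (i, j)) => //; rewrite memT size_tuple eqxx /=.
    by apply: contra_notN xy => /eqP ->.
  move=> _ /= /mapP[[w [i j]] + ->] => /=; rewrite memT => /andP[sw ij]; split => /=.
  - move=> h.
    have [_ hij _] := cell_pair_inj N_ge2 hp hV (erefl (size w)) ij h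
      (erefl (word_map p w (p j))).
    by move: ij; rewrite hij eqxx.
  - by apply/level_words; exists w, i; split => //; apply/eqP.
  - by apply/level_words; exists w, j; split => //; apply/eqP.
  - exists (Tuple sw); split; first by exists (p i) => //; exists i.
    by exists (p j) => //; exists j.
rewrite -fsbig_seq // big_map big_allpairs; apply: eq_bigr => w _ /=.
rewrite big_enum /= /graph_energy pair_big /=.
rewrite [RHS](bigID (fun ij : 'I_N * 'I_N => ij.1 != ij.2)) /=.
rewrite [X in _ = _ + X]big1 ?addr0; first exact: eq_bigl.
by move=> [i j] /= /negPn/eqP ->; rewrite subrr mul0r.
Qed.

Let N0 : (N%:R : R) != 0. Proof. by rewrite pnatr_eq0; case: N N_ge2. Qed.
Let renorm0 : 0 <= (N%:R + 2) / N%:R :> R. Proof. by rewrite divr_ge0 // addr_ge0. Qed.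

Lemma cell_energy_ext m u u' v v' : (forall x, V x -> u x = u' x) ->
  (forall x, V x -> v x = v' x) -> cell_energy m u v = cell_energy m u' v'.
Proof.
elim: m u u' v v' => [|m IH] u u' v v' uu vv /=.
  by apply: eq_bigr => i _; apply: eq_bigr => j _;
    rewrite !uu ?vv //; exact: (gasket_corner hV).
congr (_ * _); apply: eq_bigr => a _.
by apply: IH => x Vx /=; [apply: uu|apply: vv]; exact: (gasket_simil hV).
Qed.

Lemma cell_energyC m u v : cell_energy m u v = cell_energy m v u.
Proof.
elim: m u v => [|m IH] u v /=.
  by apply: eq_bigr => i _; apply: eq_bigr => j _; rewrite mulrC.
by congr (_ * _); apply: eq_bigr => a _.
Qed.

Lemma cell_energy_lin m c u v w :
  cell_energy m (fun x => c * u x + v x) w =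
  c * cell_energy m u w + cell_energy m v w.
Proof.
elim: m u v w => [|m IH] u v w /=.
  rewrite /graph_energy mulr_sumr -big_split; apply: eq_bigr => i _ /=.
  by rewrite mulr_sumr -big_split; apply: eq_bigr => j _ /=; ring.
rewrite mulrCA -mulrDr; congr (_ * _); rewrite mulr_sumr -big_split /=.
by apply: eq_bigr => a _; rewrite -IH.
Qed.

Lemma cell_energy_ge0 m u : 0 <= cell_energy m u u.
Proof.
elim: m u => [|m IH] u /=.
  by apply: sumr_ge0 => i _; apply: sumr_ge0 => j _; rewrite -expr2 sqr_ge0.
by rewrite mulr_ge0 //; apply: sumr_ge0 => a _; exact: IH.
Qed.

(** Refining one cell does not lower its energy, by [harm_min]; the other levels
    follow by self-similarity. *)
Lemma cell_energyS m u : cell_energy m u u <= cell_energy m.+1 u u.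
Proof.
elim: m u => [|m IH] u; last first.
  by apply: ler_wpM2l => //; apply: ler_sum => a _; exact: IH.
apply: (@harm_min R N N0 (fun i => u (p i)) (fun k i => u (simil p k (p i)))).
  by move=> k; rewrite simil_fix.
by move=> k i; rewrite simil_corner_swap.
Qed.

Lemma cell_energy_sub m a u W : (forall m, cell_energy m u u <= W) ->
  cell_energy m (u \o simil p a) (u \o simil p a) <= N%:R / (N%:R + 2) * W.
Proof.
move=> uW; have D0 : 0 < N%:R + 2 :> R by rewrite ltr_wpDl.
rewrite -[N%:R / _]invrK invf_div mulrC ler_pdivlMr ?divr_gt0 //; last first.
  by rewrite lt0r N0 ler0n.
apply: le_trans (uW m.+1); rewrite mulrC; apply: ler_wpM2l => //.
rewrite (bigD1 a) //= lerDl; apply: sumr_ge0 => b _; exact: cell_energy_ge0.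
Qed.

Lemma corner_osc u W i j : (forall m, cell_energy m u u <= W) ->
  `|u (p i) - u (p j)| <= Num.sqrt W.
Proof.
move=> uW; have := uW 0%N; rewrite /= /graph_energy => h.
rewrite -sqrtr_sqr ler_sqrt; last first.
  exact: le_trans (cell_energy_ge0 0 u) (uW 0%N).
apply: le_trans h; rewrite (bigD1 i) //= (bigD1 j) //= -expr2 -addrA lerDl.
apply: addr_ge0; first by apply: sumr_ge0 => k _; rewrite -expr2 sqr_ge0.
by apply: sumr_ge0 => k _; apply: sumr_ge0 => l _; rewrite -expr2 sqr_ge0.
Qed.

(** Passing to a cell of level 1 multiplies the bound W by N / (N + 2), so that the
    estimate propagates because [c sqrt (N / (N + 2)) + 1 <= c] for [c = N + 2]. *)
Lemma vertex_osc w u W i j : (forall m, cell_energy m u u <= W) ->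
  `|u (word_map p w (p i)) - u (p j)| <= (N%:R + 2) * Num.sqrt W.
Proof.
have D0 : 0 < N%:R + 2 :> R by rewrite ltr_wpDl.
elim: w u W i j => [|a w IH] u W i j uW.
  apply: le_trans (corner_osc _ _ uW) _.
  by rewrite ler_peMl ?sqrtr_ge0 //; have := ler0n R N; lra.
have h1 := IH _ _ i a (fun m => cell_energy_sub m a uW).
rewrite /= simil_fix in h1 *.
have h2 := corner_osc a j uW.
rewrite (_ : _ - _ = (u (simil p a (word_map p w (p i))) - u (p a))
  + (u (p a) - u (p j))); last by ring.
apply: le_trans (ler_normD _ _) _; apply: le_trans (lerD h1 h2) _.
rewrite sqrtrM ?divr_ge0 ?ler0n ?(ltW D0) // mulrA -[X in _ + X]mul1r -mulrDl.
apply: ler_wpM2r; first exact: sqrtr_ge0.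
have : Num.sqrt (N%:R / (N%:R + 2)) <= (N%:R + 1) / (N%:R + 2) :> R.
  rewrite -[leRHS]ger0_norm ?divr_ge0 ?addr_ge0 // -sqrtr_sqr ler_sqrt ?sqr_ge0 //.
  rewrite expr_div_n ler_pdivlMr ?exprn_gt0 // expr2 mulrA divfK ?lt0r_neq0 //; nra.
move=> /(ler_wpM2l (ltW D0)); rewrite mulrCA divff ?lt0r_neq0 // mulr1; lra.
Qed.

End GraphEnergy.

(** * Functions of finite energy *)

Lemma within_contP {K : realType} {T : normedModType K} {A : set T} {u : T -> K} :
  {within A, continuous u} <->
  forall x, A x -> forall e, 0 < e -> exists2 d, 0 < d &
    forall y, A y -> `|x - y| < d -> `|u x - u y| <= e.
Proof.
split=> [/subspace_continuousP uc x Ax e e0|uc].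
  have /cvgrPdist_le/(_ e e0) := uc x Ax.
  rewrite /= /prop_near1 /within /= => /nbhs_ballP[d d0 hd].
  exists d => // y Ay xy; apply: hd => //; by rewrite -ball_normE.
apply/subspace_continuousP => x Ax; apply/cvgrPdist_le => e e0.
have [d d0 hd] := uc x Ax e e0.
rewrite /= /prop_near1 /within /=; apply/nbhs_ballP; exists d => // y.
by rewrite -ball_normE /= => xy Ay; exact: hd.
Qed.

Lemma near_all_seq {I : eqType} {T : Type} {F : set_system T} {FF : Filter F}
    (r : seq I) (P : I -> T -> Prop) :
  (forall i, i \in r -> \forall n \near F, P i n) ->
  \forall n \near F, forall i, i \in r -> P i n.
Proof.
elim: r => [|i r IH] h; first by apply: nearW.
have h1 := h i (mem_head _ _).
have h2 : \forall n \near F, forall j, j \in r -> P j n.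
  by apply: IH => j jr; apply: h; rewrite inE jr orbT.
by apply: filterS2 h1 h2 => n h1 h2 j; rewrite inE => /orP[/eqP->|/h2].
Qed.

Section FiniteEnergy.
Context {R : realType} {N : nat}.
Local Notation E := 'rV[R]_N.-1.
Context {p : 'I_N -> E} {V : set E}.
Context (N_ge2 : (2 <= N)%N) (hp : unit_simplex p) (hV : gasket p V).
Implicit Types u v : E -> R.

Let N0 : 0 < N%:R :> R. Proof. by rewrite ltr0n; case: N N_ge2. Qed.
Let D0 : 0 < N%:R + 2 :> R. Proof. by rewrite addr_gt0. Qed.

Let i0 : 'I_N := Ordinal (ltnW N_ge2).

Definition energy_bound u W : Prop := forall m, cell_energy p m u u <= W.

(** The oscillation of a function of given energy shrinks by this factor at
    each subdivision. *)
Definition osc_ratio : R := Num.sqrt (N%:R / (N%:R + 2)).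

Lemma osc_ratio_itv : 0 <= osc_ratio < 1.
Proof.
rewrite sqrtr_ge0 /= -sqrtr1 ltr_sqrt // ltr_pdivrMr // mul1r; lra.
Qed.

Lemma cont_simil u a : {within V, continuous u} ->
  {within V, continuous (u \o simil p a)}.
Proof.
move=> /within_contP uc; apply/within_contP => x Vx e e0.
have [d d0 hd] := uc (simil p a x) (gasket_simil hV a Vx) e e0.
exists d => // y Vy xy; apply: hd; first exact: (gasket_simil hV a Vy).
by rewrite simil_dist; apply: le_lt_trans xy; rewrite ler_piMl //; lra.
Qed.

(** Vertices of small cells are close, so that continuity carries estimates at
    vertices over to all of V. *)
Lemma vertex_approx u x e : {within V, continuous u} -> V x -> 0 < e ->
  forall i, exists w, `|u x - u (word_map p w (p i))| <= e.
Proof.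
move=> /within_contP uc Vx e0 i.
have [d d0 hd] := uc x Vx e e0.
have [K K0 hK] := gasket_dist_bounded hV (p i).
have [||m hm] := @geo_small R 2^-1 K (d / 2).
- by apply/andP; split; lra.
- by rewrite divr_gt0.
have [w [y [sw Vy xy]]] := gasket_word_cover hV m Vx.
exists w; apply: hd; first exact: (gasket_word hV w (gasket_corner hV i)).
rewrite xy word_map_dist sw; apply: (@le_lt_trans _ _ (d / 2)); last by lra.
apply: le_trans hm; rewrite mulrC; apply: ler_wpM2r; last exact: hK.
by rewrite exprn_ge0 // invr_ge0.
Qed.

Lemma sup_osc u W x i : {within V, continuous u} -> energy_bound u W -> V x ->
  `|u x - u (p i)| <= (N%:R + 2) * Num.sqrt W.
Proof.
move=> uc uW Vx; apply/ler_addgt0Pr => e e0.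
have [w hw] := vertex_approx uc Vx e0 i.
have := vertex_osc N_ge2 w i i uW.
rewrite (_ : u x - u (p i) = (u x - u (word_map p w (p i))) +
  (u (word_map p w (p i)) - u (p i))); last by ring.
move=> h; apply: le_trans (ler_normD _ _) _; lra.
Qed.

Lemma cell_osc u W w x y : {within V, continuous u} -> energy_bound u W ->
  V x -> V y -> `|u (word_map p w x) - u (word_map p w y)| <=
    2 * (N%:R + 2) * Num.sqrt W * osc_ratio ^+ size w.
Proof.
move=> + + Vx Vy; elim: w u W => [|a w IH] u W uc uW /=.
  rewrite (_ : u x - u y = (u x - u (p i0)) - (u y - u (p i0))); last by ring.
  apply: le_trans (ler_normB _ _) _; rewrite mulr1.
  have := sup_osc i0 uc uW Vx; have := sup_osc i0 uc uW Vy; lra.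
have := IH _ (N%:R / (N%:R + 2) * W) (@cont_simil u a uc).
move=> /(_ (fun m => cell_energy_sub N_ge2 m a uW)) /le_trans; apply.
rewrite (sqrtrM _ (divr_ge0 (ltW N0) (ltW D0))) -/osc_ratio exprS !mulrA.
by rewrite (mulrAC _ osc_ratio).
Qed.

Let cvg_energy u W : energy_bound u W -> exists2 l, l <= W &
  cell_energy p m u u @[m --> \oo] --> l /\ energy p u = l%:E /\
  forall m, cell_energy p m u u <= l.
Proof.
move=> uW; set s := fun m => cell_energy p m u u.
have sub : has_ubound (range s) by exists W => _ [m _ <-]; exact: uW.
have nd : nondecreasing_seq s.
  by apply/nondecreasing_seqP => m; exact: cell_energyS.
have sc := nondecreasing_cvgn nd sub.
exists (sup (range s)).
  by apply: ge_sup; [exists (s 0%N); exists 0%N|move=> _ [m _ <-]; exact: uW].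
split=> //; split; last by move=> m; apply: ub_le_sup => //; exists m.
rewrite /energy (_ : (fun m => _) = EFin \o s); last first.
  by apply/funext => m /=; rewrite (energy_formE N_ge2 hp hV).
by rewrite EFin_lim ?(cvg_lim _ sc) //; apply: cvgP sc.
Qed.

(** As the graph energies increase, finiteness of their limit is a uniform bound. *)
Lemma H01E u : H01 p V u <->
  [/\ {within V, continuous u}, forall i, u (p i) = 0 & exists W, energy_bound u W].
Proof.
split=> [[uc u0 ufin]|[uc u0 [W /cvg_energy[l _ [_ [ul _]]]]]]; last first.
  by split => //; rewrite ul ltry.
split=> //.
pose s m := (cell_energy p m u u)%:E.
have nd : nondecreasing_seq s.
  by apply/nondecreasing_seqP => m; rewrite lee_fin; exact: cell_energyS.
have eE : energy p u = ereal_sup (range s).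
  rewrite /energy (_ : (fun m => _) = s); last first.
    by apply/funext => m; rewrite (energy_formE N_ge2 hp hV).
  by apply: cvg_lim => //; exact: ereal_nondecreasing_cvgn.
have su m : (s m <= energy p u)%E by rewrite eE; apply: ereal_sup_ubound; exists m.
exists (fine (energy p u)) => m; rewrite -lee_fin fineK; first exact: su.
rewrite ge0_fin_numE // ; apply: le_trans (su 0%N).
by rewrite lee_fin; exact: (cell_energy_ge0).
Qed.

Definition Wn u : R := fine (energy p u).

Lemma energy_bound_Wn u : H01 p V u -> energy_bound u (Wn u).
Proof.
move=> /H01E[_ _ [W /cvg_energy[l _ [_ [ul h]]]]] m.
by rewrite /Wn ul; exact: h.
Qed.

Lemma Wn_cvg u : H01 p V u -> cell_energy p m u u @[m --> \oo] --> Wn u.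
Proof.
by move=> /H01E[_ _ [W /cvg_energy[l _ [sl [ul _]]]]]; rewrite /Wn ul.
Qed.

Lemma Wn_le u W : energy_bound u W -> Wn u <= W.
Proof. by move=> /cvg_energy[l lW [_ [ul _]]]; rewrite /Wn ul. Qed.

Lemma H01_0 : H01 p V (fun=> 0).
Proof.
apply/H01E; split=> //; first by apply: continuous_subspaceT => x; exact: cst_continuous.
exists 0; elim=> [|m IH] /=.
  by rewrite /graph_energy big1 // => i _; rewrite big1 // => j _; rewrite subrr mul0r.
by rewrite big1 ?mulr0 // => a _; apply/eqP; rewrite eq_le IH cell_energy_ge0.
Qed.

Lemma H01_lin c u v : H01 p V u -> H01 p V v -> H01 p V (fun x => c * u x + v x).
Proof.
move=> hu hv; have uW := energy_bound_Wn hu; have vW := energy_bound_Wn hv.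
move: hu hv => /H01E[uc u0 _] /H01E[vc v0 _]; apply/H01E; split.
- move=> x; apply: cvgD; last exact: vc.
  by apply: cvgM; [exact: cvg_cst|exact: uc].
- by move=> i; rewrite u0 v0 mulr0 addr0.
- exists (2 * c ^+ 2 * Wn u + 2 * Wn v) => m.
  (* The energy of c u - v bounds the cross term in that of c u + v. *)
  have h0 := cell_energy_ge0 p m (fun x => c * u x + (-1) * v x).
  have E2 e : cell_energy p m (fun x => c * u x + e * v x) (fun x => c * u x + e * v x)
     = c ^+ 2 * cell_energy p m u u + 2 * c * e * cell_energy p m u v
       + e ^+ 2 * cell_energy p m v v.
    have sc w : cell_energy p m (fun x => e * v x) w = e * cell_energy p m v w.
      have -> : (fun x => e * v x) = (fun x => (e - 1) * v x + v x).
        by apply/funext => x; ring.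
      by rewrite cell_energy_lin; ring.
    rewrite cell_energy_lin sc !(cell_energyC _ _ _ (fun x => _ + _)) !cell_energy_lin.
    by rewrite !sc (cell_energyC _ _ v u); ring.
  rewrite E2 in h0.
  have := E2 1; rewrite (_ : (fun x => c * u x + 1 * v x) = fun x => c * u x + v x); last first.
    by apply/funext => x; rewrite mul1r.
  move=> ->; have := vW m; have := ler_wpM2l (sqr_ge0 c) (uW m); lra.
Qed.

(** By polarization from the monotone convergence of the energies. *)
Lemma inner_cvg u v : H01 p V u -> H01 p V v ->
  cell_energy p m u v @[m --> \oo] --> energy_inner p u v.
Proof.
move=> hu hv; have huv := H01_lin 1 hu hv.
have -> : energy_inner p u v = limn (fun m => cell_energy p m u v).
  by rewrite /energy_inner; under eq_fun do rewrite (energy_formE N_ge2 hp hV).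
have pol m : cell_energy p m u v = 2^-1 * (cell_energy p m
    (fun x => 1 * u x + v x) (fun x => 1 * u x + v x)
    - cell_energy p m u u - cell_energy p m v v).
  rewrite cell_energy_lin !(cell_energyC _ _ _ (fun x => _ + _)) !cell_energy_lin.
  by rewrite (cell_energyC _ _ v u); field.
have h : cell_energy p m u v @[m --> \oo] -->
    2^-1 * (Wn (fun x => 1 * u x + v x) - Wn u - Wn v).
  under eq_fun do rewrite pol.
  apply: cvgM; first exact: cvg_cst.
  by apply: cvgB; [apply: cvgB|]; exact: Wn_cvg.
by rewrite (cvg_lim _ h).
Qed.

Lemma inner_Wn u : H01 p V u -> energy_inner p u u = Wn u.
Proof.
by move=> hu; apply: cvg_unique (inner_cvg hu hu) (Wn_cvg hu).
Qed.

Lemma innerC u v : H01 p V u -> H01 p V v -> energy_inner p u v = energy_inner p v u.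
Proof.
move=> hu hv; have h := inner_cvg hv hu.
rewrite (_ : (fun m => _) = fun m => cell_energy p m u v) in h.
  exact: cvg_unique (inner_cvg hu hv) h.
by apply/funext => m; exact: cell_energyC.
Qed.

Lemma inner_lin c u v w : H01 p V u -> H01 p V v -> H01 p V w ->
  energy_inner p (fun x => c * u x + v x) w =
  c * energy_inner p u w + energy_inner p v w.
Proof.
move=> hu hv hw; have h := inner_cvg (H01_lin c hu hv) hw.
rewrite (_ : (fun m => _) = fun m => c * cell_energy p m u w + cell_energy p m v w) in h.
  have h2 : c * cell_energy p m u w + cell_energy p m v w @[m --> \oo] -->
      c * energy_inner p u w + energy_inner p v w.
    exact: cvgD (cvgM (cvg_cst c) (inner_cvg hu hw)) (inner_cvg hv hw).
  exact: cvg_unique h h2.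
by apply/funext => m; exact: cell_energy_lin.
Qed.

Lemma H01_sup u x : H01 p V u -> V x -> `|u x| <= (N%:R + 2) * Num.sqrt (Wn u).
Proof.
move=> hu Vx; have [uc u0 _] := (H01E u).1 hu.
by have := sup_osc i0 uc (energy_bound_Wn hu) Vx; rewrite u0 subr0.
Qed.

(** Bounded energy upgrades pointwise convergence to uniform convergence, the
    vertices of a fine enough level forming a finite net.  This serves both
    completeness of the energy space and compactness of its balls. *)
Section Limits.
Context {F : set_system nat} {FF : ProperFilter F}.
Context {s : nat -> E -> R} {u : E -> R} {C : R}.
Context (sH : forall n, H01 p V (s n)) (sC : forall n, Wn (s n) <= C).
Context (su : forall x, V x -> s n x @[n --> F] --> u x).

Let sEb n : energy_bound (s n) C.
Proof. by move=> m; apply: le_trans (sC n); exact: energy_bound_Wn. Qed.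

Lemma limit_uniform e : 0 < e ->
  \forall n \near F, forall x, V x -> `|s n x - u x| <= e.
Proof.
move=> e0.
have [m hm] := geo_small (2 * (N%:R + 2) * Num.sqrt C) osc_ratio_itv
  (divr_gt0 e0 (ltr0Sn R 3)).
have near1 x d : V x -> 0 < d -> \forall n \near F, `|u x - s n x| <= d.
  by move=> /su/cvgrPdist_le h d0; exact: h.
have sosc n w y : size w = m -> V y ->
    `|s n (word_map p w y) - s n (word_map p w (p i0))| <= e / 4.
  move=> sw Vy; have [sc _ _] := (H01E (s n)).1 (sH n).
  apply: le_trans (cell_osc w sc (sEb n) Vy (gasket_corner hV i0)) _.
  by rewrite sw.
have uosc w y : size w = m -> V y ->
    `|u (word_map p w y) - u (word_map p w (p i0))| <= e / 4.
  move=> sw Vy; apply/ler_addgt0Pr => d d0.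
  have V1 := gasket_word hV w Vy.
  have V2 := gasket_word hV w (gasket_corner hV i0).
  have d2 : 0 < d / 2 by rewrite divr_gt0.
  have [n [h1 h2]] := filter_ex (filterI (near1 _ _ V1 d2) (near1 _ _ V2 d2)).
  have := sosc n w y sw Vy; move: h1 h2.
  move: (word_map p w y) (word_map p w (p i0)) => z1 z2; rewrite !ler_norml; lra.
have : \forall n \near F, forall w, w \in words m ->
    `|u (word_map p w (p i0)) - s n (word_map p w (p i0))| <= e / 4.
  apply: near_all_seq => w _; apply: near1; last by rewrite divr_gt0.
  exact: (gasket_word hV w (gasket_corner hV i0)).
apply: filterS.
move=> n hn x Vx; have [w [y [sw Vy ->]]] := gasket_word_cover hV m Vx.
have := sosc n w y sw Vy; have := uosc w y sw Vy; have := hn w.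
rewrite mem_words sw eqxx => /(_ isT).
move: (word_map p w y) (word_map p w (p i0)) => z1 z2; rewrite !ler_norml; lra.
Qed.

Lemma limit_continuous : {within V, continuous u}.
Proof.
apply/within_contP => x Vx e e0.
have [n hn] := filter_ex (limit_uniform (divr_gt0 e0 (ltr0Sn R 2))).
have [/within_contP/(_ x Vx _ (divr_gt0 e0 (ltr0Sn R 2)))[d d0 hd] _ _] := (H01E (s n)).1 (sH n).
exists d => // y Vy xy; have := hd y Vy xy; have := hn x Vx; have := hn y Vy.
rewrite !ler_norml; lra.
Qed.

Lemma cell_energy_cvg m (t : nat -> E -> R) v :
  (forall x, V x -> t n x @[n --> F] --> v x) ->
  cell_energy p m (t n) (t n) @[n --> F] --> cell_energy p m v v.
Proof.
elim: m t v => [|m IH] t v tv /=.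
  apply: cvg_big; first exact: add_continuous.
  move=> i _; apply: cvg_big; first exact: add_continuous.
  move=> j _; apply: cvgM; apply: cvgB; apply: tv; exact: (gasket_corner hV).
apply: cvgM; first exact: cvg_cst.
apply: cvg_big; first exact: add_continuous.
move=> a _; apply: IH => x Vx /=; apply: tv; exact: (gasket_simil hV).
Qed.

Lemma limit_energy : energy_bound u C.
Proof.
move=> m; have h := cell_energy_cvg (m := m) su.
apply: (cvgr_to_le h); apply: nearW => n; exact: sEb.
Qed.

Lemma limit_H01 : H01 p V u.
Proof.
apply/H01E; split; [exact: limit_continuous| |by exists C; exact: limit_energy].
move=> i; have h := su (gasket_corner hV i).
rewrite (_ : (fun n => _) = fun=> 0) in h; first exact: cvg_unique h (cvg_cst 0).
by apply/funext => n; have [_ ->] := (H01E (s n)).1 (sH n).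
Qed.

End Limits.
End FiniteEnergy.
Arguments energy_bound {R N} p u W.
Arguments Wn {R N} p u.

(** * Harmonic functions and a positive test function *)

Lemma real_cauchy {R : realType} (s : nat -> R) :
  (forall e, 0 < e -> exists n0, forall m n, (n0 <= m)%N -> (n0 <= n)%N ->
     `|s m - s n| <= e) -> exists l : R, s n @[n --> \oo] --> l.
Proof.
move=> hs; exists (limn s); apply: cauchy_cvg; apply/cauchy_exP => e /= e0.
have [n0 hn0] := hs (e / 2) (divr_gt0 e0 (ltr0Sn R 1)).
exists (s n0); exists n0 => // n /= hn; rewrite -ball_normE /=.
by apply: le_lt_trans (hn0 n0 n (leqnn _) hn) _; lra.
Qed.

Section HarmonicValues.
Context {R : realType} {N : nat}.
Implicit Types a : 'I_N -> R.

Let D0 : 0 < N%:R + 2 :> R. Proof. by rewrite ltr_wpDl. Qed.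

Definition osc_le a d := forall j k, `|a j - a k| <= d.

Lemma harmC a k i : harm a k i = harm a i k.
Proof. by rewrite /harm (eq_sym k); case: eqP => [->//|_]; congr (_ / _); ring. Qed.

Lemma harm_diag a k : harm a k k = a k.
Proof. by rewrite /harm eqxx. Qed.

Lemma harm_ge a k i c : (forall j, c <= a j) -> c <= harm a k i.
Proof.
move=> ca; rewrite /harm; case: eqP => // _; rewrite ler_pdivlMr //.
have : \sum_(j < N) c <= \sum_j a j by apply: ler_sum.
rewrite sumr_const card_ord -mulr_natl; have := ca i; have := ca k; lra.
Qed.

Lemma harm_le a k i c : (forall j, a j <= c) -> harm a k i <= c.
Proof.
move=> ca; rewrite /harm; case: eqP => // _; rewrite ler_pdivrMr //.
have : \sum_j a j <= \sum_(j < N) c by apply: ler_sum.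
rewrite sumr_const card_ord -mulr_natl; have := ca i; have := ca k; lra.
Qed.

Lemma harm_gt0 a k i : (forall j, 0 <= a j) -> 0 < \sum_j a j -> i != k ->
  0 < harm a k i.
Proof.
move=> a0 sa /negbTE ik; rewrite /harm ik divr_gt0 //.
by have := a0 i; have := a0 k; lra.
Qed.

(** A new value is a k itself or an average of the old ones in which a k has weight
    at least 1 / (N + 2); two such averages differ by (a i - a j) / (N + 2). *)
Lemma harm_osc a k d : osc_le a d ->
  osc_le (harm a k) ((N%:R + 1) / (N%:R + 2) * d).
Proof.
move=> ad.
have d0 (j : 'I_N) : 0 <= d by have := ad j j; rewrite subrr normr0.
have diag i : `|a k - harm a k i| <= (N%:R + 1) / (N%:R + 2) * d.
  have [->|ik] := eqVneq i k.
    by rewrite harm_diag subrr normr0 mulr_ge0 ?divr_ge0 ?addr_ge0 ?(ltW D0) ?(d0 k).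
  rewrite /harm (negbTE ik).
  have -> : a k - (a i + a k + \sum_j a j) / (N%:R + 2) =
      (\sum_j (a k - a j) + (a k - a i)) / (N%:R + 2).
    by rewrite sumrB sumr_const card_ord -[_ *+ N]mulr_natl; field; rewrite lt0r_neq0.
  rewrite normrM (gtr0_norm (_ : 0 < (N%:R + 2)^-1)) ?invr_gt0 // mulrAC.
  apply: ler_wpM2r; first by rewrite invr_ge0 ltW.
  apply: le_trans (ler_normD _ _) _; rewrite mulrDl mul1r; apply: lerD; last exact: ad.
  apply: le_trans (ler_norm_sum _ _ _) _.
  apply: le_trans (ler_sum _ (fun j _ => ad k j)) _.
  by rewrite sumr_const card_ord mulr_natl.
move=> i j; have [->|ik] := eqVneq i k; first by rewrite harm_diag; exact: diag.
have [->|jk] := eqVneq j k; first by rewrite distrC harm_diag; exact: diag.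
rewrite /harm (negbTE ik) (negbTE jk) -mulrBl (_ : _ - _ = a i - a j); last by ring.
rewrite normrM (gtr0_norm (_ : 0 < (N%:R + 2)^-1)) ?invr_gt0 // mulrC mulrAC.
rewrite mulrC; apply: ler_wpM2r; first by rewrite invr_ge0 ltW.
apply: le_trans (ad i j) _; rewrite ler_peMl ?(d0 k) // lerDr; exact: ler0n.
Qed.

End HarmonicValues.

Section HarmonicFunctions.
Context {R : realType} {N : nat}.
Local Notation E := 'rV[R]_N.-1.
Context {p : 'I_N -> E} {V : set E}.
Context (N_ge2 : (2 <= N)%N) (hp : unit_simplex p) (hV : gasket p V).
Implicit Types (u v : E -> R) (a : 'I_N -> R).

Let N0 : 0 < N%:R :> R. Proof. by rewrite ltr0n; case: N N_ge2. Qed.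
Let D0 : 0 < N%:R + 2 :> R. Proof. by rewrite addr_gt0. Qed.
Let i0 : 'I_N := Ordinal (ltnW N_ge2).
Let th : R := (N%:R + 1) / (N%:R + 2).

Let th01 : 0 <= th < 1.
Proof.
rewrite /th divr_ge0 ?addr_ge0 ?(ltW N0) ?(ltW D0) //= ltr_pdivrMr //; lra.
Qed.

Lemma word_cell_closed w : closed (word_map p w @` V).
Proof.
apply: compact_closed; first exact: norm_hausdorff.
apply: continuous_compact; last exact: (gasket_compact hV).
apply/subspace_continuousP => x Vx; apply/cvgrPdist_le => e e0.
apply: cvg_within; apply/nbhs_ballP; exists e => //= y.
rewrite -ball_normE /= => xy; rewrite word_map_dist; apply: le_trans (ltW xy).
by rewrite ler_piMl // exprn_ile1 // invf_le1 // ler1n.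
Qed.

(** The finitely many cells of level m that miss x are closed, hence at a positive
    distance from x. *)
Lemma common_cell m x : V x -> \forall y \near x, V y ->
  exists w z t, [/\ size w = m, V z, V t, x = word_map p w z & y = word_map p w t].
Proof.
move=> Vx.
have : \forall y \near x, forall w, w \in words m ->
    (word_map p w @` V) y -> (word_map p w @` V) x.
  apply: (@near_all_seq _ _ (nbhs x) _ (words m) (fun w y =>
    (word_map p w @` V) y -> (word_map p w @` V) x)) => w _.
  have [h|h] := pselect ((word_map p w @` V) x); first by apply: nearW.
  have : nbhs x (~` (word_map p w @` V)).
    by apply: open_nbhs_nbhs; split => //; apply: closed_openC; exact: word_cell_closed.
  by apply: filterS.
apply: filterS => y hy Vy; have [w [t [sw Vt yt]]] := gasket_word_cover hV m Vy.
have [|z Vz xz] := hy w _ (ex_intro2 _ _ t Vt (esym yt)); first by rewrite mem_words sw.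
by exists w, z, t.
Qed.

(** Nearby points of V share a cell of a prescribed level. *)
Lemma osc_continuous u (C q : R) : 0 <= q < 1 ->
  (forall w x y, V x -> V y ->
    `|u (word_map p w x) - u (word_map p w y)| <= C * q ^+ size w) ->
  {within V, continuous u}.
Proof.
move=> q01 uosc; apply/within_contP => x Vx e e0.
have [m hm] := geo_small C q01 e0.
have /nbhs_ballP[d /= d0 hd] := common_cell m Vx.
exists d => // y Vy xy.
have [|//|w [z [t [sw Vz Vt -> ->]]]] := hd y; first by rewrite -ball_normE.
by apply: le_trans (uosc w z t Vz Vt) _; rewrite sw.
Qed.

(** Harmonic functions on V: every point is the limit of the cells of one of its
    addresses, and the values at the vertices of these cells converge. *)
Lemma harmonic_exists : exists h : ('I_N -> R) -> E -> R,
  [/\ forall a i, h a (p i) = a i,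
      forall a i x, V x -> h a (simil p i x) = h (harm a i) x,
      forall a c x, V x -> (forall j, c <= a j) -> c <= h a x &
      forall a c x, V x -> (forall j, a j <= c) -> h a x <= c].
Proof.
have /choice[f hf] : forall x, exists f : 'I_N * E, V x -> V f.2 /\ x = simil p f.1 f.2.
  move=> x; have [Vx|nVx] := pselect (V x); last by exists (i0, x).
  by have [i [y h]] := gasket_cover hV Vx; exists (i, y).
(* f x is the first letter of an address of x, with the preimage of x in that
   cell; happ n follows the address for n letters and then takes a value at a
   vertex of the cell that is reached. *)
pose happ := fix happ n (a : 'I_N -> R) (x : E) : R :=
  if n is n'.+1 then happ n' (harm a (f x).1) (f x).2 else a i0.
have happ_ge n a c x : (forall j, c <= a j) -> c <= happ n a x.
  by elim: n a x => [|n IH] a x ca //=; apply: IH => j; exact: harm_ge.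
have happ_le n a c x : (forall j, a j <= c) -> happ n a x <= c.
  by elim: n a x => [|n IH] a x ca //=; apply: IH => j; exact: harm_le.
have happ_osc n a d x : osc_le a d -> forall i, `|happ n a x - a i| <= d.
  move=> ad i; rewrite ler_distl.
  rewrite happ_ge ?happ_le // => j; have := ad j i; rewrite ler_norml; lra.
have happ_cauchy n m a d x : osc_le a d -> `|happ (n + m)%N a x - happ n a x| <= th ^+ n * d.
  elim: n a d x => [|n IH] a d x ad; first by rewrite mul1r; exact: happ_osc.
  by rewrite /= exprSr -mulrA; apply: IH; exact: harm_osc.
have osc_ex a : exists2 d, 0 <= d & osc_le a d.
  exists (\sum_j \sum_k `|a j - a k|).
    by apply: sumr_ge0 => j _; apply: sumr_ge0.
  move=> j k; rewrite (bigD1 j) //= (bigD1 k) //= -addrA lerDl addr_ge0 //.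
    by apply: sumr_ge0.
  by apply: sumr_ge0 => l _; apply: sumr_ge0.
have happ_cvg a x : exists l : R, happ n a x @[n --> \oo] --> l.
  apply: (real_cauchy (s := fun n => happ n a x)) => e e0; have [d d0 ad] := osc_ex a.
  have [n0 hn0] := geo_small d th01 (divr_gt0 e0 (ltr0Sn R 1)).
  exists n0 => m n hm hn.
  have := happ_cauchy n0 (m - n0)%N a d x ad; have := happ_cauchy n0 (n - n0)%N a d x ad.
  rewrite !subnKC // (mulrC (th ^+ n0)) !ler_norml; lra.
pose h a x := limn (fun n => happ n a x).
have hcvg a x : happ n a x @[n --> \oo] --> h a x.
  by have [l hl] := happ_cvg a x; rewrite /h (cvg_lim _ hl).
have hrec a x : h a x = h (harm a (f x).1) (f x).2.
  have /(cvg_comp _ _ (cvg_addnr 1)) h1 := hcvg a x.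
  have h2 := hcvg (harm a (f x).1) (f x).2.
  apply: cvg_unique h2 => //; rewrite (_ : (fun n => _) = ((fun n => happ n a x) \o addn^~ 1%N)) //.
  by apply/funext => n /=; rewrite addn1.
have fcorner i : f (p i) = (i, p i).
  have [Vt pt] := hf _ (gasket_corner hV i).
  case: (f (p i)) Vt pt => k t /= Vt pt.
  have st : simil p i (p i) = simil p k t by rewrite simil_fix.
  have [ik|ik] := eqVneq i k.
    by rewrite -ik in st *; rewrite -(simil_inj st).
  have ki := cell_overlap N_ge2 hp hV (gasket_corner hV i) Vt ik st.
  by move: ik; rewrite (corner_inj N_ge2 hp ki) eqxx.
have hcorner a i : h a (p i) = a i.
  apply/eqP; rewrite -subr_eq0 -normr_le0.
  have [d d0 ad] := osc_ex a.
  apply: (geo_le0 th01 (K := d)) => m.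
  elim: m a d d0 ad => [|m IH] a d d0 ad.
    rewrite mulr1 ler_distl; apply/andP; split.
      apply: (cvgr_to_ge (hcvg a (p i))); apply: nearW => n; apply: happ_ge => j.
      by have := ad j i; rewrite ler_norml; lra.
    apply: (cvgr_to_le (hcvg a (p i))); apply: nearW => n; apply: happ_le => j.
    by have := ad j i; rewrite ler_norml; lra.
  rewrite hrec fcorner /= -{1}(harm_diag a i) exprS mulrCA mulrA.
  apply: IH; last exact: harm_osc.
  by rewrite mulr_ge0 //; case/andP: th01.
exists h; split => //.
- move=> a i x Vx; rewrite hrec.
  have [Vt] := hf _ (gasket_simil hV i Vx).
  case: (f (simil p i x)) Vt => k t /= Vt xt.
  have [ik|ik] := eqVneq i k; first by rewrite -ik in xt *; rewrite (simil_inj xt).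
  rewrite (cell_overlap N_ge2 hp hV Vx Vt ik xt) hcorner harmC.
  by rewrite eq_sym in ik; rewrite (cell_overlap N_ge2 hp hV Vt Vx ik (esym xt)) hcorner.
- move=> a c x Vx ca; apply: (cvgr_to_ge (hcvg a x)); apply: nearW => n; exact: happ_ge.
- move=> a c x Vx ca; apply: (cvgr_to_le (hcvg a x)); apply: nearW => n; exact: happ_le.
Qed.

(** Functions of finite energy between 0 and 1 are closed under products, by the
    Leibniz rule for differences. *)
Lemma prod_energy m u v : (forall x, V x -> 0 <= u x <= 1) ->
  (forall x, V x -> 0 <= v x <= 1) ->
  cell_energy p m (fun x => u x * v x) (fun x => u x * v x) <=
  2 * cell_energy p m u u + 2 * cell_energy p m v v.
Proof.
elim: m u v => [|m IH] u v u01 v01 /=.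
  rewrite /graph_energy !mulr_sumr -big_split; apply: ler_sum => i _ /=.
  rewrite !mulr_sumr -big_split; apply: ler_sum => j _ /=.
  have := u01 _ (gasket_corner hV i); have := v01 _ (gasket_corner hV j).
  move: (u (p i)) (u (p j)) (v (p i)) (v (p j)) => ui uj vi vj /andP[v0 v1] /andP[u0 u1].
  have -> : ui * vi - uj * vj = ui * (vi - vj) + vj * (ui - uj) by ring.
  have h1 : ui ^+ 2 * (vi - vj) ^+ 2 <= (vi - vj) ^+ 2.
    by rewrite ler_piMl ?sqr_ge0 // exprn_ile1.
  have h2 : vj ^+ 2 * (ui - uj) ^+ 2 <= (ui - uj) ^+ 2.
    by rewrite ler_piMl ?sqr_ge0 // exprn_ile1.
  have := sqr_ge0 (ui * (vi - vj) - vj * (ui - uj)); lra.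
rewrite !(mulrCA 2) -mulrDr; apply: ler_wpM2l; first by rewrite divr_ge0 ?ltW.
rewrite !mulr_sumr -big_split; apply: ler_sum => a _ /=.
by apply: IH => x Vx /=; [apply: u01|apply: v01]; exact: (gasket_simil hV).
Qed.

(** The product of the harmonic functions with boundary values 1 at one vertex
    and 0 at the others, and vice versa.  Each factor is positive off the vertices:
    where it vanishes, the nonnegative boundary values on the successive cells of
    an address are zero at one and the same vertex i only, so that i is
    the only letter of this address. *)
Lemma test_function : exists e : E -> R,
  [/\ H01 p V e, forall x, V x -> 0 <= e x &
      forall x, V x -> e x = 0 -> exists i, x = p i].
Proof.
have [h [hcorner hsim hge hle]] := harmonic_exists.
have hW a m : cell_energy p m (h a) (h a) = \sum_i \sum_j (a i - a j) * (a i - a j).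
  elim: m a => [|m IH] a /=.
    by apply: eq_bigr => i _; apply: eq_bigr => j _; rewrite !hcorner.
  rewrite harm_energy ?lt0r_neq0 //; congr (_ * _); apply: eq_bigr => i _.
  by rewrite -IH; apply: (cell_energy_ext hV) => x Vx; exact: hsim.
have hosc a d w x y : osc_le a d -> V x -> V y ->
    `|h a (word_map p w x) - h a (word_map p w y)| <= 2 * d * th ^+ size w.
  elim: w a d => [|i w IH] a d ad Vx Vy /=.
    have b z : V z -> a i0 - d <= h a z <= a i0 + d.
      move=> Vz; rewrite hge ?hle // => j; have := ad j i0; rewrite ler_norml; lra.
    have := b x Vx; have := b y Vy; rewrite mulr1 ler_norml; lra.
  rewrite !hsim; try exact: (gasket_word hV).
  apply: le_trans (IH _ (th * d) (harm_osc i ad) Vx Vy) _.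
  by rewrite exprS le_eqVlt; apply/orP; left; apply/eqP; ring.
have hcont a : {within V, continuous (h a)}.
  apply: (osc_continuous (C := 2 * \sum_j \sum_k `|a j - a k|) th01) => w x y Vx Vy.
  apply: hosc => // j k; rewrite (bigD1 j) //= (bigD1 k) //= -addrA lerDl addr_ge0 //.
    by apply: sumr_ge0.
  by apply: sumr_ge0 => l _; apply: sumr_ge0.
have h01 a x : V x -> (forall j, 0 <= a j <= 1) -> 0 <= h a x <= 1.
  by move=> Vx ha; rewrite hge ?hle // => j; case/andP: (ha j).
have min_pos a : (forall j, 0 < a j) -> exists2 c, 0 < c & forall j, c <= a j.
  move=> a0; case: (@arg_minP _ R 'I_N i0 xpredT a isT) => k _ hk.
  by exists (a k) => // j; exact: hk.
have hzero1 a i y : (forall j, 0 <= a j) -> (forall j, j != i -> 0 < a j) -> V y ->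
    h a y = 0 -> y = p i.
  move=> a0 ai Vy hy.
  apply: (@peel_corner _ _ p V hV [set y | V y /\ exists a, [/\ forall j, 0 <= a j,
    forall j, j != i -> 0 < a j & h a y = 0]] i).
  - by move=> z [].
  - move=> z [Vz [b [b0 bi hz]]]; have [k [t [Vt zt]]] := gasket_cover hV Vz.
    have sb : 0 < \sum_j b j.
      have [j ji] : exists j : 'I_N, j != i.
        have [->|ii] := eqVneq i i0; first by exists (Ordinal N_ge2).
        by exists i0; rewrite eq_sym.
      by rewrite (bigD1 j) //=; apply: ltr_wpDr (bi j ji); apply: sumr_ge0.
    rewrite zt hsim // in hz; have [ki|ki] := eqVneq k i.
      exists t; last by rewrite zt ki.
      split => //; exists (harm b k); split => // j; first exact: harm_ge.
      by rewrite -ki => jk; exact: harm_gt0.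
    have [|c c0 hc] := min_pos (harm b k).
      move=> j; have [->|jk] := eqVneq j k; first by rewrite harm_diag; exact: bi.
      exact: harm_gt0.
    by have := hge _ _ _ Vt hc; rewrite hz => /(lt_le_trans c0); rewrite ltxx.
  - by split => //; exists a.
have hzero a x : (forall j, 0 <= a j) -> 0 < \sum_j a j -> V x -> h a x = 0 ->
    exists i, x = p i.
  move=> a0 sa Vx; have [i [y [Vy ->]]] := gasket_cover hV Vx.
  rewrite hsim // => hy; exists i; rewrite (hzero1 _ i y _ _ Vy hy) ?simil_fix //.
    by move=> j; exact: harm_ge.
  by move=> j ji; exact: harm_gt0.
pose a1 (j : 'I_N) : R := (j == i0)%:R; pose a2 j := 1 - a1 j.
have a101 j : 0 <= a1 j <= 1 by rewrite /a1; case: eqP; rewrite ?ler01 ?lexx.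
have a201 j : 0 <= a2 j <= 1 by have := a101 j; rewrite /a2; lra.
exists (fun x => h a1 x * h a2 x); split.
- apply/(H01E N_ge2 hp hV); split.
  + by move=> x; apply: cvgM; exact: hcont.
  + by move=> i; rewrite !hcorner /a2 /a1; case: eqP => _; rewrite /= ?subrr ?mulr0 ?mul0r.
  + exists (2 * cell_energy p 0 (h a1) (h a1) + 2 * cell_energy p 0 (h a2) (h a2)) => m.
    have h1 x (Vx : V x) := h01 a1 x Vx a101.
    have h2 x (Vx : V x) := h01 a2 x Vx a201.
    by apply: le_trans (prod_energy m h1 h2) _; rewrite !hW.
- move=> x Vx; have /andP[? _] := h01 _ x Vx a101; have /andP[? _] := h01 _ x Vx a201.
  exact: mulr_ge0.
- move=> x Vx /eqP; rewrite mulf_eq0 => /orP[]/eqP; apply: hzero => //.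
  + by rewrite (bigD1 i0) //= /a1 eqxx; apply: ltr_wpDr => //; apply: sumr_ge0.
  + by move=> j; case/andP: (a201 j).
  + rewrite (bigD1 (Ordinal N_ge2)) //= /a2 /a1 /= subr0; apply: ltr_wpDr => //.
    by apply: sumr_ge0 => j _; case/andP: (a201 j).
Qed.

End HarmonicFunctions.

(** * Integration on the gasket *)

Section Integration.
Context {R : realType} {N : nat}.
Local Notation E := 'rV[R]_N.-1.
Context {p : 'I_N -> E} {V : set E}.
Context (N_ge2 : (2 <= N)%N) (hV : gasket p V).
Context {mu : {measure set (borelRn R N.-1) -> \bar R}} (hmu : gasket_measure V mu).
Implicit Types (g h : E -> R).

Local Notation VT := (V : set (borelRn R N.-1)).

Lemma measurable_open_E (A : set E) : open A -> measurable (A : set (borelRn R N.-1)).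
Proof. by move=> oA; apply: sub_sigma_algebra. Qed.

Lemma measurable_gasket : measurable VT.
Proof.
rewrite -[VT]setCK; apply: measurableC; apply: measurable_open_E.
exact: closed_openC (gasket_closed hV).
Qed.

Let mV := measurable_gasket.

Lemma mu_gasket : mu VT = 1%E. Proof. by case: hmu. Qed.

Lemma cont_measurable g : {within V, continuous g} ->
  measurable_fun VT (g : borelRn R N.-1 -> R).
Proof.
move=> /continuousP gc; apply: (measurability _ (measurable_realfun.RGenOpens.measurableE R)).
move=> _ [_ [a [b ->] <-]].
have oI : open `]a, b[%classic by exact: interval_open.
have /open_subspaceP[W oW WV] := gc _ oI.
rewrite setIC -WV; apply: measurableI => //; exact: measurable_open_E.
Qed.

Lemma cont_bounded g : {within V, continuous g} ->
  exists2 M, 0 <= M & forall x, V x -> `|g x| <= M.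
Proof.
move=> gc; have := compact_bounded (continuous_compact gc (gasket_compact hV)).
move=> /pinfty_ex_gt0[M M0 hM]; exists M; first exact: ltW.
by move=> x Vx; apply: hM; exists x.
Qed.

Let boundedV g : {within V, continuous g} -> [bounded g x | x in VT].
Proof.
move=> gc; have [M M0 hM] := cont_bounded gc; exists M; split; first exact: num_real.
by move=> y My x Vx; apply: le_trans (hM x Vx) (ltW My).
Qed.

Lemma cont_integrable g : {within V, continuous g} ->
  mu.-integrable VT (EFin \o g).
Proof.
move=> gc; apply: measurable_bounded_integrable => //.
- by rewrite mu_gasket ltry.
- exact: cont_measurable.
- exact: boundedV.
Qed.

Lemma mul_integrable h g : mu.-integrable VT (EFin \o h) ->
  {within V, continuous g} -> mu.-integrable VT (EFin \o (fun x => h x * g x)).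
Proof.
move=> hi gc.
have := @integrableMl _ _ _ mu VT mV (EFin \o h) g hi (cont_measurable gc) (boundedV gc).
exact.
Qed.

Lemma Rintegral_cst1 c : \int[mu]_(x in VT) c = c.
Proof. by rewrite Rintegral_cst // mu_gasket /= mulr1. Qed.

Lemma Rintegral_mul_bound h g M : mu.-integrable VT (EFin \o h) ->
  {within V, continuous g} -> (forall x, V x -> `|g x| <= M) ->
  `|\int[mu]_(x in VT) (h x * g x)| <= M * \int[mu]_(x in VT) `|h x|.
Proof.
move=> hi gc gM; have hgi := mul_integrable hi gc.
have hn : mu.-integrable VT (EFin \o (fun x => `|h x|)) by exact: integrable_norm.
apply: le_trans (le_normr_Rintegral mV hgi) _.
rewrite -RintegralZl //; apply: le_Rintegral => //.
- exact: integrable_norm.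
- have := integrableZl mV M hn; exact.
- by move=> x Vx; rewrite normrM mulrC; apply: ler_wpM2r => //; exact: gM.
Qed.

Lemma Rintegral_bound g M : {within V, continuous g} ->
  (forall x, V x -> `|g x| <= M) -> `|\int[mu]_(x in VT) g x| <= M.
Proof.
move=> gc gM; apply: le_trans (le_normr_Rintegral mV (cont_integrable gc)) _.
rewrite -(Rintegral_cst1 M); apply: (@le_Rintegral _ _ _ mu VT (fun x => `|g x|) (fun=> M)) => //.
- by apply: integrable_norm => //; exact: cont_integrable.
- by apply: cont_integrable; apply: continuous_subspaceT => x; exact: cst_continuous.
Qed.

Lemma cont_le_Rintegral g h : {within V, continuous g} -> {within V, continuous h} ->
  (forall x, V x -> g x <= h x) ->
  \int[mu]_(x in VT) g x <= \int[mu]_(x in VT) h x.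
Proof.
move=> gc hc gh.
by apply: (@le_Rintegral _ _ _ mu VT g h) => //; exact: cont_integrable.
Qed.

(** Points have diameter 0, and 0 to a positive power is 0. *)
Lemma hausdorff_corners (d : R) (A : set E) : 0 < d -> A `<=` range p ->
  (hausdorff d A <= 0)%E.
Proof.
move=> d0 Ap; apply: ge_ereal_sup => _ [e e0 <-].
pose U (k : nat) : set E := [set x | exists2 i : 'I_N, i = k :> nat & x = p i].
have dU k : ediam (U k) = 0%E.
  rewrite /ediam; apply/max_idPl; apply: ge_ereal_sup.
  move=> _ [x [i ik ->] [y [j jk ->] <-]].
  have -> : i = j by apply/val_inj; rewrite /= ik jk.
  rewrite subrr /enorm big1 ?sqrtr0 // => l _; by rewrite mxE expr0n.
apply: le_trans (ereal_inf_lbound _) _.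
  exists U; last reflexivity; split=> [k|x /Ap[i _ <-]].
    by rewrite dU lee_fin ltW.
  by exists (val i) => //; exists i.
by rewrite eseries0 // => k _ _; rewrite dU poweR0r // lt0r_neq0.
Qed.

Lemma Rintegral_gt0 g : {within V, continuous g} -> (forall x, V x -> 0 <= g x) ->
  (forall x, V x -> g x = 0 -> exists i, x = p i) -> 0 < \int[mu]_(x in VT) g x.
Proof.
move=> gc g0 gz; rewrite lt0r Rintegral_ge0 // andbT; apply/negP => /eqP I0.
have gi := cont_integrable gc.
pose Z := VT `&` [set x | g x = 0].
have mZ : measurable Z.
  have := cont_measurable gc mV (measurable_set1 (0 : R)).
  by congr measurable; apply/seteqP; split => x.
have muZ : mu Z = 0%E.
  case: hmu => -[c c0 muE] _; rewrite muE //.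
  have hz : (hausdorff (ln N%:R / ln 2) (Z `&` V) <= 0)%E.
    apply: hausdorff_corners.
      by rewrite divr_gt0 // ln_gt0 // ltr1n.
    by move=> x [[Vx /= /(gz x Vx)[i ->]] _]; exists i.
  apply/eqP; rewrite eq_le -{2}(muE _ mZ) measure_ge0 andbT.
  by rewrite mule_ge0_le0 // lee_fin ltW.
have : mu.-negligible (VT `&` [set x | g x <> 0]).
  have := ae_eq_integral_abs mu mV (measurable_int _ gi).
  have -> : (\int[mu]_(x in VT) `|(EFin \o g) x| = 0)%E.
    rewrite (@eq_integral _ _ _ mu VT (EFin \o g)); last first.
      by move=> x /[!inE] Vx /=; rewrite ger0_norm // g0.
    rewrite -[LHS]fineK; last exact: integrable_fin_num.
    by congr (_%:E); exact: I0.
  case=> /(_ erefl) + _; rewrite /ae_eq => h.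
  apply: negligibleS h => x [Vx /= gx0] /= /(_ Vx) [].
  exact: gx0.
have -> : VT `&` [set x | g x <> 0] = VT `\` Z.
  apply/seteqP; split => x [Vx h]; split => //; first by case.
  by move=> gx; apply: h.
move=> /negligibleP => /(_ (measurableD mV mZ)) muD.
have : (mu VT <= mu Z + mu (VT `\` Z))%E.
  rewrite -measureU //; last first.
  - by apply/seteqP; split => x // [h [_ /(_ h)]].
  - exact: measurableD.
  apply: le_measure; rewrite ?inE //; first by apply: measurableU => //; exact: measurableD.
  by move=> x Vx; have [h|h] := pselect (Z x); [left|right].
by rewrite muZ muD mu_gasket adde0 lee_fin ler10.
Qed.

Lemma ae_le0_Rintegral h g : mu.-integrable VT (EFin \o h) ->
  {within V, continuous g} -> (forall x, V x -> 0 <= g x) ->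
  {ae mu, forall x, V x -> h x <= 0} -> \int[mu]_(x in VT) (h x * g x) <= 0.
Proof.
move=> hi gc g0 h0; have hgi := mul_integrable hi gc.
have hn : mu.-integrable VT (EFin \o (fun x => `|h x * g x|)) by exact: integrable_norm.
have -> : \int[mu]_(x in VT) (h x * g x) = \int[mu]_(x in VT) (-1 * `|h x * g x|).
  congr fine; apply: ae_eq_integral => //; first exact: (measurable_int _ hgi).
    exact: (measurable_int _ (integrableZl mV (-1) hn)).
  apply: negligibleS h0 => x /= ne hx; apply: ne => Vx /=; congr EFin.
  by rewrite mulN1r ler0_norm ?opprK // mulr_le0_ge0 ?g0 // hx.
rewrite RintegralZl // mulN1r oppr_le0; exact: Rintegral_ge0.
Qed.

End Integration.

(** * The nonlinearity and its primitive *)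

Lemma heine_cantor {K : realType} {T : normedModType K} {A : set T} {u : T -> K} e :
  compact A -> {within A, continuous u} -> 0 < e ->
  exists2 d, 0 < d & forall x y, A x -> A y -> `|x - y| < d -> `|u x - u y| <= e.
Proof.
move=> /compact_near_coveringP cA /within_contP uc e0.
have := cA K (0 : K)^'+ (fun d x => forall y, A x -> A y -> `|x - y| < d -> `|u x - u y| <= e) _.
case=> [x Ax|d /= d0 hd].
  have [d d0 hd] := uc x Ax (e / 2) (divr_gt0 e0 (ltr0Sn K 1)).
  exists (ball x (d / 2), [set r | r < d / 2]).
    split; first by apply: nbhsx_ballx; rewrite divr_gt0.
    by apply: nbhs_right_lt; rewrite divr_gt0.
  move=> [z r] /= [xz rd] y Az Ay zy; rewrite -ball_normE /= in xz.
  have h1 : `|u x - u z| <= e / 2 by apply: hd => //; lra.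
  have h2 : `|u x - u y| <= e / 2.
    apply: hd => //; rewrite -(subrK z x) -addrA.
    apply: le_lt_trans (ler_normD _ _) _; lra.
  move: h1 h2; rewrite !ler_norml; lra.
exists (d / 2); first by rewrite divr_gt0.
move=> x y Ax Ay xy; apply: (hd (d / 2)) => //=; last by rewrite divr_gt0.
rewrite sub0r normrN gtr0_norm ?divr_gt0 //; lra.
Qed.

Section Primitive.
Context {R : realType}.
Implicit Types (g : R -> R) (a b t : R).

Let integrable_itv g a b : continuous g ->
  lebesgue_measure.-integrable `[a, b] (EFin \o g).
Proof.
move=> gc; apply: continuous_compact_integrable; first exact: segment_compact.
exact: continuous_subspaceT.
Qed.

(** The oriented integral from 0 has a single formula in terms of the integral
    from a point on the left of all the arguments considered. *)
Lemma primitive0E g a : continuous g -> a < 0 ->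
  exists2 G : R -> R, forall t : R, a < t -> is_derive t 1 G (g t) &
    forall t : R, a <= t -> primitive0 g t = G t - G 0.
Proof.
move=> gc a0; pose G t := \int[lebesgue_measure]_(s in `[a, t]) g s.
have ig := integrable_itv _ _ gc.
exists G => t at_.
  have tt : t < t + 1 by rewrite ltrDl.
  have [dG G'] := continuous_FTC1_closed tt (ig a (t + 1)) at_ (gc t).
  by rewrite -G' derive1E; apply: DeriveDef.
have between x y : a <= x -> x <= y -> G y - G x = \int[lebesgue_measure]_(s in `[x, y]) g s.
  move=> ax xy; rewrite /G Rintegral_itvB ?bnd_simp //.
  apply: Rintegral_itv_obnd_cbnd.
  by apply: integrableS (ig x y) => //; exact: subset_itv_oc_cc.
rewrite /primitive0; case: leP => [t0|/ltW t0]; first by rewrite between // ltW.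
by rewrite -(between t 0) // opprB.
Qed.

Lemma primitive0_0 g : continuous g -> primitive0 g 0 = 0.
Proof.
move=> gc; have [G _ PG] := primitive0E gc (@ltrN10 R).
by rewrite PG ?subrr // lerN10.
Qed.

Lemma primitive0_MVT g a b : continuous g -> a < b ->
  exists c, a <= c <= b /\ primitive0 g b - primitive0 g a = g c * (b - a).
Proof.
move=> gc ab; pose A := - (`|a| + 1).
have A0 : A < 0 by rewrite oppr_lt0; apply: ltr_wpDl.
have Aa : A < a.
  by have := ler_norm (- a); rewrite normrN /A; lra.
have [G dG PG] := primitive0E gc A0.
have [|c|c /itvP cab h] := @MVT R G g a b ab.
- by move=> x /itvP xab; apply: dG; apply: lt_trans Aa _; rewrite xab.
- apply: derivable_within_continuous => x /itvP xab.
  by apply: ex_derive; apply: dG; apply: lt_le_trans Aa _; rewrite xab.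
exists c; rewrite !cab; split => //.
rewrite !PG ?(ltW Aa) ?(ltW (lt_trans Aa ab)) // -h; ring.
Qed.

(** Covers both orders of a and b, at the price of locating c only by its distance
    to a. *)
Lemma primitive0_incr g a b : continuous g -> exists c,
  `|c - a| <= `|b - a| /\ primitive0 g b - primitive0 g a = g c * (b - a).
Proof.
move=> gc; have [ab|ba|->] := ltgtP a b; last first.
- by exists b; rewrite !subrr normr0 mulr0.
- have [c [cab h]] := primitive0_MVT gc ba; exists c; split.
    by rewrite !ler0_norm; lra.
  by rewrite -opprB h -mulrN opprB.
- have [c [cab h]] := primitive0_MVT gc ab; exists c; split => //.
  by rewrite !ger0_norm; lra.
Qed.

Lemma primitive0B g1 g2 t : continuous g1 -> continuous g2 ->
  primitive0 (fun s => g1 s - g2 s) t = primitive0 g1 t - primitive0 g2 t.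
Proof.
move=> c1 c2; rewrite /primitive0.
by case: ifP => _; rewrite RintegralB ?opprB //; try exact: integrable_itv; ring.
Qed.

(** The Ambrosetti-Rabinowitz inequality makes [ln (- P s) - nu ln s]
    nondecreasing, so that - P grows at least like s to the power nu > 2, hence
    faster than any multiple of s ^ 2. *)
Lemma primitive0_superquadratic g nu r0 c A : continuous g -> 2 < nu -> 0 < r0 ->
  (forall t, r0 <= t -> t * g t <= nu * primitive0 g t /\ nu * primitive0 g t < 0) ->
  0 < c -> c <= - primitive0 g r0 -> 0 < A ->
  forall s, r0 <= s -> expR ((ln A + nu * ln r0 - ln c) / (nu - 2)) <= s ->
  primitive0 g s <= - (A * s ^+ 2).
Proof.
move=> gc nu2 r00 hAR c0 cP A0 s rs hs; have s0 : 0 < s by exact: lt_le_trans rs.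
have [G dG PG] := primitive0E gc (@ltrN10 R).
have PGr t : r0 <= t -> G 0 - G t = - primitive0 g t.
  by move=> rt; rewrite PG ?opprB //; apply: le_trans rt; lra.
have Ppos t : r0 <= t -> 0 < - primitive0 g t.
  by move=> /hAR[_]; rewrite oppr_gt0 pmulr_rlt0 //; lra.
pose X t := ln (G 0 - G t) - nu * ln t.
have dX t : r0 <= t -> is_derive t 1 X ((G 0 - G t)^-1 * (0 - g t) - nu * t^-1).
  move=> rt; have t0 : 0 < t by exact: lt_le_trans rt.
  have d1 : is_derive t 1 G (g t) by apply: dG; lra.
  have d2 := is_derive1_ln t0.
  have d3 : is_derive (G 0 - G t) 1 (@ln R) (G 0 - G t)^-1.
    by apply: is_derive1_ln; rewrite PGr // Ppos.
  have d4 : is_derive t 1 (fun t => G 0 - G t) (0 - g t).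
    by apply: is_deriveB.
  have d5 := @is_derive1_comp R (@ln R) (fun t => G 0 - G t) t _ _ d3 d4.
  have d6 : is_derive t 1 (fun t => nu * ln t) (nu * t^-1) by exact: is_deriveZ.
  exact: is_deriveB.
have X_mono : X r0 <= X s.
  move: rs; rewrite le_eqVlt => /predU1P[->//|rs].
  have [| |t /itvP rts h] := @MVT R X (fun t => (G 0 - G t)^-1 * (0 - g t) - nu * t^-1) r0 s rs.
  - by move=> x /itvP xrs; apply: dX; rewrite ltW ?xrs.
  - apply: derivable_within_continuous => x /itvP xrs.
    by apply: ex_derive; apply: dX; rewrite xrs.
  have rt : r0 <= t by rewrite ltW ?rts.
  have t0 : 0 < t by exact: lt_le_trans rt.
  rewrite -subr_ge0 h; apply: mulr_ge0; last by rewrite subr_ge0 ltW.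
  rewrite PGr // sub0r subr_ge0.
  have [h1 _] := hAR t rt; have P0 := Ppos t rt.
  rewrite [leRHS]mulrC ler_pdivlMr // mulrAC ler_pdivrMr //.
  move: h1; lra.
move: X_mono; rewrite /X !PGr //.
have lc : ln c <= ln (- primitive0 g r0).
  by rewrite ler_ln ?posrE //; exact: lt_le_trans cP.
have ls : (ln A + nu * ln r0 - ln c) / (nu - 2) <= ln s.
  by rewrite -ler_expR lnK.
move: ls; rewrite ler_pdivrMr; last by rewrite subr_gt0.
move=> ls Xrs.
have : ln (A * s ^+ 2) <= ln (- primitive0 g s).
  have -> : ln (A * s ^+ 2) = ln A + ln s *+ 2.
    by rewrite lnM ?posrE; [rewrite lnXn; [|exact: s0]|exact: A0|exact: exprn_gt0].
  rewrite mulr2n.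
  move: lc ls Xrs; clear; move: (ln _) (ln _) (ln _) (ln _) (ln _) (ln _) => *; lra.
by rewrite ler_ln ?posrE ?mulr_gt0 ?exprn_gt0 ?Ppos // lerNr.
Qed.

End Primitive.

(** * The Hilbert space of the problem *)

Section AlphaForm.
Context {R : realType} {N : nat}.
Local Notation E := 'rV[R]_N.-1.
Context {p : 'I_N -> E} {V : set E}.
Context (N_ge2 : (2 <= N)%N) (hp : unit_simplex p) (hV : gasket p V).
Context {mu : {measure set (borelRn R N.-1) -> \bar R}} (hmu : gasket_measure V mu).
Context {alpha : E -> R} (halpha : mu.-integrable V (fun x => (alpha x)%:E)).

Local Notation L := (E -> R^o).
Implicit Types u v w : L.

Definition alpha_form u v : R :=
  energy_inner p u v - \int[mu]_(x in V) (alpha x * u x * v x).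

Let D : set L := H01 p V.
Let mV := measurable_gasket hV.

Let hlin := H01_lin N_ge2 hp hV.

Let addE u v : u + v = fun x => 1 * u x + v x.
Proof. by apply/funext => x; rewrite mul1r. Qed.

Let scaleE a u : a *: u = fun x => a * u x + 0.
Proof. by apply/funext => x; rewrite addr0. Qed.

Lemma H01_add u v : D u -> D v -> D (u + v).
Proof. by move=> Du Dv; rewrite addE; exact: hlin. Qed.

Lemma H01_scale a u : D u -> D (a *: u).
Proof.
by move=> Du; rewrite scaleE; apply: hlin => //; exact: (H01_0 N_ge2 hp hV).
Qed.

Lemma H01_cont u : D u -> {within V, continuous u}.
Proof. by case. Qed.

Lemma contM u v : {within V, continuous u} -> {within V, continuous v} ->
  {within V, continuous (fun x => u x * v x)}.
Proof. by move=> uc vc x; apply: cvgM; [exact: uc|exact: vc]. Qed.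

Let int_alpha u v : D u -> D v ->
  mu.-integrable V (EFin \o (fun x => alpha x * u x * v x)).
Proof.
move=> /H01_cont uc /H01_cont vc.
rewrite (_ : (fun x => _) = fun x => alpha x * (u x * v x)); last first.
  by apply/funext => x; rewrite mulrA.
exact: (mul_integrable hV halpha (contM uc vc)).
Qed.

Lemma alpha_form_bound u : D u ->
  `|\int[mu]_(x in V) (alpha x * u x * u x)| <=
  (N%:R + 2) ^+ 2 * (\int[mu]_(x in V) `|alpha x|) * Wn p u.
Proof.
move=> Du; have uc := H01_cont Du.
rewrite (_ : (fun x => _) = fun x => alpha x * (u x * u x)); last first.
  by apply/funext => x; rewrite mulrA.
apply: le_trans (Rintegral_mul_bound hV halpha (contM uc uc)
  (M := (N%:R + 2) ^+ 2 * Wn p u) _) _; last by rewrite mulrAC.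
move=> x Vx; have h := H01_sup N_ge2 hp hV Du Vx.
have W0 : 0 <= Wn p u.
  exact: le_trans (cell_energy_ge0 p 0 u) (energy_bound_Wn N_ge2 hp hV Du 0).
by rewrite normrM -expr2 -(sqr_sqrtr W0) -exprMn ler_sqr ?nnegrE.
Qed.

Lemma alpha_form_Wn u : D u ->
  alpha_form u u = Wn p u - \int[mu]_(x in V) (alpha x * u x * u x).
Proof. by move=> Du; rewrite /alpha_form (inner_Wn N_ge2 hp hV). Qed.

(** If alpha is nonpositive then the form dominates the energy.  Otherwise the
    supremum bound for functions of finite energy, which holds with N + 2 and a
    fortiori with 2 N + 3, makes the integral a small fraction of the energy. *)
Lemma alpha_coercive kappa :
  ({ae mu, forall x, V x -> alpha x <= 0} /\ kappa = (2 * N + 3)%:R) \/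
  (\int[mu]_(x in V) `|alpha x| < 1 / (2 * N + 3)%:R ^+ 2 /\
    kappa = (2 * N + 3)%:R /
      Num.sqrt (1 - (2 * N + 3)%:R ^+ 2 * \int[mu]_(x in V) `|alpha x|)) ->
  exists2 c, 0 < c & kappa = (2 * N + 3)%:R / Num.sqrt c /\
    forall u, D u -> c * Wn p u <= alpha_form u u.
Proof.
have k0 : 0 < (2 * N + 3)%:R :> R by rewrite ltr0n addn3.
case=> [[a0 ->]|[a1 ->]].
  exists 1 => //; rewrite sqrtr1 divr1; split => // u Du.
  rewrite alpha_form_Wn // mul1r lerBrDr gerDl.
  rewrite (_ : (fun x => _) = fun x => alpha x * (u x * u x)); last first.
    by apply/funext => x; rewrite mulrA.
  have uc := H01_cont Du.
  apply: (ae_le0_Rintegral hV halpha (contM uc uc)) => // x Vx.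
  by rewrite -expr2 sqr_ge0.
exists (1 - (2 * N + 3)%:R ^+ 2 * \int[mu]_(x in V) `|alpha x|).
  by move: a1; rewrite ltr_pdivlMr ?exprn_gt0 // subr_gt0 mulrC.
split => // u Du; rewrite alpha_form_Wn //.
have := alpha_form_bound Du; move=> /(le_trans (ler_norm _)) h.
rewrite mulrBl mul1r lerB //; apply: le_trans h _.
apply: ler_wpM2r.
  exact: le_trans (cell_energy_ge0 p 0 u) (energy_bound_Wn N_ge2 hp hV Du 0).
apply: ler_wpM2r; first exact: Rintegral_ge0.
by rewrite ler_sqr ?nnegrE ?addr_ge0 // natrD natrM; have := ler0n R N; lra.
Qed.

Section Coercive.
Context {c : R} (c0 : 0 < c).
Context (hc : forall u, D u -> c * Wn p u <= alpha_form u u).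

Let W0 u : D u -> 0 <= Wn p u.
Proof.
by move=> Du; apply: le_trans (cell_energy_ge0 p 0 u) (energy_bound_Wn N_ge2 hp hV Du 0).
Qed.

Lemma alpha_psd : psd_form (D : set L) alpha_form.
Proof.
split.
- exact: (H01_0 N_ge2 hp hV).
- exact: H01_add.
- exact: H01_scale.
- move=> u v Du Dv; rewrite /alpha_form (innerC N_ge2 hp hV) //; congr (_ - Rintegral _ _ _).
  by apply/funext => x; rewrite mulrAC.
- move=> u v w Du Dv Dw; rewrite /alpha_form addE (inner_lin N_ge2 hp hV) // mul1r.
  rewrite (_ : (fun x => _) = fun x => alpha x * u x * w x + alpha x * v x * w x); last first.
    by apply/funext => x; rewrite mul1r; ring.
  by rewrite RintegralD //; [ring|exact: int_alpha..].
- move=> a u w Du Dw; have DZ := H01_0 N_ge2 hp hV.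
  rewrite /alpha_form scaleE (inner_lin N_ge2 hp hV) //.
  have -> : energy_inner p (fun=> 0) w = 0.
    have := inner_lin N_ge2 hp hV (-1) DZ DZ Dw.
    rewrite (_ : (fun x => _) = fun=> 0); last by apply/funext => x; rewrite mulr0 addr0.
    by move=> ->; rewrite mulN1r addNr.
  rewrite addr0 (_ : (fun x => _) = fun x => a * (alpha x * u x * w x)); last first.
    by apply/funext => x; ring.
  by rewrite RintegralZl //; [ring|exact: int_alpha].
- by move=> u Du; apply: le_trans (hc Du); rewrite mulr_ge0 ?W0 // ltW.
Qed.

Lemma alpha_nrm_sup u x : D u -> V x ->
  `|u x| <= (2 * N + 3)%:R / Num.sqrt c * nrm alpha_form u.
Proof.
move=> Du Vx; apply: le_trans (H01_sup N_ge2 hp hV Du Vx) _.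
rewrite -mulrA; apply: ler_pM; rewrite ?addr_ge0 ?sqrtr_ge0 //.
  by rewrite natrD natrM; have := ler0n R N; lra.
rewrite ler_pdivlMl ?sqrtr_gt0 // -sqrtrM ?(ltW c0) // ler_sqrt; first exact: hc.
exact: (psd_ge0 alpha_psd).
Qed.

(** A Cauchy sequence converges uniformly on V by the supremum bound, and bounds on
    the energies of differences pass to the pointwise limit. *)
Lemma alpha_complete : @psd_complete R L D alpha_form.
Proof.
move=> s sD sC; have hB := alpha_psd.
set k := (2 * N + 3)%:R / Num.sqrt c.
have k0 : 0 < k by rewrite divr_gt0 ?sqrtr_gt0 // ltr0n addn3.
have /choice[u hu] : forall x, exists l : R, V x -> s n x @[n --> \oo] --> l.
  move=> x; have [Vx|nVx] := pselect (V x); last by exists 0.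
  have [|l hl] := @real_cauchy R (fun n => s n x); last by exists l.
  move=> e e0; have [n0 hn0] := sC (e / k) (divr_gt0 e0 k0); exists n0 => m n hm hn.
  have := alpha_nrm_sup (psd_B hB (sD m) (sD n)) Vx.
  move=> /le_trans; apply; rewrite -/k mulrC -ler_pdivlMr //; exact: hn0.
have W_nrm v e : D v -> nrm alpha_form v <= e -> 0 <= e -> Wn p v <= e ^+ 2 / c.
  move=> Dv ve e0; rewrite ler_pdivlMr // mulrC; apply: le_trans (hc Dv) _.
  by rewrite -(nrm_sqr hB) // ler_sqr ?nnegrE ?nrm_ge0.
have shift n x (Vx : V x) : s (n + k)%N x @[k --> \oo] --> u x.
  rewrite (_ : (fun k => _) = (fun k => s k x) \o addn n) //.
  have := hu x Vx; rewrite -(cvg_shiftn n).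
  by under eq_fun do rewrite addnC.
have Du : D u.
  have [n0 hn0] := sC 1 ltr01.
  pose C := (nrm alpha_form (s n0) + 1) ^+ 2 / c.
  apply: (limit_H01 (F := \oo) N_ge2 hp hV (fun j => sD (n0 + j)%N)
    (C := C) _ (shift n0)).
  move=> j; apply: W_nrm; rewrite ?addr_ge0 ?nrm_ge0 //.
  apply: le_trans (nrm_dist hB (sD _) (sD n0)) _.
  by rewrite lerD2l; apply: hn0; rewrite ?leq_addr.
exists u => // e e0.
(* The form is at most C2 times the energy. *)
pose C2 := 1 + (N%:R + 2) ^+ 2 * \int[mu]_(x in V) `|alpha x|.
have C20 : 0 < C2.
  by rewrite ltr_pwDl // mulr_ge0 ?sqr_ge0 // Rintegral_ge0.
pose d := e * Num.sqrt (c / C2).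
have d0 : 0 < d by rewrite mulr_gt0 // sqrtr_gt0 divr_gt0.
have [n1 hn1] := sC d d0; exists n1 => n hn.
have Dnu : D (s n - u) := psd_B hB (sD n) Du.
have : Wn p (s n - u) <= d ^+ 2 / c.
  apply: (Wn_le N_ge2 hp hV).
  apply: (limit_energy (F := \oo) N_ge2 hp hV (s := fun j => s n - s (n1 + j)%N)).
  - by move=> j; exact: (psd_B hB (sD n) (sD _)).
  - move=> j; apply: W_nrm; [exact: (psd_B hB (sD n) (sD _))| |exact: ltW].
    by apply: hn1; rewrite ?leq_addr.
  - by move=> x Vx; apply: cvgB; [exact: cvg_cst|exact: shift].
rewrite (nrm_le hB) ?(ltW e0) // alpha_form_Wn //.
have := alpha_form_bound Dnu; rewrite ler_norml => /andP[h1 _] h2.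
have : C2 * Wn p (s n - u) <= C2 * (d ^+ 2 / c) by apply: ler_wpM2l => //; exact: ltW.
rewrite /d exprMn sqr_sqrtr ?divr_ge0 ?(ltW c0) ?(ltW C20) //.
rewrite (_ : C2 * (e ^+ 2 * (c / C2) / c) = e ^+ 2); last first.
  by field; rewrite !lt0r_neq0.
rewrite {1}/C2; move: h1; lra.
Qed.

End Coercive.
End AlphaForm.
Arguments alpha_form {R N} p V mu alpha u v.

(** * The nonlinearity on the gasket *)

Section Sign.
Context {R : realType} {N : nat}.
Local Notation E := 'rV[R]_N.-1.
Context {p : 'I_N -> E} {V : set E}.
Context (hV : gasket p V).

(** Connectedness of the gasket, in the form needed: cells of the same level are
    glued at vertices, so a sign that is constant on each of them is constant. *)
Lemma sign_glue m (g : E -> R) :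
  (forall w x y, size w = m -> V x -> V y ->
     (0 < g (word_map p w x)) = (0 < g (word_map p w y))) ->
  forall x y, V x -> V y -> (0 < g x) = (0 < g y).
Proof.
elim: m g => [|m IH] g gw x y Vx Vy; first exact: (gw [::]).
have ga a : forall x y, V x -> V y -> (0 < g (simil p a x)) = (0 < g (simil p a y)).
  by apply: (IH (g \o simil p a)) => w x' y' sw; apply: (gw (a :: w)); rewrite /= sw.
have [a [x' [Vx' ->]]] := gasket_cover hV Vx.
have [b [y' [Vy' ->]]] := gasket_cover hV Vy.
have Vp i : V (p i) := gasket_corner hV i.
by rewrite (ga a x' (p b) Vx' (Vp b)) (ga b y' (p a) Vy' (Vp a)) simil_corner_swap.
Qed.

Lemma const_sign (g : E -> R) : {within V, continuous g} ->
  (forall x, V x -> g x <> 0) ->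
  (forall x, V x -> 0 < g x) \/ (forall x, V x -> 0 < - g x).
Proof.
move=> gc gn; have V0 : V !=set0 by case: hV.
have nc : {within V, continuous (fun x => `|g x|)}.
  by move=> x; apply: cvg_norm; exact: gc.
have [z] := compact_EVT_min V0 (gasket_compact hV) nc.
rewrite inE => Vz zmin.
have z0 : 0 < `|g z| by rewrite normr_gt0; apply/eqP; exact: gn.
have [d d0 hd] := heine_cantor (gasket_compact hV) gc (divr_gt0 z0 (ltr0Sn R 1)).
have [K K0 hK] := gasket_bounded hV.
have [||m hm] := @geo_small R 2^-1 (2 * K) (d / 2).
- by apply/andP; split; lra.
- by rewrite divr_gt0.
have same x y : V x -> V y -> `|x - y| < d -> 0 < g x -> 0 < g y.
  move=> Vx Vy xy gx; have := hd x y Vx Vy xy; have := zmin x (mem_set Vx).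
  rewrite (gtr0_norm gx) => h1; rewrite ler_norml => /andP[_ h2]; lra.
have sg : forall x y, V x -> V y -> (0 < g x) = (0 < g y).
  apply: (sign_glue (m := m)) => w x y sw Vx Vy.
  have close x' y' : V x' -> V y' -> `|word_map p w x' - word_map p w y'| < d.
    move=> Vx' Vy'; rewrite word_map_dist sw mulrC.
    apply: (@le_lt_trans _ _ (d / 2)); last lra.
    apply: le_trans hm; apply: ler_wpM2r; first by rewrite exprn_ge0 // invr_ge0.
    by apply: le_trans (ler_normB _ _) _; have := hK _ Vx'; have := hK _ Vy'; lra.
  have Vw x' : V x' -> V (word_map p w x') by exact: gasket_word.
  by apply/idP/idP; apply: same; auto.
have [gz|gz] := ltP 0 (g z).
  by left=> x Vx; rewrite (sg x z).
right=> x Vx; rewrite oppr_gt0 lt_neqAle; apply/andP; split; first exact/eqP/gn.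
by rewrite leNgt (sg x z) // -leNgt.
Qed.

End Sign.

Lemma mul_frac_le {R : realType} (b e : R) : 0 <= b -> 0 <= e -> b * (e / (b + 1)) <= e.
Proof.
move=> b0 e0; rewrite mulrA ler_pdivrMr; last by rewrite ltr_wpDl.
by rewrite mulrC mulrDr mulr1 lerDl.
Qed.

Section Nonlinearity.
Context {R : realType} {N : nat}.
Local Notation E := 'rV[R]_N.-1.
Context {p : 'I_N -> E} {V : set E} (hV : gasket p V).
Context {f : E -> R -> R}
  (hf : {within V `*` [set: R], continuous (fun z : E * R => f z.1 z.2)}).
Implicit Types u : E -> R.

Lemma nonlin_joint x s : V x -> forall e, 0 < e -> exists2 d, 0 < d &
  forall y t, V y -> `|x - y| < d -> `|s - t| < d -> `|f x s - f y t| <= e.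
Proof.
move=> Vx e e0; have [//|d d0 hd] := within_contP.1 hf (x, s) _ e e0.
exists d => // y t Vy xy st; apply: (hd (y, t)) => //.
by rewrite prod_normE /= gt_max xy.
Qed.

Lemma nonlin_cont x : V x -> continuous (f x).
Proof.
move=> Vx t; apply/cvgrPdist_le => e e0.
have [d d0 hd] := nonlin_joint t Vx e0.
apply/nbhs_ballP; exists d => // s /= ts.
by apply: hd => //; rewrite subrr normr0.
Qed.

Lemma nonlin_comp u : {within V, continuous u} ->
  {within V, continuous (fun x => f x (u x))}.
Proof.
move=> /within_contP uc; apply/within_contP => x Vx e e0.
have [d d0 hd] := nonlin_joint (u x) Vx e0.
have [d' d'0 hd'] := uc x Vx (d / 2) (divr_gt0 d0 (ltr0Sn R 1)).
exists (Num.min d d'); first by rewrite lt_min d0.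
move=> y Vy; rewrite lt_min => /andP[xy xy']; apply: hd => //.
apply: le_lt_trans (hd' y Vy xy') _; lra.
Qed.

Let box A : set (E * R) := V `*` `[- A, A].

Let box_compact A : compact (box A).
Proof.
by apply: compact_setX; [exact: (gasket_compact hV)|exact: segment_compact].
Qed.

Let box_cont A : {within box A, continuous (fun z : E * R => f z.1 z.2)}.
Proof. by apply: continuous_subspaceW hf => -[x s] []. Qed.

Let in_box A x s : V x -> `|s| <= A -> box A (x, s).
Proof. by move=> Vx sA; split => //=; rewrite in_itv /= -ler_norml. Qed.

Lemma nonlin_unif A e : 0 < e -> exists2 d, 0 < d & forall x y s t, V x -> V y ->
  `|s| <= A -> `|t| <= A -> `|x - y| < d -> `|s - t| < d -> `|f x s - f y t| <= e.
Proof.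
move=> e0; have [d d0 hd] := heine_cantor (@box_compact A) (@box_cont A) e0.
exists d => // x y s t Vx Vy sA tA xy st.
by apply: (hd (x, s) (y, t)); [exact: in_box..|rewrite prod_normE /= gt_max xy].
Qed.

Lemma nonlin_bound A : exists2 M, 0 <= M & forall x t, V x -> `|t| <= A -> `|f x t| <= M.
Proof.
have := compact_bounded (continuous_compact (@box_cont A) (@box_compact A)).
move=> /pinfty_ex_gt0[M M0 hM]; exists M; first exact: ltW.
by move=> x t Vx tA; apply: hM; exists (x, t) => //; exact: in_box.
Qed.

Local Notation P := (fun x t => primitive0 (f x) t).

Lemma prim_lip A : exists2 M, 0 <= M & forall x s t, V x -> `|s| <= A -> `|t| <= A ->
  `|P x t - P x s| <= M * `|t - s|.
Proof.
have [M M0 hM] := nonlin_bound (3 * A); exists M => // x s t Vx sA tA.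
have [c [cs ->]] := primitive0_incr s t (nonlin_cont Vx).
rewrite normrM; apply: ler_wpM2r => //; apply: hM => //.
move: sA tA cs; rewrite -{2}(subrK s c) => sA tA cs.
apply: le_trans (ler_normD _ _) _.
have := ler_normB t s; lra.
Qed.

Lemma prim_bound A : exists2 M, 0 <= M & forall x t, V x -> `|t| <= A -> `|P x t| <= M.
Proof.
have [A0|A0] := leP 0 A; last first.
  by exists 0 => // x t _ tA; have := normr_ge0 t; lra.
have [M M0 hM] := prim_lip A; exists (M * A); first exact: mulr_ge0.
move=> x t Vx tA; have := hM x 0 t Vx; rewrite normr0 => /(_ A0 tA).
rewrite (primitive0_0 (nonlin_cont Vx)) !subr0 => /le_trans; apply.
exact: ler_wpM2l.
Qed.

(** Continuity in x of the integral of f(x, .) over a bounded interval needs f to be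
    uniformly continuous on compact sets. *)
Lemma prim_comp u : {within V, continuous u} ->
  {within V, continuous (fun x => P x (u x))}.
Proof.
move=> uc; have [A A0 hA] := cont_bounded hV uc.
have [M M0 hM] := prim_lip A.
apply/within_contP => x Vx e e0.
have eA : 0 < e / 2 / (A + 1) by rewrite !divr_gt0 // ltr_wpDl.
have eM : 0 < e / 2 / (M + 1) by rewrite !divr_gt0 // ltr_wpDl.
have [d d0 hd] := nonlin_unif A eA.
have [d' d'0 hd'] := within_contP.1 uc x Vx _ eM.
exists (Num.min d d'); first by rewrite lt_min d0.
move=> y Vy; rewrite lt_min => /andP[xy xy'].
have h1 : `|P x (u x) - P x (u y)| <= e / 2.
  apply: le_trans (hM x (u y) (u x) Vx (hA y Vy) (hA x Vx)) _.
  apply: le_trans (ler_wpM2l M0 (hd' y Vy xy')) _.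
  by apply: mul_frac_le => //; rewrite divr_ge0 // ltW.
have h2 : `|P x (u y) - P y (u y)| <= e / 2.
  have fxc := nonlin_cont Vx; have fyc := nonlin_cont Vy.
  rewrite -(primitive0B _ fxc fyc).
  have dc : continuous (fun s => f x s - f y s).
    by move=> s; apply: cvgB; [exact: fxc|exact: fyc].
  have [c [ct]] := primitive0_incr 0 (u y) dc.
  rewrite (primitive0_0 dc) !subr0 in ct * => ->; rewrite normrM.
  have cA : `|c| <= A by apply: le_trans ct (hA y Vy).
  have := hd x y c c Vx Vy cA cA xy; rewrite subrr normr0 => /(_ d0) h.
  apply: le_trans (ler_pM (normr_ge0 _) (normr_ge0 _) h (hA y Vy)) _.
  by rewrite mulrC; apply: mul_frac_le => //; rewrite divr_ge0 // ltW.
move: h1 h2; rewrite !ler_norml; lra.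
Qed.

Lemma prim_diff A e : 0 < e -> exists2 d, 0 < d & forall x a h, V x -> `|a| <= A ->
  `|h| <= d -> `|P x (a + h) - P x a - f x a * h| <= e * `|h|.
Proof.
move=> e0; have [d d0 hd] := nonlin_unif (A + 1) e0.
exists (Num.min (d / 2) 1); first by rewrite lt_min ltr01 divr_gt0.
move=> x a h Vx aA; rewrite le_min => /andP[h1 h2].
have [c [ca ->]] := primitive0_incr a (a + h) (nonlin_cont Vx).
have ah : a + h - a = h by rewrite addrC addKr.
rewrite ah in ca *; rewrite -mulrBl normrM; apply: ler_wpM2r => //.
apply: hd => //; rewrite ?subrr ?normr0 //; last by lra.
  by rewrite -(subrK a c); apply: le_trans (ler_normD _ _) _; lra.
by apply: le_trans aA _; rewrite lerDl.
Qed.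

Context {nu r0 : R} (hnu : 2 < nu) (hr0 : 0 < r0).
Context (hAR : forall (t : R) x, r0 <= `|t| -> V x ->
  t * f x t <= nu * P x t /\ nu * P x t < 0).

(** The quantity is nonnegative for |t| >= r0 and bounded for |t| <= r0. *)
Lemma prim_AR : exists2 C, 0 <= C & forall x t, V x -> - C <= P x t - f x t * t / nu.
Proof.
have [M M0 hM] := nonlin_bound r0; have [M' M'0 hM'] := prim_bound r0.
have nu0 : 0 < nu by exact: lt_trans hnu.
have C0 : 0 <= M' + M * r0 / nu.
  by apply: addr_ge0 => //; apply: divr_ge0; [apply: mulr_ge0 => //; exact: ltW|exact: ltW].
exists (M' + M * r0 / nu) => //.
move=> x t Vx; have [rt|/ltW tr] := leP r0 `|t|.
  have [h _] := hAR rt Vx; apply: (@le_trans _ _ 0).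
    by rewrite oppr_le0.
  by rewrite subr_ge0 ler_pdivrMr // mulrC [leRHS]mulrC.
have := hM x t Vx tr; have := hM' x t Vx tr; rewrite ler_norml => /andP[h1 _] h2.
rewrite opprD; apply: lerB => //; rewrite ler_pM2r ?invr_gt0 //.
apply: le_trans (ler_norm _) _; rewrite normrM; exact: ler_pM.
Qed.

Lemma prim_superquadratic A : 0 < A -> exists2 C, 0 <= C &
  forall x s, V x -> 0 <= s -> P x s <= C - A * s ^+ 2.
Proof.
move=> A0; have V0 : V !=set0 by case: hV.
have cr : {within V, continuous (fun x => P x r0)}.
  by apply: (prim_comp (u := fun=> r0)); apply: continuous_subspaceT => x; exact: cst_continuous.
have [z] := compact_EVT_max V0 (gasket_compact hV) cr.
rewrite inE => Vz zmax; set c := - P z r0.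
have nu0 : 0 < nu by exact: lt_trans hnu.
have c0 : 0 < c.
  have [|_] := hAR _ Vz (t := r0); first by rewrite gtr0_norm.
  by rewrite oppr_gt0 pmulr_rlt0.
pose T := Num.max r0 (expR ((ln A + nu * ln r0 - ln c) / (nu - 2))).
have T0 : 0 < T by rewrite lt_max hr0.
have [M M0 hM] := prim_bound T.
exists (M + A * T ^+ 2); first by rewrite addr_ge0 // mulr_ge0 ?sqr_ge0 // ltW.
move=> x s Vx s0; have [Ts|/ltW sT] := leP T s.
  move: Ts; rewrite ge_max => /andP[rs es].
  have := primitive0_superquadratic (nonlin_cont Vx) hnu hr0 _ c0 _ A0 rs es.
  have c_le : c <= - primitive0 (f x) r0 by rewrite lerN2; apply: zmax; rewrite inE.
  move=> /(_ _ c_le) h; apply: le_trans (h _) _.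
    move=> t rt; apply: hAR => //; rewrite ger0_norm //.
    exact: le_trans (ltW hr0) rt.
  by have := sqr_ge0 T => T2; have := mulr_ge0 (ltW A0) T2; lra.
have := hM x s Vx; rewrite ger0_norm // => /(_ sT); rewrite ler_norml => /andP[_ h].
have : A * s ^+ 2 <= A * T ^+ 2.
  by apply: ler_wpM2l; [exact: ltW|rewrite ler_sqr ?nnegrE ?(ltW T0)].
lra.
Qed.

End Nonlinearity.

(** * The energy functional and its critical points *)

(** Ultrafilters replace the extraction of a diagonal subsequence. *)
Lemma ultra_cvg {R : realType} {T : Type} {U : set_system T} (s : T -> R) (M : R) :
  UltraFilter U -> (forall n, `|s n| <= M) -> exists l : R, s n @[n --> U] --> l.
Proof.
move=> UU sM; have PU : ProperFilter U by exact: ultra_proper.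
have [|l [_ lU]] := @segment_compact R (- M) M (s @ U) (fmap_proper_filter s PU).
  apply: (@filterE T U _ (s @^-1` `[- M, M])) => n.
  by rewrite /= in_itv /= -ler_norml.
exists l => A lA; have [//|nA] := in_ultra_setVsetC (s @^-1` A) UU.
by have [x [nx Ax]] := lU (~` A) A nA lA.
Qed.

Section Functional.
Context {R : realType} {N : nat}.
Local Notation E := 'rV[R]_N.-1.
Context {p : 'I_N -> E} {V : set E}.
Context (N_ge2 : (2 <= N)%N) (hp : unit_simplex p) (hV : gasket p V).
Context {mu : {measure set (borelRn R N.-1) -> \bar R}} (hmu : gasket_measure V mu).
Context {alpha : E -> R} (halpha : mu.-integrable V (fun x => (alpha x)%:E)).
Context {c : R} (c0 : 0 < c).

Local Notation L := (E -> R^o).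
Local Notation B := (alpha_form p V mu alpha : L -> L -> R).
Local Notation D := (H01 p V : set L).
Context (hc : forall u, D u -> c * Wn p u <= B u u).
Context {f : E -> R -> R}
  (hf : {within V `*` [set: R], continuous (fun z : E * R => f z.1 z.2)}).
Context {lambda : R} (lam0 : 0 < lambda).
Implicit Types u v w : L.

Let hB : psd_form D B := alpha_psd N_ge2 hp hV halpha c0 hc.
Let k : R := (2 * N + 3)%:R / Num.sqrt c.
Let sup_nrm := alpha_nrm_sup N_ge2 hp hV halpha c0 hc.

Let k0 : 0 < k.
Proof. by rewrite divr_gt0 ?sqrtr_gt0 // ltr0n addn3. Qed.

Let cont u : D u -> {within V, continuous u}. Proof. by case. Qed.

Let fcomp u (Du : D u) : {within V, continuous (fun x => f x (u x))} :=
  nonlin_comp hf (cont Du).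

Let Pcomp u (Du : D u) : {within V, continuous (fun x => primitive0 (f x) (u x))} :=
  prim_comp hV hf (cont Du).

Definition action u : R :=
  B u u / 2 + lambda * \int[mu]_(x in V) primitive0 (f x) (u x).

Let cint g (gc : {within V, continuous g}) := cont_integrable hV hmu gc.

Let mV := measurable_gasket hV.

(** The gradient of the integral part, by Riesz representation. *)
Lemma gradient_exists : exists G : L -> L, forall u, D u -> D (G u) /\
  forall v, D v -> B (G u) v = lambda * \int[mu]_(x in V) (f x (u x) * v x).
Proof.
suff /choice[G hG] : forall u, exists w, D u -> D w /\
    forall v, D v -> B w v = lambda * \int[mu]_(x in V) (f x (u x) * v x).
  by exists G.
move=> u; have [Du|nDu] := pselect (D u); last by exists 0.
have fi := cint (fcomp Du).
have [| | | |w Dw hw] := @riesz R L D B hB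
    (fun v => lambda * \int[mu]_(x in V) (f x (u x) * v x))
    (lambda * (k * \int[mu]_(x in V) `|f x (u x)|)).
- exact: (alpha_complete N_ge2 hp hV halpha c0 hc).
- move=> v w Dv Dw; rewrite -mulrDr; congr (_ * _).
  rewrite -RintegralD //; try exact: cint (contM (fcomp Du) (cont _)).
  by apply: eq_Rintegral => x _; rewrite mulrDr.
- move=> a v Dv; rewrite mulrCA; congr (_ * _).
  rewrite -RintegralZl //; last exact: cint (contM (fcomp Du) (cont _)).
  by apply: eq_Rintegral => x _; rewrite [LHS]mulrCA.
- move=> v Dv; rewrite normrM (gtr0_norm lam0) -mulrA; apply: ler_wpM2l; first exact: ltW.
  have bd x (Vx : V x) := sup_nrm Dv Vx.
  by have := Rintegral_mul_bound hV fi (cont Dv) bd; rewrite mulrAC.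
- by exists w.
Qed.

Section WithGradient.
Context {G : L -> L} (hG : forall u, D u -> D (G u) /\
  forall v, D v -> B (G u) v = lambda * \int[mu]_(x in V) (f x (u x) * v x)).

Let DG u (Du : D u) : D (G u) := (hG Du).1.
Let GE u (Du : D u) := (hG Du).2.

Definition gradient u : L := u + G u.

Let Dg u : D u -> D (gradient u).
Proof. by move=> Du; apply: (psd_D hB) => //; exact: DG. Qed.

(** The integral part of the gradient is controlled by the supremum norm, for which
    the balls of the energy space are relatively compact. *)
Lemma grad_sup u w e : D u -> D w -> 0 <= e ->
  (forall x, V x -> `|f x (u x) - f x (w x)| <= e) ->
  nrm B (G u - G w) <= lambda * (e * k).
Proof.
move=> Du Dw e0 he; set z := G u - G w.
have Dz : D z by apply: (psd_B hB); exact: DG.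
have zz : B z z = lambda * \int[mu]_(x in V) ((f x (u x) - f x (w x)) * z x).
  rewrite {1}/z (psd_subl hB) ?GE //; try exact: DG.
  rewrite -mulrBr; congr (_ * _).
  rewrite -RintegralB //; try exact: cint (contM (fcomp _) (cont Dz)).
  by apply: eq_Rintegral => x _; rewrite mulrBl.
have fc : {within V, continuous (fun x => (f x (u x) - f x (w x)) * z x)}.
  by apply: contM (cont Dz) => x; apply: cvgB; exact: fcomp.
have bd : `|\int[mu]_(x in V) ((f x (u x) - f x (w x)) * z x)| <= e * (k * nrm B z).
  apply: (Rintegral_bound hV hmu fc) => x Vx; rewrite normrM.
  by apply: ler_pM => //; [exact: he|exact: sup_nrm].
have [->|z0] := eqVneq (nrm B z) 0; first by rewrite !mulr_ge0 ?(ltW lam0) ?(ltW k0).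
have z1 : 0 < nrm B z by rewrite lt0r z0 nrm_ge0.
rewrite -(ler_pM2r z1) -expr2 (nrm_sqr hB) // zz.
rewrite -mulrA; apply: ler_wpM2l; first exact: ltW.
by apply: le_trans (ler_norm _) _; rewrite -(mulrA e); exact: bd.
Qed.

Lemma grad_norm_bound M : exists2 K, 0 <= K & forall u, D u -> nrm B u <= M ->
  nrm B (G u) <= K.
Proof.
have [F F0 hF] := nonlin_bound hV hf (k * M).
have D0 := psd_0 hB.
exists (lambda * (2 * F * k) + nrm B (G 0)).
  by rewrite addr_ge0 ?nrm_ge0 // !mulr_ge0 ?(ltW lam0) ?(ltW k0).
move=> u Du uM; apply: le_trans (nrm_dist hB (DG Du) (DG D0)) _.
rewrite addrC lerD2r; apply: grad_sup => //; first by rewrite mulr_ge0.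
have M0 : 0 <= M := le_trans (nrm_ge0 u) uM.
move=> x Vx; apply: le_trans (ler_normB _ _) _.
have h1 : `|f x (u x)| <= F.
  by apply: hF => //; apply: le_trans (sup_nrm Du Vx) _; rewrite ler_wpM2l // ltW.
have h2 : `|f x ((0 : L) x)| <= F.
  by apply: hF => //; rewrite normr0 mulr_ge0 // ltW.
lra.
Qed.

Lemma grad_cont M e : 0 < e -> exists2 d, 0 < d & forall u w, D u -> D w ->
  (forall x, V x -> `|u x| <= M) -> (forall x, V x -> `|w x| <= M) ->
  (forall x, V x -> `|u x - w x| < d) -> nrm B (G u - G w) <= e.
Proof.
move=> e0; have [|d d0 hd] := nonlin_unif hV hf M (_ : 0 < e / (lambda * k)).
  by rewrite divr_gt0 // mulr_gt0.
exists d => // u w Du Dw uM wM uw.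
rewrite (_ : e = lambda * (e / (lambda * k) * k)); last first.
  by field; rewrite !lt0r_neq0.
apply: grad_sup => //; first by rewrite divr_ge0 ?(ltW e0) ?(ltW (mulr_gt0 lam0 k0)).
by move=> x Vx; apply: hd; rewrite ?subrr ?normr0 ?uM ?wM ?uw.
Qed.

Lemma action_diff M e : 0 < e -> exists2 d, 0 < d & forall u h, D u -> D h ->
  nrm B u <= M -> nrm B h <= d ->
  `|action (u + h) - action u - B (gradient u) h| <= e * nrm B h.
Proof.
move=> e0; have [|d d0 hd] := prim_diff hV hf (k * M) (_ : 0 < e / 2 / (lambda * k)).
  by rewrite !divr_gt0 // mulr_gt0.
exists (Num.min e (d / k)); first by rewrite lt_min e0 divr_gt0.
move=> u h Du Dh uM; rewrite le_min => /andP[he hdk].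
have Duh : D (u + h) := psd_D hB Du Dh.
pose r x := primitive0 (f x) (u x + h x) - primitive0 (f x) (u x) - f x (u x) * h x.
have rc : {within V, continuous r}.
  move=> x; apply: cvgB; last exact: (contM (fcomp Du) (cont Dh)).
  by apply: cvgB; [exact: (Pcomp Duh)|exact: (Pcomp Du)].
have rE : \int[mu]_(x in V) r x = \int[mu]_(x in V) primitive0 (f x) ((u + h) x)
    - \int[mu]_(x in V) primitive0 (f x) (u x) - \int[mu]_(x in V) (f x (u x) * h x).
  have i1 := cint (Pcomp Duh); have i2 := cint (Pcomp Du).
  have i3 := cint (contM (fcomp Du) (cont Dh)).
  rewrite -RintegralB // -RintegralB //.
  by apply: cint => x; apply: cvgB; [exact: (Pcomp Duh)|exact: (Pcomp Du)].
have -> : action (u + h) - action u - B (gradient u) h =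
    B h h / 2 + lambda * \int[mu]_(x in V) r x.
  rewrite rE /action /gradient (psd_sqrD hB) // (psd_addl hB) // ?GE //; last exact: DG.
  move: (B u u) (B h h) (B u h) (Rintegral _ _ _) (Rintegral _ _ _) (Rintegral _ _ _).
  by move=> *; field.
have bd : `|\int[mu]_(x in V) r x| <= e / 2 / (lambda * k) * (k * nrm B h).
  apply: (Rintegral_bound hV hmu rc) => x Vx.
  have hx : `|h x| <= k * nrm B h by exact: sup_nrm.
  have h1 : `|u x| <= k * M by apply: le_trans (sup_nrm Du Vx) _; rewrite ler_wpM2l // ltW.
  have h2 : `|h x| <= d.
    by apply: le_trans hx _; rewrite mulrC -ler_pdivlMr.
  apply: le_trans (hd x (u x) (h x) Vx h1 h2) _; apply: ler_wpM2l => //.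
  by rewrite !divr_ge0 ?(ltW e0) ?(ltW (mulr_gt0 lam0 k0)).
apply: le_trans (ler_normD _ _) _.
rewrite (_ : e * nrm B h = e * nrm B h / 2
  + lambda * (e / 2 / (lambda * k) * (k * nrm B h))); last first.
  by field; rewrite !lt0r_neq0.
apply: lerD.
  rewrite -(nrm_sqr hB) // ger0_norm ?divr_ge0 ?sqr_ge0 //.
  apply: ler_wpM2r; first by rewrite invr_ge0.
  by rewrite expr2; apply: ler_wpM2r he; exact: nrm_ge0.
by rewrite normrM (gtr0_norm lam0); apply: ler_wpM2l bd; exact: ltW.
Qed.

(** Bounded Palais-Smale sequences: along an ultrafilter the sequence converges
    uniformly, hence the compact part of the gradient converges in norm, hence so
    does the sequence, to minus the gradient part of its uniform limit. *)
Lemma action_ps M a b :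
  (forall d, 0 < d -> exists u,
     [/\ D u, nrm B u <= M, a <= action u <= b & nrm B (gradient u) <= d]) ->
  exists u, [/\ critical D B gradient u, nrm B u <= M & a <= action u <= b].
Proof.
move=> hps.
have /choice[s hs] : forall n : nat, exists u,
    [/\ D u, nrm B u <= M, a <= action u <= b & nrm B (gradient u) <= n.+1%:R^-1].
  by move=> n; apply: hps; rewrite invr_gt0 ltr0n.
have sD n : D (s n) by case: (hs n).
have sM n : nrm B (s n) <= M by case: (hs n).
have M0 : 0 <= M := le_trans (nrm_ge0 _) (sM 0%N).
have sup n x : V x -> `|s n x| <= k * M.
  by move=> Vx; apply: le_trans (sup_nrm (sD n) Vx) _; rewrite ler_wpM2l // ltW.
have [U [UU ooU]] := ultraFilterLemma (F := \oo : set_system nat) _.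
have PU : ProperFilter U by exact: ultra_proper.
have /choice[u hu] : forall x, exists l : R, V x -> s n x @[n --> U] --> l.
  move=> x; have [Vx|nVx] := pselect (V x); last by exists 0.
  have [l hl] := ultra_cvg UU (fun n => sup n x Vx); by exists l.
have sW n : Wn p (s n) <= M ^+ 2 / c.
  rewrite ler_pdivlMr // mulrC; apply: le_trans (hc (sD n)) _.
  by rewrite -(nrm_sqr hB) // ler_sqr ?nnegrE ?nrm_ge0.
have Du : D u := limit_H01 (FF := PU) N_ge2 hp hV sD sW hu.
have uni e (e0 : 0 < e) := limit_uniform (FF := PU) N_ge2 hp hV sD sW hu e0.
have usup x : V x -> `|u x| <= k * M.
  move=> Vx; apply/ler_addgt0Pr => e e0; have [n hn] := filter_ex (uni e e0).
  have := hn x Vx; have := sup n x Vx; rewrite !ler_norml; lra.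
set w : L := - G u.
have Dw : D w := psd_N hB (DG Du).
have gsmall e : 0 < e -> \forall n \near U, nrm B (gradient (s n)) <= e.
  move=> e0; apply: ooU; exists (Num.truncn e^-1) => // n /= hn.
  have [_ _ _ /le_trans] := hs n; apply.
  rewrite -[e]invrK lef_pV2 ?posrE ?invr_gt0 // ?ltr0n //.
  by apply: le_trans (ltW (truncnS_gt _)) _; rewrite ler_nat ltnS.
have conv e : 0 < e -> \forall n \near U, nrm B (s n - w) <= e.
  move=> e0; have e2 : 0 < e / 2 by rewrite divr_gt0.
  have [d d0 hd] := grad_cont (k * M) e2.
  have d2 : 0 < d / 2 by rewrite divr_gt0.
  apply: filterS2 (gsmall _ e2) (uni _ d2) => n h1 h2.
  rewrite (_ : s n - w = gradient (s n) - (G (s n) - G u)); last first.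
    by rewrite /w /gradient opprK opprB addrACA subrr addr0.
  have DGG : D (G (s n) - G u) by apply: (psd_B hB); exact: DG.
  apply: le_trans (nrmB hB (Dg (sD n)) DGG) _.
  have : nrm B (G (s n) - G u) <= e / 2.
    apply: hd => //; first exact: sup.
    by move=> x Vx; apply: le_lt_trans (h2 x Vx) _; lra.
  lra.
have wu x : V x -> w x = u x.
  move=> Vx; apply/eqP; rewrite -subr_eq0 -normr_le0; apply/ler_addgt0Pr => e e0.
  have e2 : 0 < e / 2 by rewrite divr_gt0.
  have [n [h1 h2]] := filter_ex (filterI (conv _ (divr_gt0 e2 k0)) (uni _ e2)).
  have := sup_nrm (psd_B hB (sD n) Dw) Vx; rewrite -/k.
  have : k * nrm B (s n - w) <= e / 2.
    by rewrite mulrC -ler_pdivlMr.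
  have := h2 x Vx; rewrite add0r.
  have -> : (s n - w) x = s n x - w x by [].
  move: (s n x) (w x) (u x) => p1 p2 p3; rewrite !ler_norml; lra.
have crit : critical D B gradient w.
  split=> // v Dv; rewrite /gradient (psd_addl hB) //; last exact: DG.
  rewrite {1}/w (psd_oppl hB) ?GE //; last exact: DG.
  rewrite (_ : \int[mu]_(x in V) (f x (w x) * v x) = \int[mu]_(x in V) (f x (u x) * v x)).
    by rewrite addNr.
  by apply: eq_Rintegral => x; rewrite inE => Vx; rewrite wu.
exists w; split => //.
  apply/ler_addgt0Pr => e e0; have [n hn] := filter_ex (conv e e0).
  apply: le_trans (nrm_dist hB Dw (sD n)) _.
  by rewrite (nrm_distC hB Dw (sD n)) lerD.
have near_action e : 0 < e -> exists n, `|action (s n) - action w| <= e.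
  move=> e0; have [d d0 hd] := action_diff (nrm B w) ltr01.
  have de : 0 < Num.min d e by rewrite lt_min d0.
  have [n hn] := filter_ex (conv _ de).
  exists n; move: hn; rewrite le_min => /andP[h1 h2].
  have Dsw : D (s n - w) := psd_B hB (sD n) Dw.
  have := hd w (s n - w) Dw Dsw (lexx _) h1.
  by rewrite subrKC crit.2 // subr0 mul1r => /le_trans; apply.
apply/andP; split; apply/ler_addgt0Pr => e e0.
  have [n] := near_action e e0; have [_ _ /andP[+ _] _] := hs n.
  by rewrite ler_norml; move: (action (s n)) (action w) => y z *; lra.
have [n] := near_action e e0; have [_ _ /andP[_ +] _] := hs n.
by rewrite ler_norml; move: (action (s n)) (action w) => y z *; lra.
Qed.

Lemma action_smooth : smooth_ps D B action gradient.
Proof.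
split.
- exact: Dg.
- move=> M e e0; have e2 : 0 < e / 2 by rewrite divr_gt0.
  have [d d0 hd] := grad_cont (k * M) e2.
  have dk : 0 < d / 2 / k by apply: divr_gt0 k0; rewrite divr_gt0.
  exists (Num.min (e / 2) (d / 2 / k)); first by rewrite lt_min e2.
  move=> u w Du Dw uM wM; rewrite le_min => /andP[uw1 uw2].
  have M0 : 0 <= M := le_trans (nrm_ge0 _) uM.
  rewrite (_ : gradient u - gradient w = (u - w) + (G u - G w)); last first.
    by rewrite /gradient opprD addrACA.
  have DGG : D (G u - G w) by apply: (psd_B hB); exact: DG.
  apply: le_trans (nrmD hB (psd_B hB Du Dw) DGG) _.
  have : nrm B (G u - G w) <= e / 2.
    apply: hd => // x Vx.
    - by apply: le_trans (sup_nrm Du Vx) _; rewrite ler_wpM2l // ltW.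
    - by apply: le_trans (sup_nrm Dw Vx) _; rewrite ler_wpM2l // ltW.
    - apply: le_lt_trans (sup_nrm (psd_B hB Du Dw) Vx) _.
      apply: (@le_lt_trans _ _ (d / 2)); last by lra.
      by rewrite mulrC -ler_pdivlMr.
  lra.
- move=> M; have [K K0 hK] := grad_norm_bound M; exists (M + K) => u Du uM.
  by apply: le_trans (nrmD hB Du (DG Du)) _; rewrite lerD // hK.
- exact: action_diff.
- exact: action_ps.
Qed.

Lemma critical_weak_solution u : critical D B gradient u ->
  weak_solution p V mu alpha f lambda u.
Proof.
move=> [Du hu]; split => // v Dv; have := hu v Dv.
by rewrite /gradient (psd_addl hB) ?GE //; exact: DG.
Qed.

End WithGradient.

Lemma inner_ext u w v : (forall x, V x -> u x = w x) ->
  energy_inner p u v = energy_inner p w v.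
Proof.
move=> uw; rewrite /energy_inner; congr (limn _); apply/funext => m.
by rewrite !(energy_formE N_ge2 hp hV); apply: (cell_energy_ext hV).
Qed.

Lemma action_ext u w : D u -> D w -> (forall x, V x -> u x = w x) ->
  action u = action w.
Proof.
move=> Du Dw uw; rewrite /action /alpha_form.
rewrite (inner_ext _ uw) (innerC N_ge2 hp hV Dw Du) (inner_ext _ uw).
have -> : \int[mu]_(x in V) (alpha x * u x * u x) =
    \int[mu]_(x in V) (alpha x * w x * w x).
  by apply: eq_Rintegral => x; rewrite inE => Vx; rewrite uw.
have -> // : \int[mu]_(x in V) primitive0 (f x) (u x) =
    \int[mu]_(x in V) primitive0 (f x) (w x).
by apply: eq_Rintegral => x; rewrite inE => Vx; rewrite uw.
Qed.

(** As f(x, 0) has a constant sign, it cannot be orthogonal to a function that is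
    positive off the vertices. *)
Lemma weak_solution_neq0 u : (forall x, V x -> f x 0 <> 0) ->
  weak_solution p V mu alpha f lambda u -> exists2 x, V x & u x <> 0.
Proof.
move=> f0 [Du hu]; apply: contrapT => nz.
have uz x : V x -> u x = (0 : L) x.
  by move=> Vx; apply: contrapT => ux; apply: nz; exists x.
have [e [De e0 ez]] := test_function N_ge2 hp hV.
have D0 := psd_0 hB.
have := hu e De.
have -> : energy_inner p u e - \int[mu]_(x in V) (alpha x * u x * e x) = 0.
  have <- : B 0 e = 0 by rewrite -(scale0r (0 : L)) (psd_scalel hB) // mul0r.
  rewrite /alpha_form (inner_ext _ uz); congr (_ - _).
  by apply: eq_Rintegral => x; rewrite inE => Vx; rewrite uz.
rewrite add0r (_ : \int[mu]_(x in V) (f x (u x) * e x) =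
    \int[mu]_(x in V) (f x 0 * e x)); last first.
  by apply: eq_Rintegral => x; rewrite inE => Vx; rewrite uz.
move=> /eqP; rewrite mulf_eq0 (gt_eqF lam0) /= => /eqP I0.
have fc : {within V, continuous (fun x => f x 0)} := fcomp D0.
have [fp|fn] := const_sign hV fc f0.
  suff : 0 < \int[mu]_(x in V) (f x 0 * e x) by rewrite I0 ltxx.
  apply: (Rintegral_gt0 N_ge2 hV hmu (contM fc (cont De))) => x Vx.
    by rewrite mulr_ge0 ?e0 // ltW // fp.
  by move=> /eqP; rewrite mulf_eq0 (gt_eqF (fp x Vx)) => /eqP; exact: ez.
suff : 0 < \int[mu]_(x in V) (-1 * (f x 0 * e x)).
  by rewrite RintegralZl ?I0 ?mulr0 ?ltxx //; exact: cint (contM fc (cont De)).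
have nfc : {within V, continuous (fun x => -1 * (f x 0 * e x))}.
  apply: contM (contM fc (cont De)).
  by apply: continuous_subspaceT => x; exact: cst_continuous.
apply: (Rintegral_gt0 N_ge2 hV hmu nfc) => x Vx; rewrite mulN1r -mulNr.
  by rewrite mulr_ge0 ?e0 // ltW // fn.
by move=> /eqP; rewrite mulf_eq0 (gt_eqF (fn x Vx)) => /eqP; exact: ez.
Qed.

Context {nu r0 : R} (hnu : 2 < nu) (hr0 : 0 < r0).
Context (hAR : forall (t : R) x, r0 <= `|t| -> V x ->
  t * f x t <= nu * primitive0 (f x) t /\ nu * primitive0 (f x) t < 0).

(** Functions of norm at most sqrt rho take values of modulus at most k sqrt rho,
    where the primitive is bounded by S.  So the functional is positive near the
    sphere of radius sqrt rho, which gives a critical point inside at a level <= 0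
    and, by the mountain pass over this sphere, another at a level > 0. *)
Lemma two_weak_solutions (rho S : R) : 0 < rho -> lambda * (2 * S) < rho ->
  (forall x t, V x -> `|t| <= k * Num.sqrt rho -> `|primitive0 (f x) t| <= S) ->
  exists u1 u2, [/\ weak_solution p V mu alpha f lambda u1,
    weak_solution p V mu alpha f lambda u2,
    exists2 x, V x & u1 x <> u2 x & nrm B u1 < Num.sqrt rho].
Proof.
move=> rho0 lS hS; have [G hG] := gradient_exists.
have hI := action_smooth hG.
have D0 := psd_0 hB.
set s := Num.sqrt rho; have s0 : 0 < s by rewrite sqrtr_gt0.
have s2 : s ^+ 2 = rho by rewrite sqr_sqrtr // ltW.
have ball_low u : D u -> nrm B u <= s -> nrm B u ^+ 2 / 2 - lambda * S <= action u.
  move=> Du us; rewrite /action (nrm_sqr hB) // lerD2l -mulrN; apply: ler_wpM2l; first exact: ltW.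
  have : `|\int[mu]_(x in V) primitive0 (f x) (u x)| <= S.
    apply: (Rintegral_bound hV hmu (Pcomp Du)) => x Vx; apply: hS => //.
    by apply: le_trans (sup_nrm Du Vx) _; rewrite ler_wpM2l // ltW.
  by rewrite ler_norml => /andP[].
pose gap := rho - lambda * (2 * S).
have gap0 : 0 < gap by rewrite subr_gt0.
(* On the rim, (nrm u) ^ 2 / 2 - rho / 2 >= - s e0 = - gap / 4. *)
pose e0 := gap / (4 * s).
have e00 : 0 < e0 by rewrite divr_gt0 // mulr_gt0.
have m00 : 0 < gap / 4 by rewrite divr_gt0.
have I0 : action 0 = 0.
  have B0 : B 0 0 = 0 by rewrite -(nrm_sqr hB D0) (nrm0 hB) expr0n.
  rewrite /action B0 mul0r add0r (_ : \int[mu]_(x in V) _ = 0) ?mulr0 //.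
  rewrite -(Rintegral_cst1 hV hmu 0); apply: eq_Rintegral => x; rewrite inE => Vx.
  exact: (primitive0_0 (nonlin_cont hf Vx)).
have rim u : D u -> s - e0 <= nrm B u <= s -> gap / 4 <= action u.
  move=> Du /andP[h1 h2]; apply: le_trans (ball_low u Du h2).
  have := sqr_ge0 (nrm B u - s); rewrite sqrrB s2 => h3.
  have : 2 * s * (s - e0) <= 2 * s * nrm B u by rewrite ler_wpM2l // mulr_ge0 // ltW.
  have -> : 2 * s * (s - e0) = 2 * s ^+ 2 - gap / 2.
    by rewrite /e0; field; rewrite lt0r_neq0.
  rewrite s2 /gap; lra.
have low u : D u -> nrm B u <= s -> - (lambda * S) <= action u.
  move=> Du us; apply: le_trans (ball_low u Du us).
  by have := sqr_ge0 (nrm B u); lra.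
have [u1 [c1 n1 i1]] := critical_in_ball hB hI (ltW s0) e00 m00 I0 low rim.
have [e [De epos ez]] := test_function N_ge2 hp hV.
have ec := cont De.
have q0 : 0 < \int[mu]_(x in V) (e x * e x).
  apply: (Rintegral_gt0 N_ge2 hV hmu (contM ec ec)) => x Vx; first by rewrite mulr_ge0 ?epos.
  by move=> /eqP; rewrite mulf_eq0 orbb => /eqP; exact: ez.
set q := \int[mu]_(x in V) (e x * e x) in q0.
have ne : 0 < nrm B e.
  rewrite lt0r nrm_ge0 andbT; apply/negP => /eqP e0'.
  have : `|q| <= 0.
    apply: (Rintegral_bound hV hmu (contM ec ec)) => x Vx.
    have := sup_nrm De Vx; rewrite e0' mulr0 normr_le0 => /eqP->.
    by rewrite mul0r normr0.
  by rewrite normr_le0 => /eqP q0'; rewrite q0' ltxx in q0.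
(* With this A the quadratic terms along the ray cancel. *)
pose A := nrm B e ^+ 2 / (2 * lambda * q).
have A0 : 0 < A by rewrite divr_gt0 ?exprn_gt0 // !mulr_gt0.
have [Cs Cs0 hCs] := prim_superquadratic hV hf hnu hr0 hAR A0.
have ray t : 0 <= t -> action (t *: e) <= lambda * Cs.
  move=> t0; have Dte : D (t *: e) := psd_Z hB t De.
  have h : \int[mu]_(x in V) primitive0 (f x) ((t *: e) x) <= Cs - A * t ^+ 2 * q.
    have cc : {within V, continuous (fun x => Cs - A * t ^+ 2 * (e x * e x))}.
      move=> x; apply: cvgB; first exact: cvg_cst.
      by apply: cvgM; [exact: cvg_cst|exact: (contM ec ec)].
    have cst a : {within V, continuous (fun=> a : R)}.
      by apply: continuous_subspaceT => x; exact: cst_continuous.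
    apply: le_trans (cont_le_Rintegral hV hmu (Pcomp Dte) cc _) _.
      move=> x Vx; have te0 : 0 <= (t *: e) x by apply: mulr_ge0 => //; exact: epos.
      apply: le_trans (hCs x _ Vx te0) _.
      rewrite (_ : (t *: e) x = t * e x) // exprMn expr2 -!expr2 mulrA; exact: lexx.
    rewrite RintegralB //; last 2 first.
    - exact: cint (cst Cs).
    - exact: cint (contM (cst (A * t ^+ 2)) (contM ec ec)).
    rewrite RintegralZl //; last exact: cint (contM ec ec).
    by rewrite (Rintegral_cst1 hV hmu).
  rewrite /action (psd_sqrZ hB) // -(nrm_sqr hB) //.
  apply: (@le_trans _ _ (t ^+ 2 * nrm B e ^+ 2 / 2 + lambda * (Cs - A * t ^+ 2 * q))).
    by rewrite lerD2l; apply: ler_wpM2l h; exact: ltW.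
  rewrite le_eqVlt; apply/orP; left; apply/eqP; rewrite /A; field.
  by rewrite !lt0r_neq0.
have radial : exists r, forall u, D u -> r <= nrm B u -> action u <= lambda * Cs + 1 ->
    B (@gradient G u) u <= 0.
  have [C C0 hC] := prim_AR hV hf hnu hr0 hAR.
  have nu0 : 0 < nu by exact: lt_trans hnu.
  (* z = 1/2 - 1/nu is the coefficient of (nrm u) ^ 2 in I u - I'(u) u / nu. *)
  pose z := (nu - 2) / (2 * nu).
  have z0 : 0 < z by rewrite divr_gt0 ?mulr_gt0 // subr_gt0.
  pose Q := (lambda * Cs + 1 + lambda * C) / z.
  exists (Num.max Q 1) => u Du; rewrite ge_max => /andP[uQ u1'] Iu.
  have fu := contM (fcomp Du) (cont Du).
  have h : - C <= \int[mu]_(x in V) primitive0 (f x) (u x)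
      - \int[mu]_(x in V) (f x (u x) * u x) / nu.
    have -> : \int[mu]_(x in V) (f x (u x) * u x) / nu =
        \int[mu]_(x in V) (f x (u x) * u x / nu).
      by rewrite RintegralZr //; exact: cint.
    have cst : {within V, continuous (fun=> nu^-1 : R)}.
      by apply: continuous_subspaceT => x; exact: cst_continuous.
    rewrite -RintegralB //; [|exact: cint (Pcomp Du)|exact: cint (contM fu cst)].
    rewrite -(Rintegral_cst1 hV hmu (- C)).
    apply: (cont_le_Rintegral hV hmu) => [||x Vx]; last exact: hC.
      by apply: continuous_subspaceT => x; exact: cst_continuous.
    by move=> x; apply: cvgB; [exact: (Pcomp Du)|exact: (contM fu cst)].
  have [DGu GE] := hG u Du.
  rewrite /gradient (psd_addl hB) // GE //.
  move: Iu; rewrite /action -(nrm_sqr hB) // => Iu.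
  set J := \int[mu]_(x in V) (f x (u x) * u x) in h *.
  set P := \int[mu]_(x in V) primitive0 (f x) (u x) in h Iu.
  have n2 : Q <= nrm B u ^+ 2.
    by apply: le_trans uQ _; rewrite expr2 ler_peMl // nrm_ge0.
  move: n2; rewrite /Q ler_pdivrMr // => n2.
  have lP := ler_wpM2l (ltW lam0) h.
  have : (nrm B u ^+ 2 + lambda * J) / nu <= 0.
    have -> : (nrm B u ^+ 2 + lambda * J) / nu =
      (nrm B u ^+ 2 / 2 + lambda * P) - nrm B u ^+ 2 * z - lambda * (P - J / nu).
      by rewrite /z; field; rewrite lt0r_neq0.
    rewrite mulrN in lP; rewrite -addrA -opprD subr_le0; apply: le_trans Iu _.
    by have := lerD n2 lP; rewrite addrK.
  by rewrite ler_pdivrMr // mul0r.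
have [u2 [c2 i2]] := mountain_pass hB hI (ltW s0) e00 m00 I0 rim De ne ray radial.
exists u1, u2; split.
- exact (critical_weak_solution hG c1).
- exact (critical_weak_solution hG c2).
- apply: contrapT => same; move: i1; rewrite (action_ext c1.1 c2.1) ?leNgt ?i2 //.
  by move=> x Vx; apply: contrapT => ne12; apply: same; exists x.
- by [].
Qed.

End Functional.


Unset Implicit Arguments.

Theorem theorem1p1 (R : realType) (N : nat) (hN : (2 <= N)%N)
    (p : 'I_N -> 'rV[R]_N.-1) (hp : unit_simplex p)
    (V : set 'rV[R]_N.-1) (hV : gasket p V)
    (mu : {measure set (borelRn R N.-1) -> \bar R})
    (hmu : gasket_measure V mu)
    (alpha : 'rV[R]_N.-1 -> R)
    (halpha : mu.-integrable V (fun x => (alpha x)%:E))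
    (kappa : R)
    (hkappa :
      ({ae mu, forall x, V x -> alpha x <= 0} /\
        kappa = (2 * N + 3)%:R)
      \/
      (\int[mu]_(x in V) `|alpha x| < 1 / (2 * N + 3)%:R ^+ 2 /\
        kappa = (2 * N + 3)%:R /
          Num.sqrt (1 - (2 * N + 3)%:R ^+ 2 * \int[mu]_(x in V) `|alpha x|)))
    (f : 'rV[R]_N.-1 -> R -> R)
    (hf : {within V `*` [set: R],
             continuous (fun z : 'rV[R]_N.-1 * R => f z.1 z.2)})
    (hf0 : forall x, V x -> f x 0 <> 0)
    (nu r0 : R) (hnu : 2 < nu) (hr0 : 0 < r0)
    (hAR : forall (t : R) (x : 'rV[R]_N.-1), r0 <= `|t| -> V x ->
       t * f x t <= nu * primitive0 (f x) t /\ nu * primitive0 (f x) t < 0)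
    (rho : R) (hrho : 0 < rho)
    (lambda : R) (hlambda0 : 0 < lambda)
    (hlambda : lambda < rho /
       (2 * sup [set `|primitive0 (f x) s| | x in V
                   & s in [set s : R | `|s| <= kappa * Num.sqrt rho]])) :
  exists u1 u2 : 'rV[R]_N.-1 -> R,
    [/\ weak_solution p V mu alpha f lambda u1,
        weak_solution p V mu alpha f lambda u2,
        (exists2 x, V x & u1 x <> 0),
        (exists2 x, V x & u2 x <> 0) &
        (exists2 x, V x & u1 x <> u2 x) /\
        alpha_norm p V mu alpha u1 < Num.sqrt rho].
Proof.
have [c c0 [kE hc]] := alpha_coercive hN hp hV halpha hkappa.
set S := sup _ in hlambda.
have k0 : 0 <= kappa * Num.sqrt rho.
  by rewrite kE mulr_ge0 ?sqrtr_ge0 // divr_ge0 ?sqrtr_ge0 ?ler0n.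
have hS x t : V x -> `|t| <= kappa * Num.sqrt rho -> `|primitive0 (f x) t| <= S.
  move=> Vx tk; apply: ub_le_sup; last by exists x => //; exists t.
  have [M _ hM] := prim_bound hV hf (kappa * Num.sqrt rho).
  by exists M => _ [y Vy [s sk <-]]; exact: hM.
have [z Vz] : V !=set0 by case: hV.
have S0 : 0 <= S.
  by apply: le_trans (hS z 0 Vz _); rewrite ?normr0.
have lS : lambda * (2 * S) < rho.
  move: S0; rewrite le_eqVlt => /predU1P[S0|S0].
    by rewrite -S0 !mulr0.
  by rewrite -ltr_pdivlMr // mulr_gt0.
rewrite kE in hS.
have [u1 [u2 [w1 w2 ne12 n1]]] := two_weak_solutions hN hp hV hmu halpha c0 hc hf
  hlambda0 hnu hr0 (fun t x => hAR t x) hrho lS hS.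
exists u1, u2; split => //.
- exact: (weak_solution_neq0 hN hp hV hmu halpha c0 hc hf hlambda0 hf0 w1).
- exact: (weak_solution_neq0 hN hp hV hmu halpha c0 hc hf hlambda0 hf0 w2).
split=> //; apply: le_lt_trans n1; rewrite /alpha_norm /nrm.
rewrite (alpha_form_Wn hN hp hV) //; last by case: w1.
rewrite /Wn (_ : (fun x => alpha x * `|u1 x| ^+ 2) = fun x => alpha x * u1 x * u1 x) //.
by apply/funext => x; rewrite real_normK ?num_real // expr2 mulrA.
Qed.
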